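(* Let $(W,S)$ be a finite Coxeter system. Let $v,w,v',w'\in W$ be such that $v\leq w$, $v'\leq w'$, $wv^{-1}=w'v'^{-1}$, $m=\ell(v,w)=\ell(v',w')$. Let $s_{\beta_1}\cdots s_{\beta_\ell}$ be a reduced expression of $w'$. Let $\alpha_i=s_{\beta_1}\cdots s_{\beta_{i-1}}(\beta_i)$ and $\alpha_i'=s_{\beta_\ell}\cdots s_{\beta_{i+1}}(\beta_i)$ for all $1\leq i\leq\ell$. For $J\subseteq\{1,\ldots,\ell\}$ let $\bar J$ denote its complement in $\{1,\ldots,\ell\}$. Then $c_{w/v,w'/v'}$ is equal to the number of subsets $J=\{1\leq j_1<\cdots<j_m\leq\ell\}$ of $\{1,\ldots,\ell\}$ such that $v'=\prod_{j\in\bar J}s_{\beta_j}$ and \[ v\lessdot s_{\alpha_{j_1}}v\lessdot\cdots\lessdot s_{\alpha_{j_{m-1}}}\cdots s_{\alpha_{j_1}}v\lessdot s_{\alpha_{j_m}}\cdots s_{\alpha_{j_1}}v=w, \] and equivalently $c_{w^{-1}/v^{-1},w'^{-1}/v'^{-1}}$ is equal to the number of subsets $J=\{1\leq j_1<\cdots<j_m\leq\ell\}$ of $\{1,\ldots,\ell\}$ such that $v'=\prod_{j\in\bar J}s_{\beta_j}$ and \[ v\lessdot vs_{\alpha_{j_m}'}\lessdot\cdots\lessdot vs_{\alpha_{j_m}'}\cdots s_{\alpha_{j_2}'}\lessdot vs_{\alpha_{j_m}'}\cdots s_{\alpha_{j_1}'}=w. \] In particular, these two cardinalities are independent of the choice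 of the reduced expression of $w'$.
   Context: Coxeter setup. $(W,S)$ is a Coxeter system with $W$ finite; $m(s,s')$ is the order of $ss'$. $\mathfrak h_{\mathbb R}$ is a real vector space with basis $\Delta$ (the simple roots), in bijection with $S$ via $\beta\mapsto s_\beta$, with symmetric bilinear form $B(\beta,\beta')=-\cos(\pi/m(s_\beta,s_{\beta'}))$. $W$ acts by $s_\beta(x)=x-2B(x,\beta)\beta$. $R=\{u(\beta):u\in W,\beta\in\Delta\}$ is the root system, $R^+$ the set of roots that are nonnegative linear combinations of $\Delta$. For $\alpha=u(\beta)\in R$, $s_\alpha=us_\beta u^{-1}$. $\ell(\cdot)$ is the length function, $\ell(v,w)=\ell(w)-\ell(v)$, $\leq$ the (strong) Bruhat order, $\lessdot$ its covering relation. Products $\prod_{j\in J}$ over a finite set $J$ of integers are taken in increasing order of the index (empty product $=1$). Nichols algebra $\mathscr B_W$. $V_W$ is the complex vector space spanned by symbols $x_\alpha$ ($\alpha\in R$) modulo $x_{-\alpha}=-x_\alpha$; $\{x_\alpha:\alpha\in R^+\}$ is a basis. $W$ acts by $ux_\alpha=x_{u(\alpha)}$, and $V_W$ is $W$-graded with $x_\alpha$ of degree $s_\alpha$. The braiding is $\Psi(x_\alpha\otimes y)=s_\alpha y\otimes x_\alpha$ on $V_W^{\otimes 2}$. For $\sigma$ in the symmetric group $\mathbb S_m$ with reduced expression $s_{i_1}\cdots s_{i_k}$, $\Psi_\sigma=\Psi_{i_1}\cdots\Psi_{i_k}$ on $V_W^{\otimes m}$, where $\Psi_i$ is $\Psi$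 applied to factors $i,i+1$; the braided factorial is $[m]!=\sum_{\sigma\in\mathbb S_m}\Psi_\sigma$. $\mathscr B_W=T(V_W)/\bigoplus_m\ker[m]!$. $T(V_W)$, with multiplicatively extended $W$-action and $W$-grading, is a braided Hopf algebra: $\Delta$ is the algebra homomorphism to $T(V_W)\otimes T(V_W)$ with twisted multiplication $(a\otimes b)\cdot(c\otimes d)=a(gc)\otimes bd$ for $b$ of $W$-degree $g$, and $\Delta(x)=x\otimes1+1\otimes x$ for $x\in V_W$. This structure descends to $\mathscr B_W$. Pairing. $\langle-,-\rangle:\mathscr B_W\otimes\mathscr B_W\to\mathbb C$ is the nondegenerate symmetric bilinear form that vanishes between components of different $\mathbb Z_{\geq0}$-degree and on degree $m$ is induced by $(y,z)\mapsto \mathrm{ev}(y,[m]!z)$ for $y,z\in V_W^{\otimes m}$, where $\mathrm{ev}(y_1\otimes\cdots\otimes y_m,z_1\otimes\cdots\otimes z_m)=\prod_{i=1}^m\langle y_i,z_{m+1-i}\rangle$ and $\langle x_\alpha,x_{\alpha'}\rangle=\delta_{\alpha,\alpha'}$ for $\alpha,\alpha'\in R^+$. Elements. For $w\in W$ with reduced expression $s_{\gamma_1}\cdots s_{\gamma_k}$, $x_w=x_{\gamma_1}\cdots x_{\gamma_k}\in\mathscr B_W$ (well defined; the $x_w$, $w\in W$, are linearly independent). The elements $x_{w/v}\in\mathscr B_W$ for $v\leq w$ are uniquely determined by $\Delta(x_w)=\sum_{v\leq w}x_{w/v}\otimes x_v$; $x_{w/v}=0$ if $v\not\leq w$. The linear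 map $\bar{\mathscr S}:\mathscr B_W\to\mathscr B_W$ is defined by $\bar{\mathscr S}(x)=(-1)^m\rho(\mathscr S(x))$ for $x$ of $\mathbb Z_{\geq0}$-degree $m$, where $\mathscr S$ is the braided antipode and $\rho$ is the anti-algebra involution fixing all $x_\alpha$; explicitly $\bar{\mathscr S}(x_{\alpha_1}\cdots x_{\alpha_m})=x_{\alpha_1}(s_{\alpha_1}x_{\alpha_2})\cdots(s_{\alpha_1}\cdots s_{\alpha_{m-1}}x_{\alpha_m})$. Invariant. For $v,w,v',w'\in W$, $c_{w/v,w'/v'}=\langle x_{w/v},\bar{\mathscr S}(x_{w'/v'})\rangle$. *)

(* Defs.v *)
From HB Require Import structures.
From mathcomp Require Import all_boot all_order all_algebra all_fingroup.
From mathcomp Require Import complex ring_quotient.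
From mathcomp Require Import boolp classical_sets reals trigo.
From mathcomp Require Import finmap monalg.

Set Implicit Arguments.
Unset Strict Implicit.
Unset Printing Implicit Defensive.

Import Order.TTheory GRing.Theory Num.Theory.

Local Open Scope ring_scope.

(* Used both for a Coxeter system and for the symmetric groups acting on    *)
(* tensor powers.                                                           *)
Section Words.
Variables (gT : finGroupType) (I : finType) (s : I -> gT).

Definition wprod (r : seq I) : gT := (\prod_(i <- r) s i)%g.

Definition has_word (w : gT) (k : nat) : bool :=
  [exists t : k.-tuple I, wprod t == w].

(* When s generates gT, the least k with has_word w k is less than #|gT|.   *)
Definition len (w : gT) : nat := find (has_word w) (iota 0 #|gT|).

Definition reduced_expr (w : gT) (r : seq I) : bool :=
  (wprod r == w) && (size r == len w).

Definition redword (w : gT) : seq I :=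
  if [pick t : (len w).-tuple I | wprod t == w] is Some t then val t else [::].

End Words.

Section CoxeterSystem.
Variables (gT : finGroupType) (S : {set gT}).

(* The last clause is the universal property of the presentation            *)
(* < S | (s t)^m(s,t) = 1 >; it ranges over arbitrary groups H, and f is    *)
(* only relevant on S.                                                      *)
Definition coxeter_system : Prop :=
  [/\ <<S>>%g = [set: gT],
      forall s, s \in S -> #[s]%g = 2%N
    & forall (H : groupType) (f : gT -> H),
        (forall s t, s \in S -> t \in S ->
           (f s * f t) ^+ #[(s * t)%g]%g = 1)%g ->
        exists phi : gT -> H,
          (forall x y, phi (x * y) = phi x * phi y)%g /\
          (forall s, s \in S -> phi s = f s)].

(* The simple roots, hence the simple reflections, are indexed by 'I_#|S|.  *)
Definition sgen (i : 'I_#|S|) : gT := enum_val i.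

Definition ell : gT -> nat := len sgen.

Definition reflections : {set gT} :=
  [set (s ^ u)%g | s in S, u in [set: gT]].

Definition bruhat_step : rel gT := fun v w =>
  [exists t in reflections, w == (v * t)%g] && (ell v < ell w)%N.

Definition bruhat : rel gT := connect bruhat_step.

Definition bruhat_cover : rel gT := fun v w =>
  [&& v != w, bruhat v w
    & [forall u, bruhat v u && bruhat u w ==> (u == v) || (u == w)]].

End CoxeterSystem.

Section RootSystem.
Variables (R : realType) (gT : finGroupType) (S : {set gT}).

Local Notation n := #|S|.
Local Notation s := (@sgen gT S).

Definition simple_root (i : 'I_n) : 'rV[R]_n := delta_mx 0 i.

Definition coxeter_matrix : 'M[R]_n :=
  \matrix_(i, j) - cos (pi / #[(s i * s j)%g]%g%:R).

Definition coxeter_form (x y : 'rV[R]_n) : R :=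
  (x *m coxeter_matrix *m y^T) 0 0.

Definition refl_simple (i : 'I_n) (x : 'rV[R]_n) : 'rV[R]_n :=
  x - (2 * coxeter_form x (simple_root i)) *: simple_root i.

(* The action of W; for a Coxeter system the reflections satisfy the        *)
(* defining relations, so any expression of u gives the same map.           *)
Definition coxact (u : gT) (x : 'rV[R]_n) : 'rV[R]_n :=
  foldr refl_simple x (redword s u).

Definition coxeter_roots : seq 'rV[R]_n :=
  undup [seq coxact u (simple_root i) | u <- enum gT, i <- enum 'I_n].

Definition positive_roots : seq 'rV[R]_n :=
  [seq a : 'rV[R]_n <- coxeter_roots | [forall i, 0 <= a 0 i]].

Definition root_reflection (a : 'rV[R]_n) : gT :=
  if [pick p : gT * 'I_n | coxact p.1 (simple_root p.2) == a] is Some p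
  then (p.1 * s p.2 * p.1^-1)%g else 1%g.

Definition pos_root : finType := seq_sub positive_roots.

End RootSystem.

Section LinearExtension.
Variables (F : nzRingType) (K : choiceType) (M : lmodType F) (f : K -> M).

Definition lin_ext (a : {malg F[K]}) : M := \sum_(k <- msupp a) a@_k *: f k.

Lemma lin_extEw (a : {malg F[K]}) (d : {fset K}) :
  (msupp a `<=` d)%fset -> lin_ext a = \sum_(k <- d) a@_k *: f k.
Proof.
move=> /fsubsetP sad; rewrite /lin_ext.
rewrite [RHS](bigID (mem (msupp a))) /= [X in _ + X]big1 ?addr0; last first.
  by move=> k; rewrite -mcoeff_eq0 => /eqP ->; rewrite scale0r.
rewrite -[RHS]big_filter; apply: perm_big; apply: uniq_perm.
- exact: fset_uniq.
- by rewrite filter_uniq ?fset_uniq.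
- move=> k; rewrite mem_filter /=.
  by case: (boolP (k \in msupp a)) => // /sad ->.
Qed.

Lemma lin_ext_linear : linear lin_ext.
Proof.
move=> c a b; set d := (msupp a `|` msupp b)%fset.
have sa : (msupp a `<=` d)%fset by exact: fsubsetUl.
have sb : (msupp b `<=` d)%fset by exact: fsubsetUr.
have sab : (msupp (c *: a + b) `<=` d)%fset.
  apply/fsubsetP => k; rewrite -mcoeff_neq0 mcoeffD mcoeffZ in_fsetU.
  apply: contraR; rewrite negb_or -!mcoeff_eq0 => /andP[/eqP -> /eqP ->].
  by rewrite mulr0 addr0.
rewrite (lin_extEw sa) (lin_extEw sb) (lin_extEw sab) scaler_sumr -big_split /=.
by apply: eq_bigr => k _; rewrite mcoeffD mcoeffZ scalerDl scalerA.
Qed.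

HB.instance Definition _ :=
  GRing.isLinear.Build F {malg F[K]} M *:%R lin_ext lin_ext_linear.

End LinearExtension.

Section NicholsAlgebra.
Variables (R : realType) (gT : finGroupType) (S : {set gT}).

Local Notation n := #|S|.
Local Notation C := (complex R).
Local Notation root := 'rV[R]_n.
Local Notation pos := (pos_root R S).

(* T(V_W) as the free algebra on the basis {x_a : a positive root} of V_W:  *)
(* linear combinations of words in the positive roots.                      *)
Definition word : choiceType := {fmonom pos}.
Definition tensor_alg : lalgType C := {malg C[word]}.
Local Notation T := tensor_alg.

Definition mono (k : word) : T := << k >>.
Definition letter (p : pos) : T := mono (FMonom [:: p]).

(* x_a for an arbitrary root a, with x_(-a) = - x_a. *)
Definition xroot (a : root) : T :=
  if insub a is Some p then letter p
  else if insub (- a) is Some p then - letter p else 0.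

Definition word_deg (k : word) : gT :=
  (\prod_(p <- (k : seq pos)) root_reflection (val p))%g.

Definition tensor_act (u : gT) : T -> T :=
  lin_ext (fun k : word => \prod_(p <- (k : seq pos)) xroot (coxact u (val p))).

(* The braiding x_p (x) x_q |-> s_p x_q (x) x_p on factors i, i + 1         *)
(* (counted from 0).                                                        *)
Definition braid (i : nat) : T -> T :=
  lin_ext (fun k : word =>
    if drop i k is [:: p, q & r] then
      mono (FMonom (take i k))
      * (xroot (coxact (root_reflection (val p)) (val q)) * letter p)
      * mono (FMonom r)
    else mono k).

Definition adj_tperm (m : nat) (i : 'I_m) : 'S_m.+1 :=
  tperm (widen_ord (leqnSn m) i) (lift ord0 i).

(* The product of 'S_m composes from left to right; this does not affect    *)
(* the braided factorial, as inversion permutes 'S_m.                       *)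
Definition braid_perm (m : nat) (sigma : 'S_m.+1) (a : T) : T :=
  foldr (fun i : 'I_m => braid i) a (redword (@adj_tperm m) sigma).

Definition braided_fact_at (m : nat) (a : T) : T :=
  if m is m'.+1 then \sum_(sigma : 'S_m'.+1) braid_perm sigma a else a.

(* The direct sum over m of the operators [m]!, so that its kernel is the   *)
(* direct sum of the kernels.                                               *)
Definition braided_fact : T -> T :=
  lin_ext (fun k : word => braided_fact_at (size k) (mono k)).

Definition nichols_ker : {pred T} := fun a => braided_fact a == 0.

Lemma nichols_ker_zmod_closed : zmod_closed nichols_ker.
Proof.
split=> [|a b /eqP Ha /eqP Hb]; rewrite unfold_in /braided_fact.
  by rewrite linear0.
by rewrite linearB /= [X in X - _]Ha [X in _ - X]Hb subrr.
Qed.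

HB.instance Definition _ :=
  GRing.isZmodClosed.Build T nichols_ker nichols_ker_zmod_closed.

Definition nichols : zmodType := Quotient.quot nichols_ker.
Local Notation B := nichols.

Definition nclass (a : T) : B := \pi_(Quotient.quot nichols_ker)%qT a.
Definition nrepr (b : B) : T :=
  generic_quotient.repr (b : Quotient.quot nichols_ker).

(* T(V_W) (x) T(V_W) has the pairs of words as a basis. *)
Definition tensor2 : lmodType C := {malg C[(word * word)%type]}.
Local Notation T2 := tensor2.

Definition mono2 (kl : word * word) : T2 := << kl >>.

Definition tens (a b : T) : T2 :=
  lin_ext (fun k => lin_ext (fun l => mono2 (k, l)) b) a.

(* The twisted multiplication (a (x) b)(c (x) d) = a (g c) (x) b d. *)
Definition tmul (t u : T2) : T2 :=
  lin_ext (fun ab : word * word =>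
    lin_ext (fun cd : word * word =>
      tens (mono ab.1 * tensor_act (word_deg ab.2) (mono cd.1))
           (mono ab.2 * mono cd.2)) u) t.

Definition coprod : T -> T2 :=
  lin_ext (fun k : word =>
    foldr (fun p acc => tmul (tens (letter p) 1 + tens 1 (letter p)) acc)
          (tens 1 1) (k : seq pos)).

Definition counit (a : T) : C := a@_(FMonom [::] : word).

(* mu o (f (x) g) o coprod *)
Definition convol (f g : T -> T) (a : T) : T :=
  lin_ext (fun kl : word * word => f (mono kl.1) * g (mono kl.2)) (coprod a).

Definition is_antipode (f : T -> T) : Prop :=
  [/\ linear f,
      forall a, convol f id a = counit a *: 1
    & forall a, convol id f a = counit a *: 1].

Definition antipode : T -> T := xget (id : T -> T) [set f | is_antipode f]%classic.

Definition rho : T -> T := lin_ext (fun k : word => mono (FMonom (rev k))).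

Definition sbar_tensor : T -> T :=
  lin_ext (fun k : word => (-1) ^+ size k *: rho (antipode (mono k))).

Definition ev_word (y z : word) : C :=
  if size y == size z then
    \prod_(p <- zip (y : seq pos) (rev z)) (p.1 == p.2)%:R
  else 0.

Definition ev (y z : T) : C :=
  \sum_(k <- msupp y) \sum_(l <- msupp z) y@_k * z@_l * ev_word k l.

Definition pairing_tensor (y z : T) : C := ev y (braided_fact z).

(* nichols (x) nichols: the quotient of T (x) T by N (x) T + T (x) N, where *)
(* N = nichols_ker.                                                         *)
Definition nichols2_ker : {pred T2} := fun t =>
  `[< exists r : seq (T * T),
        (forall p, p \in r -> p.1 \in nichols_ker \/ p.2 \in nichols_ker) /\
        t = \sum_(p <- r) tens p.1 p.2 >].

Lemma nichols2_ker_zmod_closed : zmod_closed nichols2_ker.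
Proof.
split=> [|t u /asboolP[r [Hr ->]] /asboolP[q [Hq ->]]]; apply/asboolP.
  by exists [::]; split=> [p|]; rewrite ?in_nil ?big_nil.
exists (r ++ [seq (- p.1, p.2) | p <- q]); split=> [p|].
  rewrite mem_cat => /orP[/Hr //|/mapP[p' /Hq[H|H] ->]] /=; last by right.
  by left; rewrite rpredN.
rewrite big_cat big_map /= -sumrN; congr (_ + _).
by apply: eq_bigr => p _; rewrite /tens linearN.
Qed.

HB.instance Definition _ :=
  GRing.isZmodClosed.Build T2 nichols2_ker nichols2_ker_zmod_closed.

Definition nichols2 : zmodType := Quotient.quot nichols2_ker.
Local Notation B2 := nichols2.

Definition nclass2 (t : T2) : B2 := \pi_(Quotient.quot nichols2_ker)%qT t.

(* These descend from T(V_W), so the choice of representatives is immaterial. *)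
Definition ntens (a b : B) : B2 := nclass2 (tens (nrepr a) (nrepr b)).
Definition ncoprod (b : B) : B2 := nclass2 (coprod (nrepr b)).
Definition nsbar (b : B) : B := nclass (sbar_tensor (nrepr b)).
Definition pairing (a b : B) : C := pairing_tensor (nrepr a) (nrepr b).

Definition xelt (w : gT) : B :=
  nclass (\prod_(i <- redword (@sgen gT S) w) xroot (simple_root R i)).

(* xdiv w v is x_{w/v}. *)
Definition is_xdiv (w : gT) (X : gT -> B) : Prop :=
  ncoprod (xelt w) = \sum_(v | bruhat S v w) ntens (X v) (xelt v) /\
  (forall v, ~~ bruhat S v w -> X v = 0).

Definition xdiv (w : gT) : gT -> B :=
  xget ((fun=> 0) : gT -> B) [set X | is_xdiv w X]%classic.

(* cdiv w v w' v' is c_{w/v, w'/v'}. *)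
Definition cdiv (w v w' v' : gT) : C := pairing (xdiv w v) (nsbar (xdiv w' v')).

End NicholsAlgebra.

(* Positions in a word b of size l are counted from 0; enum and big         *)
(* operators run through subsets of 'I_l in increasing order.               *)
Section Subsets.
Variables (R : realType) (gT : finGroupType) (S : {set gT}).
Variables (l : nat) (b : l.-tuple 'I_#|S|).

Local Notation s := (@sgen gT S).

Definition alpha (j : 'I_l) : 'rV[R]_#|S| :=
  coxact (wprod s (take j b)) (simple_root R (tnth b j)).

Definition alpha' (j : 'I_l) : 'rV[R]_#|S| :=
  coxact (wprod s (rev (drop j.+1 b))) (simple_root R (tnth b j)).

Definition omit_prod (J : {set 'I_l}) : gT :=
  (\prod_(j in ~: J) s (tnth b j))%g.

Definition saturated_chain (v w : gT) (c : seq gT) : bool :=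
  path (bruhat_cover S) v c && (last v c == w).

Definition left_chain (v : gT) (J : {set 'I_l}) : seq gT :=
  scanl (fun u j => root_reflection (alpha j) * u)%g v (enum J).

Definition right_chain (v : gT) (J : {set 'I_l}) : seq gT :=
  scanl (fun u j => u * root_reflection (alpha' j))%g v (rev (enum J)).

Definition left_count (v w v' : gT) (m : nat) : nat :=
  #|[set J : {set 'I_l} | [&& #|J| == m, v' == omit_prod J
                            & saturated_chain v w (left_chain v J)]]|.

Definition right_count (v w v' : gT) (m : nat) : nat :=
  #|[set J : {set 'I_l} | [&& #|J| == m, v' == omit_prod J
                            & saturated_chain v w (right_chain v J)]]|.

End Subsets.

(* Main.v *)
(* The braided factorial F is determined by the twisted derivations: the       *)
(* coefficient of F(x) at the word p :: k is that of F(d_p x) at k. If r is a  *)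
(* word in simple roots with product w, this gives, by a telescoping sum of    *)
(* signs, that F(x_r) is 0 unless r is reduced, and else the sum of the words  *)
(* k = p_1 ... p_l such that w > s_{p_1} w > s_{p_2} s_{p_1} w > ... > 1 with  *)
(* lengths dropping by one (a chain of length-one covers).                     *)
(*                                                                             *)
(* F turns the coproduct into deconcatenation, so F(x_{w/v}) is the sum of the *)
(* words of the chains from w down to v. Expanding the coproduct of a reduced  *)
(* word of w', x_{w'/v'} is a sum over the subsets J whose complement spells   *)
(* v', and applying the twisted antipode to the J-th term gives the product    *)
(* x_{alpha_{j_1}} ... x_{alpha_{j_m}}. As F is self-adjoint and commutes with *)
(* this antipode up to reversal of words, c_{w/v,w'/v'} is the sum over J of   *)
(* the coefficient of F(x_{w/v}) at alpha_{j_m} ... alpha_{j_1}, which is 1 if *)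
(* these roots spell a saturated chain from v up to w and 0 otherwise.         *)
(*                                                                             *)
(* Inverting all group elements and reversing the reduced word exchanges the   *)
(* two counts.                                                                 *)

From HB Require Import structures.
Require Import Defs.
From mathcomp Require Import all_boot all_order all_algebra all_fingroup.
From mathcomp Require Import boolp complex reals trigo.
From mathcomp Require Import finmap monalg.
From mathcomp Require classical_sets.
From mathcomp Require Import zify ring.

Set Implicit Arguments.
Unset Strict Implicit.
Unset Printing Implicit Defensive.

(** * Words and the symmetric group *)

(** Write F for the braided factorial, called [fact] below. The relations of the Nichols algebra are
    the kernel of F, so an element is known through the coefficients of its image under F, and the
    argument takes place in the tensor algebra. Coefficients are read off letter by letter: removing
    the first or the last letter p of a word amounts to applying the left or right twisted
    derivation along p before F ([coef_fact_cons], [coef_fact_rcons]).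

    Let r be a word in simple roots with product w. Its derivative along p is a signed sum over the
    letters of r equal to p or -p once moved to the front, and deleting such a letter replaces w by
    s_p w ([rr_pull]). The signs telescope to [p > 0] - [w^-1 p > 0] ([sum_rdelta_pull]), which is 1
    if s_p w is shorter than w and 0 otherwise. Hence F of a reduced word is the sum of all chains
    from w down to 1 ([coef_fact_simple_word]). As F turns the coproduct into deconcatenation
    ([coef2_fact2_coprd]), cutting these chains at v shows that F(x_{w/v}) is the sum of the chains
    from w down to v ([xdiv_fact]).

    For the count, the coproduct of a reduced word of w' is expanded over the sets J of letters that
    go to the left ([coprd_simple_word]). The twisted antipode turns the left factor of J into the
    product of the x_{alpha_j}, j in J ([sbar_lfactor]). By symmetry of the pairing ([pair_sym]),
    c_{w/v,w'/v'} is a sum over J of coefficients of F(x_{w/v}), each 0 or 1 ([pair_sbar_quotient]),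
    and [saturated_upchain] recognizes the value 1 as the condition on Bruhat covers. The second
    count follows by inverting and reversing ([left_count_rev]). *)

Section WordLength.
Variables (gT : finGroupType) (I : finType) (s : I -> gT).

Lemma wprod_cons i r : wprod s (i :: r) = (s i * wprod s r)%g.
Proof. by rewrite /wprod big_cons. Qed.

Lemma wprod_nil : wprod s [::] = 1%g.
Proof. by rewrite /wprod big_nil. Qed.

Lemma wprod_cat r1 r2 : wprod s (r1 ++ r2) = (wprod s r1 * wprod s r2)%g.
Proof. by rewrite /wprod big_cat. Qed.

Lemma gen_wprod : <<[set s i | i : I]>>%g = [set: gT] ->
  forall w, exists r, wprod s r = w.
Proof.
move=> gen w; have: w \in <<[set s i | i : I]>>%g by rewrite gen inE.
case/gen_prodgP => n [c cP ->].
have /fin_all_exists[g gP] (i : 'I_n) : exists j, c i = s j.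
  by case/imsetP: (cP i) => j _ ->; exists j.
exists [seq g i | i <- index_enum 'I_n].
by rewrite /wprod big_map; apply: eq_bigr.
Qed.

Hypothesis gen : forall w, exists r, wprod s r = w.

Let e : rel gT := fun u v => [exists i, v == (u * s i)%g].

Lemma path_word u p : path e u p ->
  exists2 r, size r = size p & last u p = (u * wprod s r)%g.
Proof.
elim: p u => [|v p IH] u /=; first by exists [::]; rewrite ?wprod_nil ?mulg1.
case/andP => /existsP[i /eqP ->] /IH[r sr ->].
by exists (i :: r); rewrite /= ?sr // wprod_cons mulgA.
Qed.

Lemma word_path r u : exists2 p, path e u p & last u p = (u * wprod s r)%g.
Proof.
elim: r u => [|i r IH] u; first by exists [::]; rewrite ?wprod_nil ?mulg1.
have [p pp lp] := IH (u * s i)%g; exists ((u * s i)%g :: p) => /=.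
  by rewrite pp andbT; apply/existsP; exists i.
by rewrite lp wprod_cons mulgA.
Qed.

Lemma has_wordP w k :
  reflect (exists2 r, size r = k & wprod s r = w) (has_word s w k).
Proof.
apply: (iffP existsP) => [[t /eqP tw]|[r <- rw]].
  by exists t; rewrite ?size_tuple.
by exists (in_tuple r); apply/eqP.
Qed.

(** A walk in the Cayley graph can be shortened to one without repeated vertices, which has fewer
    than [#|gT|] edges; so the search in [len] succeeds. *)
Lemma has_short_word w : has (has_word s w) (iota 0 #|gT|).
Proof.
have [r rw] := gen w; have [p pp lp] := word_path r 1%g.
rewrite mul1g rw in lp.
case/shortenP: pp lp => q qp uq _ lq.
have [r' sr' lr'] := path_word qp.
apply/hasP; exists (size q); last first.
  by apply/has_wordP; exists r'; rewrite // -[LHS]mul1g -lr' -lq.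
rewrite mem_iota /= add0n.
by have := max_card (mem (1%g :: q)); rewrite (card_uniqP uq).
Qed.

Lemma len_word w : exists2 r, size r = len s w & wprod s r = w.
Proof.
have := has_short_word w => hw; have := nth_find 0 hw.
by rewrite nth_iota ?add0n; [move/has_wordP | move: hw; rewrite has_find size_iota].
Qed.

Lemma len_wprod r : len s (wprod s r) <= size r.
Proof.
rewrite leqNgt; apply/negP => lt; have := before_find 0 lt.
rewrite nth_iota; last first.
  by apply: leq_trans lt _; have := find_size (has_word s (wprod s r)) (iota 0 #|gT|);
     rewrite size_iota.
by rewrite add0n => /has_wordP[]; exists r.
Qed.

Lemma redwordP w : wprod s (redword s w) = w /\ size (redword s w) = len s w.
Proof.
rewrite /redword; case: pickP => [t /eqP tw|no]; first by rewrite size_tuple.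
have [r sr rw] := len_word w.
by have := no (tcast sr (in_tuple r)); rewrite val_tcast /= rw eqxx.
Qed.

End WordLength.

(** * Lehmer codes and their canonical words *)

Section LehmerCodes.

(** Read from the right: [iota 0 j] brings strand j to the front, then the shifted word permutes the
    other strands according to [c']. *)
Fixpoint lehmer_word (c : seq nat) : seq nat :=
  if c is j :: c' then [seq i.+1 | i <- lehmer_word c'] ++ iota 0 j else [::].

Fixpoint is_lehmer (c : seq nat) : bool :=
  if c is j :: c' then (j <= size c') && is_lehmer c' else true.

(** Effect on the code of left multiplication by the adjacent transposition i. The sum of the
    entries is the length, and the two branches are ascent and descent. *)
Fixpoint lehmer_step (i : nat) (c : seq nat) : seq nat :=
  match i, c with
  | i'.+1, j :: c' => j :: lehmer_step i' c'
  | 0, [:: j, k & c'] =>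
      if j <= k then [:: k.+1, j & c'] else [:: k, j.-1 & c']
  | _, _ => c
  end.

Fixpoint lehmer_codes (n : nat) : seq (seq nat) :=
  if n is n'.+1 then [seq j :: c | j <- iota 0 n, c <- lehmer_codes n']
  else [:: [::]].

Lemma lehmer_stepK i c : lehmer_step i (lehmer_step i c) = c.
Proof.
elim: i c => [|i IH] [|j c] //=; last by rewrite IH.
case: c => [|k c] //=; case: (leqP j k) => /= jk; first by rewrite ltnNge jk.
by rewrite -ltnS (ltn_predK jk) jk.
Qed.

Lemma size_lehmer_step i c : size (lehmer_step i c) = size c.
Proof.
elim: i c => [|i IH] [|j c] //=; last by rewrite IH.
by case: c => [|k c] //=; case: ifP. Qed.

Lemma is_lehmer_step i c : is_lehmer c -> is_lehmer (lehmer_step i c).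
Proof.
elim: i c => [|i IH] [|j c] //=; last first.
  by rewrite size_lehmer_step => /andP[-> /IH].
case: c => [|k c] //=; case: (leqP j k) => jk /= /and3P[h1 h2 ->]; rewrite andbT.
  by apply/andP; split; lia.
by apply/andP; split; lia.
Qed.

Lemma sumn_lehmer_step i c : i.+1 < size c ->
  sumn (lehmer_step i c) = (sumn c).+1 \/ (sumn (lehmer_step i c)).+1 = sumn c.
Proof.
elim: i c => [|i IH] [|j c] //=; last by rewrite ltnS => /IH[]; lia.
case: c => [|k c] //= _; case: (leqP j k) => /= jk; lia.
Qed.

Lemma size_lehmer_word c : size (lehmer_word c) = sumn c.
Proof.
by elim: c => [|j c IH] //=; rewrite size_cat size_map IH size_iota addnC.
Qed.

Lemma all_lehmer_word c : is_lehmer c ->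
  all (fun i => i.+1 < size c) (lehmer_word c).
Proof.
elim: c => [|j c IH] //= /andP[jc /IH cc]; rewrite all_cat all_map.
apply/andP; split; first by apply: sub_all cc => i /=.
by apply/allP => i; rewrite mem_iota add0n /= ltnS => /leq_trans ->.
Qed.

Lemma lehmer_word0 n : lehmer_word (nseq n 0) = [::].
Proof. by elim: n => //= n ->. Qed.

Lemma lehmer_codesS n :
  lehmer_codes n.+1 = [seq j :: c | j <- iota 0 n.+1, c <- lehmer_codes n].
Proof. by []. Qed.

Lemma mem_lehmer_codes n c :
  (c \in lehmer_codes n) = (size c == n) && is_lehmer c.
Proof.
elim: n c => [|n IH] c; first by rewrite inE; case: c.
rewrite lehmer_codesS; apply/allpairsP/idP => [[[j c'] /= [jn]] | ].
  rewrite IH => /andP[/eqP sc lc] -> /=.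
  have := jn; rewrite -[_ :: _]/(iota 0 n.+1) mem_iota ltnS => /andP[_].
  by rewrite sc lc eqxx andbT.
case: c => [|j c] //= /andP[]; rewrite eqSS => sc /andP[jc lc].
exists (j, c); rewrite IH sc lc; split=> //.
by rewrite -[_ :: _]/(iota 0 n.+1) mem_iota /= add0n ltnS -(eqP sc).
Qed.

Lemma size_lehmer_codes n : size (lehmer_codes n) = n`!.
Proof.
elim: n => // n IH.
by rewrite lehmer_codesS size_allpairs size_iota IH factS.
Qed.

End LehmerCodes.

(** * Operators satisfying the braid relations *)

Section BraidAction.

(* Operators that satisfy the braid relations for the strands below N only:  *)
(* the braiding of the tensor algebra is the identity beyond the last letter. *)
Record braid_action (X : Type) (P : X -> Prop) (N : nat) (f : nat -> X -> X) :=
  BraidAction {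
    _ : forall i x, i.+1 < N -> P x -> P (f i x);
    _ : forall i j x, i.+1 < j -> j.+1 < N -> P x -> f i (f j x) = f j (f i x);
    _ : forall i x, i.+2 < N -> P x ->
          f i (f i.+1 (f i x)) = f i.+1 (f i (f i.+1 x)) }.

Lemma braid_action_shift X P N f :
  @braid_action X P N.+1 f -> @braid_action X P N (fun i => f i.+1).
Proof. by case=> h1 h2 h3; split=> [i x|i j x|i x] *; [apply: h1|apply: h2|apply: h3]. Qed.

Section Fixed.
Variables (X : Type) (P : X -> Prop) (N : nat) (f : nat -> X -> X).
Hypothesis fP : braid_action P N f.

Lemma braid_foldr_closed r x : all (fun i => i.+1 < N) r -> P x -> P (foldr f x r).
Proof.
case: fP => h1 _ _; elim: r => //= i r IH /andP[iN /IH r' /r']; exact: h1.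
Qed.

Lemma braid_foldr_comm i r x : i.+1 < N -> all (fun j => i.+1 < j < N.-1) r -> P x ->
  f i (foldr f x r) = foldr f (f i x) r.
Proof.
case: fP => _ h2 _ iN; elim: r => //= j r IH /andP[/andP[ij jN] rr] Px.
rewrite h2 ?IH //; first lia.
apply: braid_foldr_closed => //; apply: sub_all rr => k; lia.
Qed.

Lemma braid_foldr_comm_lt i r x : i.+1 < N -> all (fun j => j.+1 < i) r -> P x ->
  f i (foldr f x r) = foldr f (f i x) r.
Proof.
case: fP => _ h2 _ iN; elim: r => //= j r IH /andP[ij rr] Px.
rewrite -h2 ?IH //.
apply: braid_foldr_closed => //; apply: sub_all rr => k; lia.
Qed.

(** Far commutation brings [f i.+1] next to the factors i, i + 1 of the product, where a single
    braid relation turns it into [f i] on the other side. *)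
Lemma braid_iota_slide i k x : i < k -> k.+1 < N -> P x ->
  f i.+1 (foldr f x (iota 0 k.+1)) = foldr f (f i x) (iota 0 k.+1).
Proof.
move=> ik kN Px; case: (fP) => h1 _ h3.
have -> : k.+1 = i + (2 + (k.+1 - i.+2)) by lia.
rewrite !iotaD !foldr_cat /= add0n.
have allI a b : a + b <= k.+1 -> all (fun i => i.+1 < N) (iota a b).
  by move=> ab; apply/allP => j; rewrite mem_iota; lia.
set t := iota (i + 2) _; have tN : all (fun i => i.+1 < N) t by apply: allI; lia.
rewrite -(@braid_foldr_comm i t x) //; last 2 first.
- lia.
- by apply/allP => j; rewrite mem_iota; lia.
have Py := braid_foldr_closed tN Px; set y := foldr f x t in Py *.
rewrite braid_foldr_comm_lt; last 3 first.
- lia.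
- by apply/allP => j; rewrite mem_iota; lia.
- by do 2 (apply: (h1); first lia).
congr foldr; rewrite h3 //; lia.
Qed.

Lemma braid_iota_iota j k x : j <= k -> k.+1 < N -> P x ->
  foldr f (foldr f x (iota 0 k.+1)) (iota 1 j) =
  foldr f (foldr f x (iota 0 j)) (iota 0 k.+1).
Proof.
elim: j x => [|j IH] x jk kN Px //.
have iotaSr a : iota a j.+1 = iota a j ++ [:: a + j] by rewrite -addn1 iotaD.
rewrite !iotaSr !foldr_cat [foldr f _ [:: 1 + j]]/= [foldr f _ [:: 0 + j]]/=.
rewrite add1n add0n braid_iota_slide // IH //; first lia.
by case: fP => h1 _ _; apply: h1 => //; lia.
Qed.

End Fixed.

Lemma foldr_map_shift X (g : nat -> X -> X) x r :
  foldr g x [seq i.+1 | i <- r] = foldr (fun i => g i.+1) x r.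
Proof. by elim: r => //= a r ->. Qed.

Lemma lehmer_word_step X P N f i c x : @braid_action X P N f -> P x ->
  size c = N -> is_lehmer c -> i.+1 < N ->
  sumn (lehmer_step i c) = (sumn c).+1 ->
  foldr f x (lehmer_word (lehmer_step i c)) = f i (foldr f x (lehmer_word c)).
Proof.
elim: i N f c x => [|i IH] N f [|j c] x fP Px //= sc; subst N.
  move=> lc iN; case: c lc fP iN => [|k c] //= /and3P[jc kc lc] fP _.
  case: (leqP j k) => [jk _|jk]; last by move=> /=; lia.
  rewrite /= !map_cat -map_comp.
  have -> : [seq i.+1 | i <- iota 0 j] = iota 1 j.
    by rewrite -[1]add1n iotaDl.
  have -> : [seq i.+1 | i <- iota 0 k] = iota 1 k.
    by rewrite -[1]add1n iotaDl.
  rewrite -catA !foldr_cat.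
  rewrite (_ : 0 :: iota 1 k = iota 0 k.+1) //.
  rewrite (braid_iota_iota fP) //.
  rewrite (braid_foldr_comm fP) //.
    rewrite all_map; apply: sub_all (all_lehmer_word lc) => a /=; lia.
  rewrite -foldr_cat; apply: (braid_foldr_closed fP) => //.
  rewrite all_cat; apply/andP; split; apply/allP => a; rewrite mem_iota; lia.
move=> /andP[jc lc] iN; rewrite -addnS => /addnI hs.
rewrite !foldr_cat !foldr_map_shift.
rewrite (IH (size c)) //; first exact: braid_action_shift fP.
apply: (braid_foldr_closed fP) => //.
by apply/allP => a; rewrite mem_iota; lia.
Qed.

Definition lehmer_of (N : nat) (r : seq nat) : seq nat :=
  foldr lehmer_step (nseq N 0) r.

Section LehmerOf.
Variable N : nat.
Implicit Types r : seq nat.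
Local Notation ok := (all (fun i => i.+1 < N)).

Lemma size_lehmer_of r : size (lehmer_of N r) = N.
Proof.
by rewrite /lehmer_of; elim: r => /= [|i r IH]; rewrite ?size_nseq ?size_lehmer_step.
Qed.

Lemma is_lehmer_of r : is_lehmer (lehmer_of N r).
Proof.
rewrite /lehmer_of; elim: r => /= [|i r IH]; last exact: is_lehmer_step.
by elim: N.
Qed.

Lemma sumn_lehmer_of r : ok r -> sumn (lehmer_of N r) <= size r.
Proof.
elim: r => /= [|i r IH]; first by rewrite sumn_nseq.
case/andP => iN /IH {}IH.
have := @sumn_lehmer_step i (lehmer_of N r); rewrite size_lehmer_of => /(_ iN).
by rewrite /lehmer_of /= -/(lehmer_of N r); lia.
Qed.

(** Each letter raises the sum of the code by at most one, so equality forces every step to be an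
    ascent, where [lehmer_word_step] applies. This is Matsumoto's theorem for the symmetric group: a
    reduced word acts as the canonical one. *)
Lemma lehmer_of_foldr X P f r x : @braid_action X P N f -> P x -> ok r ->
  sumn (lehmer_of N r) = size r ->
  foldr f x (lehmer_word (lehmer_of N r)) = foldr f x r.
Proof.
move=> fP Px; elim: r => /= [|i r IH]; first by rewrite lehmer_word0.
case/andP => iN okr; have le := sumn_lehmer_of okr.
have := @sumn_lehmer_step i (lehmer_of N r); rewrite size_lehmer_of => /(_ iN) st.
rewrite /lehmer_of /= -/(lehmer_of N r) => hs.
have hr : sumn (lehmer_of N r) = size r by lia.
rewrite (lehmer_word_step fP) ?IH ?size_lehmer_of ?is_lehmer_of //; lia.
Qed.

End LehmerOf.

End BraidAction.

Lemma uniq_map_inj_in (T1 T2 : eqType) (f : T1 -> T2) t :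
  uniq (map f t) -> {in t &, injective f}.
Proof.
elim: t => //= a t IH /andP[nfa /IH {}IH] x y; rewrite !inE.
case/predU1P => [->|xt] /predU1P[->|yt] // e; last exact: IH.
  by rewrite e map_f in nfa.
by rewrite -e map_f in nfa.
Qed.

(** * Summing over the symmetric group by Lehmer codes *)

Section SymmetricGroup.
Variable m : nat.
Local Notation N := m.+1.

Definition adj_nat (i : nat) : 'S_N := tperm (inord i) (inord i.+1).

Lemma adj_tpermE (i : 'I_m) : adj_tperm i = adj_nat i.
Proof.
congr tperm; apply: val_inj; rewrite /= inordK //.
- exact: ltnW (ltn_ord i).
- exact: (ltn_ord i).
Qed.

Lemma tpermC3 (T : finType) (x y z : T) : x != y -> y != z -> x != z ->
  (tperm x y * tperm y z * tperm x y = tperm y z * tperm x y * tperm y z)%g.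
Proof.
move=> xy yz xz.
have -> : (tperm x y * tperm y z * tperm x y = tperm y z ^ tperm x y)%g.
  by rewrite conjgE tpermV mulgA.
have -> : (tperm y z * tperm x y * tperm y z = tperm x y ^ tperm y z)%g.
  by rewrite conjgE tpermV mulgA.
by rewrite !tpermJ !permE /= eqxx /= ?eqxx (negPf xy) (negPf xz) /=
  ?[z == x]eq_sym ?[z == y]eq_sym ?[y == x]eq_sym ?(negPf xy) ?(negPf yz) ?(negPf xz) ?eqxx.
Qed.

Lemma inord_inj i j : i < N -> j < N -> (inord i == inord j :> 'I_N) = (i == j).
Proof. by move=> iN jN; rewrite -val_eqE /= !inordK. Qed.

Lemma tperm_comm (T : finType) (x y z t : T) :
  x != z -> x != t -> y != z -> y != t ->
  (tperm x y * tperm z t = tperm z t * tperm x y)%g.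
Proof.
move=> xz xt yz yt; apply/commgP/conjg_fixP.
by rewrite tpermJ !tpermD // eq_sym.
Qed.

Lemma adj_nat_action :
  braid_action (fun _ : 'S_N => True) N (fun i x => adj_nat i * x)%g.
Proof.
split=> // [i j x ij jN _|i x iN _]; rewrite !mulgA; congr (_ * _)%g.
  by apply: tperm_comm; rewrite inord_inj //; lia.
by rewrite tpermC3 // ?inord_inj //; lia.
Qed.

Lemma adj_tperm_gen : <<[set adj_tperm i | i : 'I_m]>>%g = [set: 'S_N].
Proof.
set G := <<_>>%g; apply/eqP; rewrite eqEsubset subsetT /=.
have step i j : i + j < N -> tperm (inord i) (inord (i + j)) \in G.
  elim: j => [|j IH] ijN; first by rewrite addn0 tperm1 group1.
  have jN : i + j < m by lia.
  have aG : adj_nat (i + j) \in G.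
    by rewrite -[i + j]/(val (Ordinal jN)) -adj_tpermE mem_gen // imset_f.
  case: j IH ijN jN aG => [|j] IH ijN jN aG; first by rewrite addn1; rewrite addn0 in aG.
  have <- : (tperm (inord i) (inord (i + j.+1)) ^ adj_nat (i + j.+1))%g =
         tperm (inord i) (inord (i + j.+2)).
    rewrite tpermJ tpermL tpermD ?addnS // inord_inj //; lia.
  by rewrite groupJ // IH //; lia.
apply/subsetP => sigma _; have [ts -> _] := prod_tpermP sigma.
apply: group_prod => -[i j] _ /=.
wlog ij : i j / i <= j.
  by move=> W; case/orP: (leq_total i j) => /W //; rewrite tpermC.
have := step i (j - i); rewrite subnKC // !inord_val; exact.
Qed.

Lemma wprod_adj_nat (r : seq 'I_m) :
  wprod (@adj_tperm m) r = foldr (fun i x => adj_nat i * x)%g 1%g (map val r).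
Proof. by elim: r => [|i r IH] /=; rewrite ?wprod_nil // wprod_cons IH adj_tpermE. Qed.

Definition lehmer_perm (c : seq nat) : 'S_N :=
  foldr (fun i x => adj_nat i * x)%g 1%g (lehmer_word c).

Lemma lehmer_perm_step i c : size c = N -> is_lehmer c -> i.+1 < N ->
  lehmer_perm (lehmer_step i c) = (adj_nat i * lehmer_perm c)%g.
Proof.
move=> sc lc iN.
have [] := @sumn_lehmer_step i c; first by rewrite sc.
  exact: (lehmer_word_step adj_nat_action).
move=> hs; have := lehmer_word_step adj_nat_action (x := 1%g) (i := i)
  (c := lehmer_step i c) I.
rewrite lehmer_stepK size_lehmer_step is_lehmer_step // hs => /(_ sc isT iN erefl).
by rewrite -!/(lehmer_perm _) => ->; rewrite mulgA tperm2 mul1g.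
Qed.

Lemma lehmer_perm_of r : all (fun i => i.+1 < N) r ->
  lehmer_perm (lehmer_of N r) = foldr (fun i x => adj_nat i * x)%g 1%g r.
Proof.
elim: r => [_|i r IH /andP[iN rN]].
  by rewrite /lehmer_perm (_ : lehmer_of N [::] = nseq N 0) // lehmer_word0.
rewrite -[lehmer_of N _]/(lehmer_step i (lehmer_of N r)).
by rewrite lehmer_perm_step ?size_lehmer_of ?is_lehmer_of // IH.
Qed.

(** Codes reach every permutation, since words act on them by [lehmer_step], and there are as many
    codes as permutations. *)
Lemma lehmer_perm_enum :
  perm_eq (map lehmer_perm (lehmer_codes N)) (enum 'S_N).
Proof.
have sub : {subset enum 'S_N <= map lehmer_perm (lehmer_codes N)}.
  move=> sigma _; have [r <-] := gen_wprod adj_tperm_gen sigma.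
  rewrite wprod_adj_nat -lehmer_perm_of; last first.
    by rewrite all_map; apply/allP => i _ /=; rewrite ltnS.
  by rewrite map_f // mem_lehmer_codes size_lehmer_of is_lehmer_of eqxx.
have sz : size (map lehmer_perm (lehmer_codes N)) <= size (enum 'S_N).
  rewrite size_map size_lehmer_codes -cardE.
  by rewrite card_Sn.
have ue := enum_uniq {perm 'I_N}.
have [_ eqm] := uniq_min_size ue sub sz.
by rewrite perm_sym; apply: uniq_perm => //; exact: leq_size_uniq ue sub sz.
Qed.

Local Open Scope ring_scope.
Import GRing.Theory.

(** Trades the arbitrarily chosen reduced words of the braided factorial for Lehmer words, which are
    recursive in the number of strands. *)
Lemma sum_redword (V : nmodType) X P (f : nat -> X -> X) (h : X -> V) x :
  braid_action P N f -> P x ->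
  \sum_(sigma : 'S_N)
     h (foldr (fun i : 'I_m => f i) x (redword (@adj_tperm m) sigma)) =
  \sum_(c <- lehmer_codes N) h (foldr f x (lehmer_word c)).
Proof.
move=> fP Px; have gen := gen_wprod adj_tperm_gen.
rewrite -big_enum -(perm_big _ lehmer_perm_enum) big_map.
apply: eq_big_seq => c; rewrite mem_lehmer_codes => /andP[/eqP sc lc]; congr h.
have [rw rs] := redwordP gen (lehmer_perm c).
set r := redword _ _ in rw rs *.
have rN : all (fun i => i.+1 < N)%N (map val r).
  by rewrite all_map; apply/allP => i _ /=; rewrite ltnS.
have fold_val : foldr (fun i : 'I_m => f i) x r = foldr f x (map val r).
  by elim: (r) => //= i r' ->.
have uc : uniq (map lehmer_perm (lehmer_codes N)).
  by rewrite (perm_uniq lehmer_perm_enum) enum_uniq.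
have perm_r : lehmer_perm (lehmer_of N (map val r)) = lehmer_perm c.
  by rewrite lehmer_perm_of // -wprod_adj_nat.
have rc : lehmer_of N (map val r) = c.
  apply: (uniq_map_inj_in uc) => //; last by rewrite mem_lehmer_codes sc lc eqxx.
  by rewrite mem_lehmer_codes size_lehmer_of is_lehmer_of eqxx.
(* The Lehmer word bounds the length above by [sumn c], and [sumn_lehmer_of] bounds it below; so the
   chosen word consists of ascents only. *)
have len_c : (len (@adj_tperm m) (lehmer_perm c) <= sumn c)%N.
  have cwN : all (fun i => i < m)%N (lehmer_word c).
    by have := all_lehmer_word lc; rewrite sc; apply: sub_all => i; rewrite ltnS.
  have [r' er'] : exists r' : seq 'I_m, map val r' = lehmer_word c.
    elim: (lehmer_word c) cwN => [|i t IH] /=; first by exists [::].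
    by case/andP => im /IH[r' <-]; exists (Ordinal im :: r').
  have -> : lehmer_perm c = wprod (@adj_tperm m) r'.
    by rewrite wprod_adj_nat er'.
  by apply: leq_trans (len_wprod _ _) _; rewrite -(size_map val) er' size_lehmer_word.
rewrite fold_val -(lehmer_of_foldr fP Px rN) ?rc //.
apply/eqP; rewrite eqn_leq size_map -{1}rc rs len_c andbT.
by apply: leq_trans (sumn_lehmer_of rN) _; rewrite size_map rs.
Qed.

End SymmetricGroup.

(** * The geometric representation *)

Section OppositeGL.
Variables (R : comUnitRingType) (n : nat).
Import GRing.Theory.
Local Open Scope ring_scope.

(* Invertible matrices with the opposite product, as they act on row vectors *)
(* from the right.                                                           *)
Definition gl_op : Type := {A : 'M[R]_n | A \in unitmx}.
HB.instance Definition _ := Choice.on gl_op.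

Definition gl_one : gl_op := exist _ 1%:M (unitmx1 R n).
Definition gl_mul (A B : gl_op) : gl_op :=
  exist (fun A => A \in unitmx) (val B *m val A)
    (etrans (unitmx_mul _ _) (introT andP (conj (valP B) (valP A)))).
Definition gl_inv (A : gl_op) : gl_op :=
  exist (fun A => A \in unitmx) (invmx (val A)) (etrans (unitmx_inv _) (valP A)).

Lemma gl_mulA : associative gl_mul.
Proof. by move=> A B C; apply: val_inj; rewrite /= mulmxA. Qed.
Lemma gl_mul1 : left_id gl_one gl_mul.
Proof. by move=> A; apply: val_inj; rewrite /= mulmx1. Qed.
Lemma gl_mulr1 : right_id gl_one gl_mul.
Proof. by move=> A; apply: val_inj; rewrite /= mul1mx. Qed.
Lemma gl_mulV : left_inverse gl_one gl_inv gl_mul.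
Proof. by move=> A; apply: val_inj; rewrite /= mulmxV // (valP A). Qed.
Lemma gl_mulrV : right_inverse gl_one gl_inv gl_mul.
Proof. by move=> A; apply: val_inj; rewrite /= mulVmx // (valP A). Qed.

HB.instance Definition _ :=
  isGroup.Build gl_op gl_mulA gl_mul1 gl_mulr1 gl_mulV gl_mulrV.

Definition gl_act (A : gl_op) (x : 'rV[R]_n) := x *m val A.

Lemma gl_actM A B x : gl_act (A * B)%g x = gl_act A (gl_act B x).
Proof. by rewrite /gl_act /= mulmxA. Qed.

Lemma gl_act1 x : gl_act 1%g x = x.
Proof. by rewrite /gl_act /= mulmx1. Qed.

Lemma gl_actX A k x : gl_act (A ^+ k)%g x = iter k (gl_act A) x.
Proof.
elim: k x => [|k IH] x; first by rewrite expg0 gl_act1.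
by rewrite expgS gl_actM IH.
Qed.

Lemma gl_act_inj A B : gl_act A =1 gl_act B -> A = B.
Proof.
move=> AB; apply: val_inj; apply/row_matrixP => i.
by rewrite !rowE; apply: AB.
Qed.

End OppositeGL.

(** * Simple reflections and the dihedral relations *)

Section Reflections.
Variables (R : realType) (gT : finGroupType) (S : {set gT}).
Import Order.TTheory GRing.Theory Num.Theory.
Local Open Scope ring_scope.

Local Notation n := #|S|.
Local Notation s := (@sgen gT S).
Local Notation root := 'rV[R]_n.
Local Notation B := (@coxeter_form R gT S).
Local Notation sr := (@simple_root R gT S).
Local Notation refl := (@refl_simple R gT S).

Hypothesis S2 : forall x, x \in S -> #[x]%g = 2%N.

Lemma sgen_in i : s i \in S.
Proof. exact: enum_valP. Qed.

Lemma sgen_inj : injective s.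
Proof. exact: enum_val_inj. Qed.

Lemma sgenK i : (s i * s i = 1)%g.
Proof. by rewrite -expg2 -(S2 (sgen_in i)) expg_order. Qed.

Lemma sgenV i : (s i)^-1%g = s i.
Proof. by apply/eqP; rewrite eq_invg_mul sgenK. Qed.

Lemma order_sgen_sym i j : #[(s i * s j)%g]%g = #[(s j * s i)%g]%g.
Proof. by rewrite -orderV invMg !sgenV. Qed.

Lemma coxeter_formPl a x y z : B (a *: x + y) z = a * B x z + B y z.
Proof. by rewrite /coxeter_form !mulmxDl -!scalemxAl !mxE. Qed.

Lemma coxeter_formC x y : B x y = B y x.
Proof.
have sym : (coxeter_matrix R S)^T = coxeter_matrix R S.
  by apply/matrixP => i j; rewrite !mxE order_sgen_sym.
transitivity ((x *m coxeter_matrix R S *m y^T)^T 0 0); first by rewrite mxE.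
by rewrite !trmx_mul trmxK sym mulmxA.
Qed.

Lemma coxeter_formDl x y z : B (x + y) z = B x z + B y z.
Proof. by rewrite -[x]scale1r coxeter_formPl mul1r scale1r. Qed.
Lemma coxeter_formZl a x z : B (a *: x) z = a * B x z.
Proof. by rewrite -[a *: x]addr0 coxeter_formPl {2}/coxeter_form !mul0mx mxE addr0. Qed.
Lemma coxeter_formDr x y z : B z (x + y) = B z x + B z y.
Proof. by rewrite !(coxeter_formC z) coxeter_formDl. Qed.
Lemma coxeter_formZr a x z : B z (a *: x) = a * B z x.
Proof. by rewrite !(coxeter_formC z) coxeter_formZl. Qed.

Lemma coxeter_form_simple i j : B (sr i) (sr j) = - cos (pi / #[(s i * s j)%g]%g%:R).
Proof.
by rewrite /coxeter_form /simple_root -rowE trmx_delta -colE !mxE.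
Qed.

Lemma coxeter_form_simple1 i : B (sr i) (sr i) = 1.
Proof. by rewrite coxeter_form_simple sgenK order1 divr1 cospi opprK. Qed.

Lemma refl_linear i : linear (refl i).
Proof.
move=> a x y; rewrite /refl_simple coxeter_formDl coxeter_formZl.
rewrite mulrDr scalerDl opprD addrACA scalerBr scalerA.
by congr (_ - _ + _); congr (_ *: _); ring.
Qed.

HB.instance Definition _ i := GRing.isLinear.Build R root root *:%R (refl i) (refl_linear i).

Lemma reflZ i a x : refl i (a *: x) = a *: refl i x.
Proof. exact: linearZ. Qed.

Lemma reflD i x y : refl i (x + y) = refl i x + refl i y.
Proof. exact: linearD. Qed.

Lemma refl_simpleE i : refl i (sr i) = - sr i.
Proof.
rewrite /refl_simple coxeter_form_simple1 mulr1 scaler_nat mulr2n.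
by rewrite opprD addrA subrr sub0r.
Qed.

Lemma reflK i : involutive (refl i).
Proof.
move=> x; rewrite {2}/refl_simple linearB linearZ /= refl_simpleE scalerN opprK.
by rewrite /refl_simple subrK.
Qed.

Lemma refl_form i x y : B (refl i x) (refl i y) = B x y.
Proof.
rewrite /refl_simple -!scaleNr !(coxeter_formDl, coxeter_formDr, coxeter_formZl, coxeter_formZr).
rewrite coxeter_form_simple1 (coxeter_formC (sr i) y); ring.
Qed.

Definition wact (r : seq 'I_n) (x : root) := foldr refl x r.

Lemma wact_linear r : linear (wact r).
Proof.
by move=> a x y; elim: r => //= i r ->; rewrite linearP.
Qed.

HB.instance Definition _ r := GRing.isLinear.Build R root root *:%R (wact r) (wact_linear r).

(** The parity test fixes the letters from the right end, which is always [j]; a longer word extends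
    a shorter one on the left. *)
Fixpoint altword (k : nat) (i j : 'I_n) : seq 'I_n :=
  if k is k'.+1 then (if odd k' then i else j) :: altword k' i j else [::].

Section Dihedral.
Variables (i j : 'I_n).
Hypothesis ij : i != j.
Let m := #[(s i * s j)%g]%g.
Let theta : R := pi / m%:R.

Lemma order_gt1 : (1 < m)%N.
Proof.
rewrite /m ltn_neqAle order_gt0 andbT eq_sym order_eq1.
rewrite -eq_invg_mul sgenV; apply: contra ij => /eqP/sgen_inj ->; exact: eqxx.
Qed.

Lemma theta_gt0 : 0 < theta.
Proof. by rewrite divr_gt0 ?pi_gt0 // ltr0n; apply: ltnW order_gt1. Qed.

Lemma theta_m : theta *+ m = pi.
Proof.
by rewrite -mulr_natr divfK // pnatr_eq0 -lt0n; apply: ltnW order_gt1.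
Qed.

Lemma theta_le k : (k <= m)%N -> theta *+ k <= pi.
Proof. by move=> km; rewrite -theta_m ler_wpMn2l // ltW // theta_gt0. Qed.

Lemma sin_theta_gt0 : 0 < sin theta.
Proof.
apply: sin_gt0_pi; rewrite ?theta_gt0 //= -theta_m -{1}[theta]mulr1n.
by rewrite ltr_pMn2l ?theta_gt0 ?order_gt1.
Qed.

Lemma sin_theta_ge0 k : (k <= m)%N -> 0 <= sin (theta *+ k).
Proof.
move=> km; apply: sin_ge0_pi; rewrite theta_le //.
by rewrite mulrn_wge0 // ltW // theta_gt0.
Qed.

Lemma form_ij : B (sr i) (sr j) = - cos theta.
Proof. by rewrite coxeter_form_simple. Qed.

Lemma sin_theta_rec k :
  2 * sin (theta *+ k.+1) * cos theta - sin (theta *+ k) = sin (theta *+ k.+2).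
Proof.
have -> : theta *+ k = theta *+ k.+1 - theta by rewrite mulrSr addrK.
rewrite [theta *+ k.+2]mulrS [theta + _]addrC sinB sinD; ring.
Qed.

(** The two simple roots enclose the angle pi - theta, so the coefficients of the images are sines
    of multiples of theta, with [sin_theta_rec] as recursion. The factor [sin theta] clears
    denominators. *)
Lemma wact_altword k : sin theta *: wact (altword k i j) (sr i) =
  sin (theta *+ (if odd k then k else k.+1)) *: sr i +
  sin (theta *+ (if odd k then k.+1 else k)) *: sr j.
Proof.
elim: k => [|k IH] /=; first by rewrite sin0 scale0r addr0.
rewrite -reflZ IH reflD !reflZ.
case: (odd k) => /=; rewrite refl_simpleE /refl_simple ?[B (sr j) _]coxeter_formC form_ij.
all: move: (sr i) (sr j) => u v; rewrite -sin_theta_rec.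
all: by apply/rowP => l; rewrite !mxE; ring.
Qed.

Lemma wact_altword_nonneg k : (k < m)%N -> exists a b,
  [/\ 0 <= a, 0 <= b & wact (altword k i j) (sr i) = a *: sr i + b *: sr j].
Proof.
move=> km; have st0 := sin_theta_gt0.
exists (sin (theta *+ (if odd k then k else k.+1)) / sin theta).
exists (sin (theta *+ (if odd k then k.+1 else k)) / sin theta); split.
- by rewrite divr_ge0 ?(ltW st0) // sin_theta_ge0 //; case: ifP => // _; apply: ltnW.
- by rewrite divr_ge0 ?(ltW st0) // sin_theta_ge0 //; case: ifP => // _; apply: ltnW.
apply: (@scalerI _ _ (sin theta)); first by rewrite gt_eqF.
rewrite wact_altword scalerDr !scalerA.
by rewrite ![sin theta * _]mulrC !divfK // gt_eqF.
Qed.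

Lemma wact_altword_double k x :
  wact (altword k.*2 i j) x = iter k (refl i \o refl j) x.
Proof. by elim: k => //= k ->; rewrite /= odd_double. Qed.

Lemma iter_refl_simple : iter m (refl i \o refl j) (sr i) = sr i.
Proof.
have st0 : sin theta != 0 by rewrite gt_eqF // sin_theta_gt0.
apply: (scalerI st0); rewrite -wact_altword_double wact_altword odd_double.
have e2 : theta *+ m.*2 = pi *+ 2 by rewrite -muln2 mulrnA theta_m.
by rewrite mulrS e2 sinD sin2pi cos2pi mulr1 mulr0 addr0 scale0r addr0.
Qed.

End Dihedral.

Lemma iter_morph1 (T : Type) (f op : T -> T) k :
  {morph f : x / op x} -> {morph iter k f : x / op x}.
Proof. by move=> fop x; elim: k => //= k ->. Qed.

Lemma iter_morph2 (T : Type) (f : T -> T) (op : T -> T -> T) k :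
  {morph f : x y / op x y} -> {morph iter k f : x y / op x y}.
Proof. by move=> fop x y; elim: k => //= k ->. Qed.

(** The space splits into the plane of the two simple roots, handled by [iter_refl_simple], and its
    orthogonal for the form, which both reflections fix. *)
Lemma iter_refl i j x : iter #[(s i * s j)%g]%g (refl i \o refl j) x = x.
Proof.
set m := #[_]%g; have [<-|ij] := eqVneq i j.
  by elim: m => //= k IHk; rewrite reflK.
have cancel k y : iter k (refl i \o refl j) (iter k (refl j \o refl i) y) = y.
  elim: k y => // k IH y; rewrite iterS -[iter k.+1 (refl j \o refl i) y]/(_ (iter k _ y)).
  by rewrite -iterS iterSr /= !reflK.
have itD k y z : iter k (refl i \o refl j) (y + z) =
    iter k (refl i \o refl j) y + iter k (refl i \o refl j) z.
  by apply: (iter_morph2 (op := +%R)) => {y z} y z; rewrite /= (reflD j y z); exact: reflD.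
have itZ k a y : iter k (refl i \o refl j) (a *: y) = a *: iter k (refl i \o refl j) y.
  by apply: (@iter_morph1 _ _ ( *:%R a)) => {y} y; rewrite /= (reflZ j a y); exact: reflZ.
have ei : iter m (refl i \o refl j) (sr i) = sr i by exact: iter_refl_simple.
have ej : iter m (refl i \o refl j) (sr j) = sr j.
  by rewrite -[RHS](cancel m) /m order_sgen_sym iter_refl_simple // eq_sym.
pose c := cos (pi / m%:R) : R.
have c1 : 1 - c ^+ 2 != 0.
  by rewrite -sin2cos2 expf_neq0 // gt_eqF // sin_theta_gt0.
pose p := B x (sr i); pose q := B x (sr j).
(* The orthogonal projection of x to the plane: the coefficients solve the Gram system, of
   determinant [1 - c ^+ 2]. *)
pose y := ((p + c * q) / (1 - c ^+ 2)) *: sr i + ((q + c * p) / (1 - c ^+ 2)) *: sr j.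
have yi : B y (sr i) = p.
  rewrite coxeter_formDl !coxeter_formZl coxeter_form_simple1 (coxeter_formC (sr j)).
  by rewrite coxeter_form_simple -/m -/c; field.
have yj : B y (sr j) = q.
  rewrite coxeter_formDl !coxeter_formZl coxeter_form_simple1.
  by rewrite coxeter_form_simple -/m -/c; field.
have fix_i z : B z (sr i) = 0 -> refl i z = z.
  by rewrite /refl_simple => ->; rewrite mulr0 scale0r subr0.
have fix_j z : B z (sr j) = 0 -> refl j z = z.
  by rewrite /refl_simple => ->; rewrite mulr0 scale0r subr0.
have BB t : B (x - y) t = B x t - B y t.
  by rewrite -scaleN1r coxeter_formDl coxeter_formZl mulN1r.
rewrite -(subrK y x) itD; congr (_ + _).
  by elim: (m) => //= k ->; rewrite /= fix_j ?fix_i // BB ?yi ?yj subrr.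
by rewrite itD !itZ ei ej.
Qed.

End Reflections.

(* The product of gT reaches ell through several canonical structures, which *)
(* lia does not identify.                                                    *)
Ltac ell_lia :=
  repeat (let a := fresh "a" in set a := (Defs.ell _ _); move: a => a); lia.

(** * Length, roots and positivity *)

Section CoxeterGroup.
Variables (R : realType) (gT : finGroupType) (S : {set gT}).
Import Order.TTheory GRing.Theory Num.Theory.
Local Open Scope ring_scope.

Local Notation n := #|S|.
Local Notation s := (@sgen gT S).
Local Notation root := 'rV[R]_n.
Local Notation B := (@coxeter_form R gT S).
Local Notation sr := (@simple_root R gT S).
Local Notation refl := (@refl_simple R gT S).
Local Notation act := (@coxact R gT S).
Local Notation wact := (@wact R gT S).
Local Notation ell := (ell S).

Hypothesis hWS : coxeter_system S.

Let S2 : forall x, x \in S -> #[x]%g = 2%N.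
Proof. by case: hWS. Qed.

Lemma coxeter_word w : exists r, wprod s r = w.
Proof.
apply: gen_wprod; case: hWS => <- _ _; congr <<_>>%g.
apply/setP => x; apply/imsetP/idP => [[i _ ->]|xS]; first exact: sgen_in.
by exists (enum_rank_in xS x); rewrite // /sgen enum_rankK_in.
Qed.

Lemma ell_word w : exists2 r, size r = ell w & wprod s r = w.
Proof. exact: (len_word coxeter_word). Qed.

Lemma ell_le r : (ell (wprod s r) <= size r)%N.
Proof. exact: len_wprod. Qed.

Lemma wprod_rev r : wprod s (rev r) = (wprod s r)^-1%g.
Proof.
elim: r => [|i r IH]; first by rewrite wprod_nil invg1.
by rewrite rev_cons -cats1 wprod_cat IH !wprod_cons wprod_nil mulg1 invMg sgenV.
Qed.

Lemma ellV (w : gT) : ell w^-1%g = ell w.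
Proof.
suff le u : (ell u^-1%g <= ell u)%N.
  by apply/eqP; rewrite eqn_leq le -{1}[w]invgK le.
by have [r <- <-] := ell_word u; rewrite -wprod_rev -(size_rev r) ell_le.
Qed.

Lemma ellM (u v : gT) : (ell (u * v)%g <= ell u + ell v)%N.
Proof.
have [r <- <-] := ell_word u; have [r' <- <-] := ell_word v.
by rewrite -wprod_cat -size_cat ell_le.
Qed.

Lemma ell_gen i : (ell (s i) <= 1)%N.
Proof. by have := ell_le [:: i]; rewrite wprod_cons wprod_nil mulg1. Qed.

(** The universal property gives the sign character, sending every generator to the transposition of
    ['S_2]. *)
Lemma wprod_parity r r' : wprod s r = wprod s r' -> odd (size r) = odd (size r').
Proof.
case: hWS => _ _ uni; pose t : 'S_2 := tperm ord0 ord_max.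
have [|phi [phiM phis]] := uni _ (fun=> t).
  by move=> x y _ _; rewrite tperm2 expg1n.
have phi1 : phi 1%g = 1%g.
  by apply: (mulgI (phi 1%g)); rewrite -phiM !mulg1.
have phiW q : (phi (wprod s q) : bool) = odd (size q).
  elim: q => [|i q IH]; first by rewrite wprod_nil phi1 odd_perm1.
  by rewrite wprod_cons phiM phis ?sgen_in // odd_permM odd_tperm IH.
by rewrite -!phiW => ->.
Qed.

Lemma ell_parity r : odd (ell (wprod s r)) = odd (size r).
Proof. by have [r' <- /wprod_parity] := ell_word (wprod s r). Qed.

Lemma ell_neq (w : gT) i : ell (w * s i)%g != ell w.
Proof.
have [r sr wr] := ell_word w.
apply/negP => /eqP e; have := ell_parity (rcons r i).
rewrite size_rcons -cats1 wprod_cat wprod_cons wprod_nil mulg1 wr e -sr.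
by rewrite /=; case: odd.
Qed.

Lemma ell_step (w : gT) i :
  ell (w * s i)%g = (ell w).+1 \/ (ell (w * s i)%g).+1 = ell w.
Proof.
have := ell_neq w i; have h1 := ellM w (s i).
have := ellM (w * s i)%g (s i); rewrite -mulgA sgenK // mulg1.
have := ell_gen i; lia.
Qed.

Lemma ell1 : ell 1%g = 0%N.
Proof. by apply/eqP; rewrite -leqn0 -(@wprod_nil _ _ s) ell_le. Qed.

Lemma ell_desc (w : gT) : w != 1%g -> exists i, (ell (w * s i)%g < ell w)%N.
Proof.
have [r] := ell_word w; case/lastP: r => [|r i] lr wr.
  by rewrite -wr wprod_nil eqxx.
exists i; rewrite -{1}wr -cats1 wprod_cat wprod_cons wprod_nil mulg1 -mulgA sgenK //.
by rewrite mulg1; apply: leq_ltn_trans (ell_le r) _; rewrite -lr size_rcons.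
Qed.

(** By [iter_refl] the simple reflections satisfy the Coxeter relations, so the universal property
    extends them to a homomorphism into [gl_op]; hence a word and the [redword] of its product act
    alike. *)
Lemma coxact_wprod r x : act (wprod s r) x = wact r x.
Proof.
have unit_refl i : lin1_mx (refl i) \in unitmx.
  have e : lin1_mx (refl i) *m lin1_mx (refl i) = 1%:M.
    apply/row_matrixP => j; rewrite !rowE mulmxA !mul_rV_lin1 mulmx1.
    exact: reflK.
  by case: (mulmx1_unit e).
pose rho i : gl_op R n := exist (fun A => A \in unitmx) _ (unit_refl i).
have rhoE i y : gl_act (rho i) y = refl i y by exact: mul_rV_lin1.
pose f g := if [pick i | s i == g] is Some i then rho i else 1%g.
have fE i : f (s i) = rho i.
  rewrite /f; case: pickP => [j /eqP/sgen_inj -> //|/(_ i)]; by rewrite eqxx.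
case: hWS => _ _ uni; have [|phi [phiM phis]] := uni _ f.
  move=> g h /[dup] gS gS' /[dup] hS hS'.
  rewrite -[g](enum_rankK_in gS' gS') -[h](enum_rankK_in hS' hS').
  rewrite -/(s _) -/(s _) !fE.
  set i := enum_rank_in _ _; set j := enum_rank_in _ _.
  apply: gl_act_inj => y; rewrite gl_actX gl_act1.
  rewrite -[RHS](iter_refl S2 i j); apply: eq_iter => z.
  by rewrite gl_actM !rhoE.
have phi1 : phi 1%g = 1%g.
  by apply: (mulgI (phi 1%g)); rewrite -phiM !mulg1.
have phiW q y : gl_act (phi (wprod s q)) y = wact q y.
  elim: q y => [|i q IH] y; first by rewrite wprod_nil phi1 gl_act1.
  by rewrite wprod_cons phiM gl_actM IH phis ?sgen_in // fE rhoE.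
have [rw _] := redwordP coxeter_word (wprod s r).
by rewrite /coxact -[foldr _ _ _]/(wact _ x) -phiW rw phiW.
Qed.

Lemma coxactM (u v : gT) x : act (u * v)%g x = act u (act v x).
Proof.
have [r <-] := coxeter_word u; have [r' <-] := coxeter_word v.
by rewrite -wprod_cat !coxact_wprod /@wact foldr_cat.
Qed.

Lemma coxact1 x : act 1%g x = x.
Proof. by rewrite -(@wprod_nil _ _ s) coxact_wprod. Qed.

Lemma coxact_sgen i x : act (s i) x = refl i x.
Proof. by rewrite -[s i]mulg1 -(@wprod_nil _ _ s) -wprod_cons coxact_wprod. Qed.

Lemma coxactK (u : gT) : cancel (act u) (act u^-1%g).
Proof. by move=> x; rewrite -coxactM mulVg coxact1. Qed.

Lemma coxactKV (u : gT) : cancel (act u^-1%g) (act u).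
Proof. by move=> x; rewrite -coxactM mulgV coxact1. Qed.

Lemma coxactD u x y : act u (x + y) = act u x + act u y.
Proof. exact: (linearD (wact (redword s u))). Qed.

Lemma coxactZ u a x : act u (a *: x) = a *: act u x.
Proof. exact: (linearZ_LR (wact (redword s u))). Qed.

Lemma coxactN u x : act u (- x) = - act u x.
Proof. exact: (linearN (wact (redword s u))). Qed.

Lemma coxact_form u x y : B (act u x) (act u y) = B x y.
Proof.
have [r <-] := coxeter_word u; rewrite !coxact_wprod.
by elim: r => //= i r IH; rewrite refl_form.
Qed.

Lemma altword_cat a b (i j : 'I_n) :
  exists2 p, altword (a + b) i j = p ++ altword b i j & size p = a.
Proof.
elim: a => [|a [p e sp]]; first by exists [::].
by exists ((if odd (a + b) then i else j) :: p); rewrite /= ?e ?sp.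
Qed.

Lemma size_altword k (i j : 'I_n) : size (altword k i j) = k.
Proof. by elim: k => //= k ->. Qed.

(** The alternating word of length 2m spells 1 and starts with [i], so its right half is the inverse
    of its left half and can be written with m letters ending in [s i], which cancels. *)
Lemma altword_braid i j (m := #[(s i * s j)%g]%g) :
  (ell (wprod s (altword m i j) * s i)%g < m)%N.
Proof.
have m0 : (0 < m)%N by exact: order_gt0.
have em : wprod s (altword (m + m) i j) = 1%g.
  rewrite addnn -[RHS](expg_order (s i * s j)%g) -/m.
  elim: (m) => [|k IH]; first by rewrite wprod_nil expg0.
  by rewrite /= odd_double /= !wprod_cons IH expgS mulgA.
move: em; rewrite -{1}(prednK m0) addSn /=.
have -> : odd (m.-1 + m) by move: m0; case: (m) => // k _; rewrite oddD /=; case: odd.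
have [p -> sp] := altword_cat m.-1 m i j.
rewrite wprod_cons wprod_cat mulgA => /eqP; rewrite -eq_invg_mul => /eqP <-.
rewrite invMg -mulgA (sgenV S2) sgenK // mulg1 ellV.
by apply: leq_ltn_trans (ell_le p) _; rewrite sp prednK.
Qed.

(* Split off from a reduced word of w the longest suffix alternating between *)
(* s_i and another right descent s_j: the complementary factor v has neither *)
(* of them as a descent, and the suffix is too short to reach the longest    *)
(* element of the dihedral subgroup.                                         *)
Lemma coxact_simple_ge0 (w : gT) i : (ell w < ell (w * s i)%g)%N ->
  forall l, 0 <= act w (sr i) 0 l.
Proof.
have [N] := ubnP (ell w); elim: N w i => // N IH w i; rewrite ltnS => wN wi l.
have [->|w1] := eqVneq w 1%g; first by rewrite coxact1 mxE ler0n.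
have [j wj] := ell_desc w1.
have ij : i != j by apply: contraTneq wj => <-; rewrite -leqNgt ltnW.
pose P k := [exists v : gT, (w == v * wprod s (altword k i j))%g && (ell v + k == ell w)%N].
have P1 : P 1%N.
  apply/existsP; exists (w * s j)%g; rewrite wprod_cons wprod_nil mulg1 -mulgA.
  rewrite sgenK // mulg1 eqxx /=; have := ell_step w j; lia.
have exP : exists k, P k by exists 1%N.
have bdP k : P k -> (k <= ell w)%N by case/existsP => v /andP[_ /eqP]; lia.
have [k /existsP[v /andP[/eqP wv /eqP lv]] kmax] := ex_maxnP exP bdP.
have k1 : (0 < k)%N by apply: kmax.
have vw : (ell v < ell w)%N by lia.
have asc (c : 'I_n) : c \in [:: i; j] -> (ell v < ell (v * s c)%g)%N.
  move=> cij; have := ell_step v c; case=> [|down]; first by move=> ->.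
  have [cn|cn] := boolP (c == if odd k then i else j).
    have : P k.+1.
      apply/existsP; exists (v * s c)%g; rewrite /= wprod_cons -(eqP cn).
      rewrite mulgA -(mulgA v) sgenK // mulg1 -wv eqxx /=.
      move: lv down; ell_lia.
    by move/kmax; rewrite ltnn.
  have cE : c = if odd k.-1 then i else j.
    move: cij cn; rewrite !inE -[in odd k](prednK k1) /=.
    by case: (odd k.-1) => /= /orP[] /eqP -> //; rewrite eqxx.
  have : w = (v * s c * wprod s (altword k.-1 i j))%g.
    by rewrite wv -{1}(prednK k1) /= wprod_cons -cE !mulgA.
  move/(congr1 ell) => ew.
  have := ellM (v * s c)%g (wprod s (altword k.-1 i j)); rewrite -ew.
  have := ell_le (altword k.-1 i j); rewrite size_altword.
  move: lv down k1; ell_lia.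
have [mk|km] := leqP #[(s i * s j)%g]%g k.
  set m := #[_]%g in mk.
  have [p ep sp] := altword_cat (k - m) m i j; rewrite subnK // in ep.
  have lm : (ell (wprod s (altword m i j) * s i)%g < m)%N := altword_braid i j.
  suff: False by [].
  move: wi; rewrite wv ep wprod_cat -!mulgA.
  have := ellM v (wprod s p * (wprod s (altword m i j) * s i))%g.
  have := ellM (wprod s p) (wprod s (altword m i j) * s i)%g.
  have := ell_le p; rewrite sp.
  have : ell w = ell (v * (wprod s p * wprod s (altword m i j)))%g.
    by rewrite -wprod_cat -ep -wv.
  move: lv lm mk; ell_lia.
have [a [b [a0 b0 e]]] := wact_altword_nonneg R S2 ij km.
rewrite wv coxactM coxact_wprod e coxactD !coxactZ !mxE.
by rewrite addr_ge0 // mulr_ge0 // IH ?asc ?inE ?eqxx ?orbT //; lia.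
Qed.

Definition pos_row (x : root) := [forall l, 0 <= x 0 l].

(** If [w * s i] were shorter than w, both the image of [sr i] under w and its negative would be
    nonnegative, hence zero, although the form takes the value 1 on it. *)
Lemma coxact_pos (w : gT) i : pos_row (act w (sr i)) = (ell w < ell (w * s i)%g)%N.
Proof.
have pos u : (ell u < ell (u * s i)%g)%N -> pos_row (act u (sr i)).
  by move=> h; apply/forallP; apply: coxact_simple_ge0.
apply/idP/idP => [p|]; last exact: pos.
case: (ell_step w i) => [-> //|down].
have := pos (w * s i)%g; rewrite -mulgA sgenK // mulg1 -down ltnSn => /(_ isT).
rewrite coxactM coxact_sgen refl_simpleE // coxactN => q.
have z : act w (sr i) = 0.
  apply/rowP => l; apply/eqP; rewrite mxE eq_le (forallP p l) andbT.
  by have := forallP q l; rewrite mxE oppr_ge0.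
have := coxeter_form_simple1 R S2 i; rewrite -(coxact_form w) z /coxeter_form.
by rewrite !mul0mx mxE => /eqP; rewrite eq_sym oner_eq0.
Qed.

Definition is_root (x : root) := x \in coxeter_roots R S.

Lemma is_rootP x : reflect (exists u i, x = act u (sr i)) (is_root x).
Proof.
rewrite /is_root mem_undup; apply: (iffP allpairsP) => [[[u i] [_ _ ->]]|[u [i ->]]].
  by exists u, i.
by exists (u, i); rewrite !mem_enum.
Qed.

Lemma is_root_coxact u x : is_root (act u x) = is_root x.
Proof.
apply/is_rootP/is_rootP => [[v [i e]]|[v [i ->]]].
  by exists (u^-1 * v)%g, i; rewrite coxactM -e coxactK.
by exists (u * v)%g, i; rewrite coxactM.
Qed.

Lemma is_root_simple i : is_root (sr i).
Proof. by apply/is_rootP; exists 1%g, i; rewrite coxact1. Qed.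

Lemma is_rootN x : is_root (- x) = is_root x.
Proof.
suff im y : is_root y -> is_root (- y).
  by apply/idP/idP => /im //; rewrite opprK.
case/is_rootP => u [i ->]; rewrite -coxactN is_root_coxact -refl_simpleE //.
by rewrite -coxact_sgen is_root_coxact is_root_simple.
Qed.

Lemma pos_rowN x : is_root x -> pos_row (- x) = ~~ pos_row x.
Proof.
case/is_rootP => u [i ->]; rewrite -coxactN -refl_simpleE // -coxact_sgen.
rewrite -coxactM !coxact_pos -mulgA sgenK // mulg1 -leqNgt.
by rewrite ltn_neqAle ell_neq.
Qed.

Lemma is_root_form x : is_root x -> B x x = 1.
Proof. by case/is_rootP => u [i ->]; rewrite coxact_form coxeter_form_simple1. Qed.

Lemma pos_row_simple i : pos_row (sr i).
Proof. by apply/forallP => l; rewrite mxE ler0n. Qed.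

(** Only coordinate i changes, so another nonzero coordinate keeps the sign of the root; without
    one, x is a multiple of [sr i] with [B x x = 1]. *)
Lemma pos_row_refl i x : is_root x -> x != sr i -> pos_row x -> pos_row (refl i x).
Proof.
move=> rx xi px; have rrx : is_root (refl i x) by rewrite -coxact_sgen is_root_coxact.
have [/existsP[l /andP[li xl]]|] := boolP [exists l, (l != i) && (x 0 l != 0)].
  have rl : refl i x 0 l = x 0 l.
    by rewrite /refl_simple mxE [X in _ + X]mxE [X in - X]mxE mxE (negPf li) andbF mulr0 subr0.
  apply: contraT; rewrite -pos_rowN // => /forallP/(_ l).
  rewrite mxE rl oppr_ge0 => xl0.
  by case/eqP: xl; apply/eqP; rewrite eq_le xl0 (forallP px).
rewrite negb_exists => /forallP h.
have ex : x = x 0 i *: sr i.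
  apply/rowP => l; rewrite !mxE eqxx /=; have := h l; have [->|li] := eqVneq l i.
    by rewrite mulr1.
  by rewrite /= negbK => /eqP ->; rewrite mulr0.
have := is_root_form rx; rewrite ex coxeter_formZl coxeter_formZr // => /eqP.
rewrite coxeter_form_simple1 // mulr1 -expr2 sqrf_eq1 => /orP[] /eqP x1.
  by case/eqP: xi; rewrite ex x1 scale1r.
by have := forallP px i; rewrite x1 oppr_ge0 ler10.
Qed.

(** The simple reflection changes the sign of no root other than plus or minus [sr i]. This form is
    made to telescope along a word in [sum_rdelta_pull]. *)
Lemma pos_row_diff (Z : pzRingType) i x : is_root x ->
  (x == sr i)%:R - (x == - sr i)%:R = (pos_row x)%:R - (pos_row (refl i x))%:R :> Z.
Proof.
move=> rx; have pi := pos_row_simple i; have ri := is_root_simple i.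
have ni : pos_row (- sr i) = false by rewrite pos_rowN // pi.
have [->|xi] := eqVneq x (sr i).
  have -> : sr i == - sr i = false by apply: contraFF ni => /eqP <-.
  by rewrite refl_simpleE // pi ni.
have [->|xni] := eqVneq x (- sr i).
  by rewrite linearN /= refl_simpleE // opprK pi ni.
suff -> : pos_row (refl i x) = pos_row x by rewrite !subrr.
have rrx : is_root (refl i x) by rewrite -coxact_sgen is_root_coxact.
have [px|] := boolP (pos_row x); first exact: pos_row_refl.
rewrite -pos_rowN // => px; apply/negbTE; rewrite -pos_rowN //.
rewrite (_ : - refl i x = refl i (- x)); last by rewrite -!coxact_sgen coxactN.
by apply: pos_row_refl; rewrite ?is_rootN // eqr_oppLR.
Qed.

(** An element other than 1 has a right descent and so makes a simple root negative. *)
Lemma coxact_faithful u v : act u =1 act v -> u = v.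
Proof.
move=> uv; have [/eqP|n1] := eqVneq (u * v^-1)%g 1%g.
  by rewrite -eq_mulgV1 => /eqP.
case: (ell_desc n1) => i; rewrite ltnNge => /negP[]; apply: ltnW.
rewrite -coxact_pos coxactM uv coxactKV; exact: pos_row_simple.
Qed.

Local Notation rr := (@root_reflection R gT S).

(** The right side involves the root alone, so by faithfulness the pair picked in [root_reflection]
    does not matter. *)
Lemma coxact_root_reflection a x : is_root a ->
  act (rr a) x = x - (2 * B x a) *: a.
Proof.
case/is_rootP => u0 [i0 ->]; rewrite /root_reflection.
case: pickP => [[u i] /= /eqP <-|/(_ (u0, i0))]; last by rewrite eqxx.
rewrite !coxactM coxact_sgen /refl_simple coxactD coxactN coxactZ coxactKV.
by rewrite -(coxact_form u) coxactKV.
Qed.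

Lemma coxact_root_reflectionE a : is_root a -> act (rr a) a = - a.
Proof.
move=> ra; rewrite coxact_root_reflection // is_root_form // mulr1.
by rewrite scaler_nat mulr2n opprD addrA subrr sub0r.
Qed.

Lemma root_reflection_coxact u a : is_root a -> rr (act u a) = (u * rr a * u^-1)%g.
Proof.
move=> ra; apply: coxact_faithful => x.
rewrite coxact_root_reflection ?is_root_coxact // !coxactM.
rewrite coxact_root_reflection // coxactD coxactN coxactZ coxactKV.
by rewrite -(coxact_form u (act u^-1%g x)) coxactKV.
Qed.

Lemma root_reflectionN a : is_root a -> rr (- a) = rr a.
Proof.
move=> ra; rewrite -coxact_root_reflectionE // root_reflection_coxact //.
by rewrite -mulgA mulgV mulg1.
Qed.

Lemma root_reflection_simple i : rr (sr i) = s i.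
Proof.
apply: coxact_faithful => x.
by rewrite coxact_root_reflection ?is_root_simple // coxact_sgen.
Qed.

Lemma root_reflectionK a : is_root a -> (rr a * rr a)%g = 1%g.
Proof.
case/is_rootP => u [i ->]; rewrite root_reflection_coxact ?is_root_simple //.
rewrite root_reflection_simple !mulgA -(mulgA _ u^-1%g u) mulVg mulg1.
by rewrite -(mulgA u) sgenK // mulg1 mulgV.
Qed.

Lemma root_reflectionV a : is_root a -> (rr a)^-1%g = rr a.
Proof. by move=> ra; apply/eqP; rewrite eq_invg_mul root_reflectionK. Qed.

Lemma root_reflection_in a : is_root a -> rr a \in reflections S.
Proof.
case/is_rootP => u [i ->]; rewrite root_reflection_coxact ?is_root_simple //.
rewrite root_reflection_simple; apply/imset2P.
exists (s i) u^-1%g; rewrite ?sgen_in ?inE //.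
by rewrite conjgE invgK mulgA.
Qed.

End CoxeterGroup.

(** * The tensor algebra and the braided factorial *)

Section TensorModel.
Import GRing.Theory.
Local Open Scope ring_scope.

Record is_basis (F : fieldType) (K : eqType) (M : lmodType F) (W : K -> M)
    (coef : K -> M -> F) (ext : forall N : lmodType F, (K -> N) -> M -> N) : Prop :=
  IsBasis {
    basis_ind : forall P : M -> Prop, P 0 -> (forall k, P (W k)) ->
      (forall c x y, P x -> P y -> P (c *: x + y)) -> forall x, P x;
    basis_coefP : forall k c x y, coef k (c *: x + y) = c * coef k x + coef k y;
    basis_coefW : forall k l, coef l (W k) = (k == l)%:R;
    basis_coef_inj : forall x y, (forall k, coef k x = coef k y) -> x = y;
    basis_extP : forall N f c x y, ext N f (c *: x + y) = c *: ext N f x + ext N f y;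
    basis_extW : forall N f k, ext N f (W k) = f k }.

(* The tensor algebra over I and its tensor square, known only through their *)
(* bases: for the concrete monoid algebras, conversion is prohibitively slow. *)
Record tensor_model (F : fieldType) (I : eqType) := TensorModel {
  tm_alg : lalgType F;
  tm_sq : lmodType F;
  tm_word : seq I -> tm_alg;
  tm_word2 : (seq I * seq I)%type -> tm_sq;
  tm_coef : seq I -> tm_alg -> F;
  tm_coef2 : (seq I * seq I)%type -> tm_sq -> F;
  tm_ext : forall N : lmodType F, (seq I -> N) -> tm_alg -> N;
  tm_ext2 : forall N : lmodType F, ((seq I * seq I)%type -> N) -> tm_sq -> N;
  tm_basis : is_basis tm_word tm_coef tm_ext;
  tm_basis2 : is_basis tm_word2 tm_coef2 tm_ext2;
  tm_word_nil : tm_word [::] = 1;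
  tm_word_cat : forall k l, tm_word (k ++ l) = tm_word k * tm_word l;
  tm_scaleAr : forall c (a b : tm_alg), a * (c *: b) = c *: (a * b) }.

End TensorModel.

(** * The group action and the twisted derivations *)

Section TensorAlgebra.
Variables (R : realType) (gT : finGroupType) (S : {set gT}).
Import Order.TTheory GRing.Theory Num.Theory.
Local Open Scope ring_scope.

Local Notation n := #|S|.
Local Notation root := 'rV[R]_n.
Local Notation pos := (pos_root R S).
Local Notation act := (@coxact R gT S).
Local Notation rr := (@root_reflection R gT S).
Local Notation is_root := (@is_root R gT S).

Hypothesis hWS : coxeter_system S.

Variables (F : fieldType) (tm : tensor_model F pos).
Local Notation T := (tm_alg tm).
Local Notation T2 := (tm_sq tm).
Local Notation W := (tm_word tm).
Local Notation letter p := (W [:: p]).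
Local Notation coef := (tm_coef (t := tm)).
Local Notation coef2 := (tm_coef2 (t := tm)).
Local Notation ext := (tm_ext (t := tm)).
Local Notation ext2 := (tm_ext2 (t := tm)).

Let W0 : W [::] = 1 := tm_word_nil tm.
Let W_cat k l : W (k ++ l) = W k * W l := tm_word_cat tm k l.
Let tscaleAr c (a b : T) : a * (c *: b) = c *: (a * b) := tm_scaleAr c a b.
Let W_ind := basis_ind (tm_basis tm).
Let coefP := basis_coefP (tm_basis tm).
Let coefW := basis_coefW (tm_basis tm).
Let tensorP := basis_coef_inj (tm_basis tm).
Let extP := basis_extP (tm_basis tm).
Let extW := basis_extW (tm_basis tm).

Lemma W_cons p k : W (p :: k) = letter p * W k.
Proof. exact: (W_cat [:: p]). Qed.

Lemma tensor_ind (P : T -> Prop) : P 0 ->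
  P 1 -> (forall p k, P (W k) -> P (letter p * W k)) ->
  (forall c a b, P a -> P b -> P (c *: a + b)) -> forall a, P a.
Proof.
move=> P0 P1 Pl Plin; apply: W_ind => //.
by elim=> [|p k IH]; rewrite ?W0 // W_cons; apply: Pl.
Qed.

Lemma tmulrP (a : T) c x y : a * (c *: x + y) = c *: (a * x) + a * y.
Proof. by rewrite mulrDr tscaleAr. Qed.

Lemma tmullP (a : T) c x y : (c *: x + y) * a = c *: (x * a) + y * a.
Proof. by rewrite mulrDl scalerAl. Qed.

Lemma linP0 (M N : lmodType F) (f : M -> N) :
  (forall c x y, f (c *: x + y) = c *: f x + f y) -> f 0 = 0.
Proof.
by move=> fP; have := fP (-1) 0 0; rewrite scaler0 addr0 scaleN1r addNr.
Qed.

Lemma linPN (M N : lmodType F) (f : M -> N) :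
  (forall c x y, f (c *: x + y) = c *: f x + f y) -> forall x, f (- x) = - f x.
Proof. by move=> fP x; rewrite -scaleN1r -[_ *: _]addr0 fP linP0 // addr0 scaleN1r. Qed.

Lemma coef0 k : coef k 0 = 0.
Proof. by have := coefP k (-1) 0 0; rewrite scaler0 addr0 mulN1r addNr. Qed.

Lemma coefN k x : coef k (- x) = - coef k x.
Proof. by rewrite -scaleN1r -[_ *: _]addr0 coefP coef0 addr0 mulN1r. Qed.

(** Counterpart of [xroot] in an arbitrary tensor model. [tact], [coprd], [trev] and [pair] likewise
    mirror [tensor_act], [coprod], [rho] and [ev]. *)
Definition xr (a : root) : T :=
  if insub a is Some p then letter p
  else if insub (- a) is Some p then - letter p else 0.
Local Notation X := xr.

Definition tact (u : gT) : T -> T :=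
  ext (fun k => \prod_(p <- k) X (act u (val p))).

Lemma mem_pos (a : root) : (a \in positive_roots R S) = pos_row a && is_root a.
Proof. by rewrite mem_filter. Qed.

Lemma pos_is_root (p : pos) : is_root (val p).
Proof. by have := valP p; rewrite mem_pos => /andP[]. Qed.

Lemma pos_pos_row (p : pos) : pos_row (val p).
Proof. by have := valP p; rewrite mem_pos => /andP[]. Qed.

Lemma root_cases a : is_root a -> exists p : pos, a = val p \/ a = - val p.
Proof.
move=> ra; have [pa|na] := boolP (pos_row a).
  have ma : a \in positive_roots R S by rewrite mem_pos pa.
  by exists (SeqSub ma); left.
have ma : - a \in positive_roots R S by rewrite mem_pos pos_rowN // na is_rootN.
by exists (SeqSub ma); right; rewrite opprK.
Qed.

Lemma val_pos_neqN (p q : pos) : val p != - val q.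
Proof.
apply: contraTneq (pos_pos_row p) => ->.
by rewrite pos_rowN ?pos_is_root // pos_pos_row.
Qed.

Lemma xroot_val p : X (val p) = letter p.
Proof. by rewrite /xr valK. Qed.

Lemma xroot_valN p : X (- val p) = - letter p.
Proof.
rewrite /xr insubF; last first.
  by rewrite mem_pos pos_rowN ?pos_is_root // pos_pos_row.
by rewrite opprK valK.
Qed.

Lemma xrootN a : is_root a -> X (- a) = - X a.
Proof.
case/root_cases => p [] ->; first by rewrite xroot_val xroot_valN.
by rewrite opprK xroot_val xroot_valN opprK.
Qed.

(* The value at x_b of the odd function on roots dual to x_a. *)
Definition rdelta (a b : root) : F := (a == b)%:R - (a == - b)%:R.

Lemma rdeltaNl a b : rdelta (- a) b = - rdelta a b.
Proof. by rewrite /rdelta eqr_oppLR eqr_opp opprB. Qed.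

Lemma rdeltaNr a b : rdelta a (- b) = - rdelta a b.
Proof. by rewrite /rdelta opprK opprB. Qed.

Lemma rdelta_coxact u a b : rdelta (act u a) (act u b) = rdelta a b.
Proof.
by rewrite /rdelta -coxactN // !(can_eq (coxactK hWS u)).
Qed.

Lemma rdelta_pos (p q : pos) : rdelta (val p) (val q) = (p == q)%:R.
Proof.
rewrite /rdelta; have /negPf -> := val_pos_neqN p q.
by rewrite subr0 val_eqE.
Qed.

Lemma tactP u c a b : tact u (c *: a + b) = c *: tact u a + tact u b.
Proof. exact: extP. Qed.

Lemma tact0 u : tact u 0 = 0.
Proof. exact: (linP0 (tactP u)). Qed.

Lemma tact_W u k : tact u (W k) = \prod_(p <- k) X (act u (val p)).
Proof. exact: extW. Qed.

Lemma tact_letter u p : tact u (letter p) = X (act u (val p)).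
Proof. by rewrite (tact_W u [:: p]) big_seq1. Qed.

Lemma tact1 u : tact u 1 = 1.
Proof. by rewrite -{1}W0 tact_W big_nil. Qed.

Lemma tactM u a b : tact u (a * b) = tact u a * tact u b.
Proof.
elim/tensor_ind: a => [||p k IH|c x y IHx IHy].
- by rewrite tact0 !mul0r tact0.
- by rewrite tact1 !mul1r.
- elim/W_ind: b {IH} => [|l|c x y IHx IHy].
  + by rewrite mulr0 tact0 mulr0.
  + by rewrite -W_cons -W_cat !tact_W big_cat.
  + by rewrite tmulrP !tactP IHx IHy tmulrP.
- by rewrite tmullP !tactP IHx IHy tmullP.
Qed.

Lemma tactN u x : tact u (- x) = - tact u x.
Proof. exact: (linPN (tactP u)). Qed.

Lemma tact_xroot u a : is_root a -> tact u (X a) = X (act u a).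
Proof.
case/root_cases => p [] ->; first by rewrite xroot_val tact_letter.
rewrite xroot_valN tactN tact_letter coxactN // xrootN //.
by rewrite is_root_coxact // pos_is_root.
Qed.

Lemma tact_comp u v x : tact (u * v)%g x = tact u (tact v x).
Proof.
elim/tensor_ind: x => [||p k IH|c x y IHx IHy].
- by rewrite !tact0.
- by rewrite !tact1.
- by rewrite !tactM IH !tact_letter tact_xroot ?is_root_coxact ?pos_is_root // coxactM.
- by rewrite !tactP IHx IHy.
Qed.

Lemma tact_id x : tact 1%g x = x.
Proof.
elim/tensor_ind: x => [||p k IH|c x y IHx IHy].
- by rewrite !tact0.
- by rewrite !tact1.
- by rewrite !tactM IH !tact_letter coxact1 // xroot_val.
- by rewrite !tactP IHx IHy.
Qed.

Lemma coef_letter_nil p (x : T) : coef [::] (letter p * x) = 0.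
Proof.
elim/W_ind: x => [|k|c x y IHx IHy]; first by rewrite mulr0 coef0.
  by rewrite -W_cons coefW.
by rewrite tmulrP coefP IHx IHy mulr0 addr0.
Qed.

Lemma coef_letter_cons p q k (x : T) :
  coef (q :: k) (letter p * x) = (q == p)%:R * coef k x.
Proof.
elim/W_ind: x => [|l|c x y IHx IHy]; first by rewrite mulr0 !coef0 mulr0.
  by rewrite -W_cons !coefW eqseq_cons eq_sym; case: (q == p);
    rewrite ?mul1r ?mul0r.
by rewrite tmulrP !coefP IHx IHy mulrDr mulrCA.
Qed.

Lemma coef_xroot_nil a (x : T) : is_root a -> coef [::] (X a * x) = 0.
Proof.
case/root_cases => p [] ->; first by rewrite xroot_val coef_letter_nil.
by rewrite xroot_valN mulNr coefN coef_letter_nil oppr0.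
Qed.

Lemma coef_xroot_cons a q k (x : T) : is_root a ->
  coef (q :: k) (X a * x) = rdelta (val q) a * coef k x.
Proof.
case/root_cases => p [] ->; first by rewrite xroot_val coef_letter_cons rdelta_pos.
by rewrite xroot_valN rdeltaNr rdelta_pos mulNr coefN coef_letter_cons mulNr.
Qed.

(* Left and right twisted derivations: the components of the coproduct in    *)
(* degrees (1, m - 1) and (m - 1, 1).                                        *)
Fixpoint lder_word (a : root) (k : seq pos) : T :=
  if k is q :: k' then
    rdelta a (val q) *: W k' + letter q * lder_word (act (rr (val q)) a) k'
  else 0.

Fixpoint rder_word (a : root) (k : seq pos) : T :=
  if k is q :: k' then
    rdelta a (val q) *: tact (rr (val q)) (W k') + letter q * rder_word a k'
  else 0.

Definition lder (a : root) : T -> T := ext (lder_word a).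
Definition rder (a : root) : T -> T := ext (rder_word a).

Lemma lderP a c x y : lder a (c *: x + y) = c *: lder a x + lder a y.
Proof. exact: extP. Qed.
Lemma rderP a c x y : rder a (c *: x + y) = c *: rder a x + rder a y.
Proof. exact: extP. Qed.

Lemma lder_W a k : lder a (W k) = lder_word a k.
Proof. exact: extW. Qed.
Lemma rder_W a k : rder a (W k) = rder_word a k.
Proof. exact: extW. Qed.

Lemma lder0 a : lder a 0 = 0.
Proof. exact: (linP0 (lderP a)). Qed.
Lemma rder0 a : rder a 0 = 0.
Proof. exact: (linP0 (rderP a)). Qed.

Lemma lder1 a : lder a 1 = 0.
Proof. by rewrite -W0 lder_W. Qed.
Lemma rder1 a : rder a 1 = 0.
Proof. by rewrite -W0 rder_W. Qed.

Lemma lder_letter a q x : lder a (letter q * x) =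
  rdelta a (val q) *: x + letter q * lder (act (rr (val q)) a) x.
Proof.
elim/W_ind: x => [|k|c x y IHx IHy].
- by rewrite !(mulr0, lder0) scaler0 addr0.
- by rewrite -W_cons !lder_W.
- by rewrite tmulrP !lderP IHx IHy !(scalerDr, tmulrP, scalerA) [c * _]mulrC addrACA.
Qed.

Lemma rder_letter a q x : rder a (letter q * x) =
  rdelta a (val q) *: tact (rr (val q)) x + letter q * rder a x.
Proof.
elim/W_ind: x => [|k|c x y IHx IHy].
- by rewrite !(mulr0, rder0, tact0) scaler0 addr0.
- by rewrite -W_cons !rder_W.
- by rewrite tmulrP !(rderP, tactP) IHx IHy !(scalerDr, tmulrP, scalerA) [c * _]mulrC addrACA.
Qed.

Lemma lderN a x : lder a (- x) = - lder a x.
Proof. exact: (linPN (lderP a)). Qed.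
Lemma rderN a x : rder a (- x) = - rder a x.
Proof. exact: (linPN (rderP a)). Qed.

Lemma lder_xroot a b x : is_root b -> lder a (X b * x) =
  rdelta a b *: x + X b * lder (act (rr b) a) x.
Proof.
case/root_cases => p [] ->; first by rewrite xroot_val lder_letter.
rewrite xroot_valN root_reflectionN ?pos_is_root // !mulNr lderN lder_letter opprD.
by rewrite rdeltaNr scaleNr.
Qed.

Lemma rder_xroot a b x : is_root b -> rder a (X b * x) =
  rdelta a b *: tact (rr b) x + X b * rder a x.
Proof.
case/root_cases => p [] ->; first by rewrite xroot_val rder_letter.
rewrite xroot_valN root_reflectionN ?pos_is_root // !mulNr rderN rder_letter opprD.
by rewrite rdeltaNr scaleNr.
Qed.

Lemma lder_tact u a x : lder (act u a) (tact u x) = tact u (lder a x).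
Proof.
elim/tensor_ind: x a => [||p k IH|c x y IHx IHy] a.
- by rewrite !(tact0, lder0).
- by rewrite !(tact1, lder1, tact0).
- have rp := pos_is_root p.
  rewrite tactM tact_letter lder_xroot ?is_root_coxact // rdelta_coxact.
  rewrite root_reflection_coxact // -coxactM // mulgKV coxactM // IH.
  by rewrite lder_letter tactP tactM tact_letter.
- by rewrite !(tactP, lderP) IHx IHy.
Qed.

Lemma rder_tact u a x : rder (act u a) (tact u x) = tact u (rder a x).
Proof.
elim/tensor_ind: x a => [||p k IH|c x y IHx IHy] a.
- by rewrite !(tact0, rder0).
- by rewrite !(tact1, rder1, tact0).
- have rp := pos_is_root p.
  rewrite tactM tact_letter rder_xroot ?is_root_coxact // rdelta_coxact.
  rewrite root_reflection_coxact // -tact_comp mulgKV tact_comp IH.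
  by rewrite rder_letter tactP tactM tact_letter.
- by rewrite !(tactP, rderP) IHx IHy.
Qed.

(** An instance of coassociativity: splitting off a first and a last factor of degree 1 can be done
    in either order. *)
Lemma lder_rder a b x : lder a (rder b x) = rder b (lder a x).
Proof.
elim/tensor_ind: x a => [||p k IH|c x y IHx IHy] a.
- by rewrite !(lder0, rder0).
- by rewrite !(lder1, rder1, lder0, rder0).
- rewrite rder_letter lderP lder_letter lder_letter rderP rder_letter IH.
  have e : a = act (rr (val p)) (act (rr (val p)) a).
    by rewrite -coxactM // root_reflectionK ?pos_is_root // coxact1.
  by rewrite {1}e lder_tact addrCA.
- by rewrite !(lderP, rderP) IHx IHy.
Qed.

(** * The braided factorial on lists of roots *)

Fixpoint root_braid (i : nat) (l : seq root) : seq root :=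
  match i, l with
  | 0, [:: a, b & r] => [:: act (rr a) b, a & r]
  | i'.+1, a :: r => a :: root_braid i' r
  | _, _ => l
  end.

(** The root that letter j becomes when the braiding moves it to the front across the letters before
    it. *)
Fixpoint pull (j : nat) (l : seq root) : root :=
  match j, l with
  | j'.+1, a :: r => act (rr a) (pull j' r)
  | _, a :: _ => a
  | _, [::] => 0
  end.

Definition omit (U : Type) (j : nat) (l : seq U) : seq U := take j l ++ drop j.+1 l.

Lemma size_omit (U : Type) j (l : seq U) : (j < size l)%N -> size (omit j l) = (size l).-1.
Proof. by move=> jl; rewrite size_cat size_take size_drop jl; lia. Qed.

Lemma omit0 (U : Type) (a : U) l : omit 0 (a :: l) = l.
Proof. by rewrite /omit /= drop0. Qed.

Lemma omitS (U : Type) j (a : U) l : omit j.+1 (a :: l) = a :: omit j l.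
Proof. by []. Qed.

Lemma size_root_braid i l : size (root_braid i l) = size l.
Proof. by elim: i l => [|i IH] [|a [|b r]] //=; rewrite ?IH //; case: r. Qed.

Lemma all_root_braid i l : all is_root l -> all is_root (root_braid i l).
Proof.
elim: i l => [|i IH] [|a l] //=; last by case/andP => -> /IH.
by case: l => [|b r] //= /and3P[ra rb rl]; rewrite is_root_coxact // ra rb.
Qed.

Lemma root_braid_action N :
  braid_action (fun l => size l = N /\ all is_root l) N root_braid.
Proof.
split=> [i l _ [sl rl]|i j l ij jN [sl rl]|i l iN [sl rl]].
- by rewrite size_root_braid all_root_braid.
- elim: i j l N ij jN sl rl => [|i IH] [|j] [|a l] N //.
    case: j l => [|j] [|b l] //.
  move=> ij; case: N => // N jN [sl] /andP[ra rl] /=; congr (_ :: _).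
  by apply: (IH _ _ N).
elim: i l N iN sl rl => [|i IH] [|a l] N.
- by move=> h /= e; rewrite -e in h.
- move=> iN sl; case: l sl => [|b [|c l]] sl; try by move: iN; rewrite -sl.
  move=> /= /and4P[ra rb rc _]; congr [:: _, _ & _].
  by rewrite root_reflection_coxact // -!coxactM // mulgKV.
- by [].
case: N => // N iN [sl] /andP[ra rl] /=; congr (_ :: _).
by apply: (IH _ N).
Qed.

Definition xroots (l : seq root) : T := \prod_(a <- l) X a.

(** Summed over Lehmer words; [brd_fact_atE] identifies this with the sum over chosen reduced
    words. *)
Definition fact_roots (l : seq root) : T :=
  \sum_(c <- lehmer_codes (size l)) xroots (foldr root_braid l (lehmer_word c)).

Lemma foldr_root_braid_shift a l r :
  foldr root_braid (a :: l) [seq i.+1 | i <- r] = a :: foldr root_braid l r.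
Proof. by elim: r => //= i r ->. Qed.

Lemma foldr_root_braid_iota j l : (j < size l)%N ->
  foldr root_braid l (iota 0 j) = pull j l :: omit j l.
Proof.
elim: j l => [|j IH] [|a l] //=; first by rewrite omit0.
rewrite ltnS => jl.
by rewrite -[1%N]/(1 + 0)%N iotaDl foldr_root_braid_shift IH.
Qed.

(** The first entry of a Lehmer code selects the strand moved to the front and the rest permutes the
    remaining strands, which factors [m]! through [m - 1]!. *)
Lemma fact_roots_cons l : l != [::] ->
  fact_roots l = \sum_(j <- iota 0 (size l)) X (pull j l) * fact_roots (omit j l).
Proof.
case El: l => [|a l'] // _; rewrite -El.
have -> : size l = (size l').+1 by rewrite El.
rewrite /fact_roots El lehmer_codesS big_allpairs_dep /=.
apply: eq_big_seq => j; rewrite -[_ :: _]/(iota 0 (size l').+1) mem_iota add0n /= => jl.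
rewrite big_distrr /=.
have -> : size (omit j (a :: l')) = size l'.
  by rewrite size_omit.
apply: eq_bigr => c _; rewrite foldr_cat foldr_root_braid_iota //.
by rewrite foldr_root_braid_shift /xroots big_cons.
Qed.

Definition fact : T -> T := ext (fun k => fact_roots [seq val p | p <- k]).

Lemma factP c x y : fact (c *: x + y) = c *: fact x + fact y.
Proof. exact: extP. Qed.

Lemma fact0 : fact 0 = 0.
Proof. exact: linP0 factP. Qed.

Lemma fact_W k : fact (W k) = fact_roots [seq val p | p <- k].
Proof. exact: extW. Qed.

Lemma fact1 : fact 1 = 1.
Proof. by rewrite -{1}W0 fact_W /fact_roots /= big_seq1 /xroots big_nil. Qed.

Lemma all_is_root_val (k : seq pos) : all is_root [seq val p | p <- k].
Proof. by rewrite all_map; apply/allP => p _; apply: pos_is_root. Qed.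

Lemma is_root_pull j l : (j < size l)%N -> all is_root l -> is_root (pull j l).
Proof.
elim: j l => [|j IH] [|a l] //=; first by move=> _ /andP[].
by move=> jl /andP[ra rl]; rewrite is_root_coxact // IH.
Qed.

Lemma map_omit (U V : Type) (f : U -> V) j l :
  [seq f x | x <- omit j l] = omit j [seq f x | x <- l].
Proof. by rewrite /omit map_cat map_take map_drop. Qed.

Lemma lder_W_sum a k : lder a (W k) =
  \sum_(j <- iota 0 (size k)) rdelta a (pull j [seq val p | p <- k]) *: W (omit j k).
Proof.
elim: k a => [|q k IH] a; first by rewrite W0 lder1 big_nil.
rewrite W_cons lder_letter IH /= big_cons omit0; congr (_ + _).
rewrite -[1%N]/(1 + 0)%N iotaDl big_map big_distrr /=; apply: eq_bigr => j _.
rewrite tscaleAr -W_cons; congr (_ *: _).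
rewrite -(rdelta_coxact (rr (val q)) a) -coxactM // root_reflectionK ?pos_is_root //.
by rewrite coxact1.
Qed.

Lemma coef_sum (I : Type) (r : seq I) k (f : I -> T) :
  coef k (\sum_(i <- r) f i) = \sum_(i <- r) coef k (f i).
Proof.
elim: r => [|i r IH]; first by rewrite !big_nil coef0.
by rewrite !big_cons -[f i]scale1r coefP IH mul1r scale1r.
Qed.

Lemma coefZ c k x : coef k (c *: x) = c * coef k x.
Proof. by rewrite -[_ *: _]addr0 coefP coef0 addr0. Qed.

Lemma fact_sum (I : Type) (r : seq I) (f : I -> T) :
  fact (\sum_(i <- r) f i) = \sum_(i <- r) fact (f i).
Proof.
elim: r => [|i r IH]; first by rewrite !big_nil fact0.
by rewrite !big_cons -[f i]scale1r factP IH !scale1r.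
Qed.

Lemma factZ c x : fact (c *: x) = c *: fact x.
Proof. by rewrite -[_ *: _]addr0 factP fact0 addr0. Qed.

Lemma coef_fact_nil x : coef [::] (fact x) = coef [::] x.
Proof.
elim/W_ind: x => [|k|c x y IHx IHy]; first by rewrite fact0.
  have [->|k0] := eqVneq k [::]; first by rewrite W0 fact1.
  rewrite fact_W fact_roots_cons; last by case: (k) k0.
  rewrite coefW (negPf k0) coef_sum big_seq big1 // => j.
  rewrite mem_iota => /andP[_ jk]; rewrite coef_xroot_nil //.
  by apply: is_root_pull; rewrite ?all_is_root_val.
by rewrite factP !coefP IHx IHy.
Qed.

(** Taking the coefficient at first letter p in [fact_roots_cons] weights the j-th term by [rdelta]
    at the pulled root, exactly as [lder (val p)] does. *)
Lemma coef_fact_cons p l x :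
  coef (p :: l) (fact x) = coef l (fact (lder (val p) x)).
Proof.
elim/W_ind: x => [|k|c x y IHx IHy]; first by rewrite lder0 fact0 !coef0.
  have [->|k0] := eqVneq k [::].
    by rewrite W0 lder1 fact1 fact0 coef0 -W0 coefW.
  rewrite fact_W fact_roots_cons; last by case: (k) k0.
  rewrite lder_W_sum fact_sum !coef_sum size_map; apply: eq_big_seq => j.
  rewrite mem_iota => /andP[_ jk].
  rewrite coef_xroot_cons; last first.
    by apply: is_root_pull; rewrite ?size_map ?all_is_root_val.
  by rewrite factZ coefZ fact_W map_omit.
by rewrite factP lderP factP !coefP IHx IHy.
Qed.

Lemma coef_lder_nil a x : coef [::] (lder a x) = coef [::] (rder a x).
Proof.
elim/tensor_ind: x => [||p k _|c x y IHx IHy].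
- by rewrite lder0 rder0.
- by rewrite lder1 rder1.
- rewrite lder_letter rder_letter !coefP !coef_letter_nil !addr0.
  congr (_ * _); elim/tensor_ind: (W k) => [||q l IH|c x y IHx IHy].
  + by rewrite tact0.
  + by rewrite tact1.
  + rewrite tactM tact_letter coef_letter_nil coef_xroot_nil //.
    by rewrite is_root_coxact // pos_is_root.
  + by rewrite tactP !coefP IHx IHy.
- by rewrite lderP rderP !coefP IHx IHy.
Qed.

Lemma coef_fact_rcons p l x :
  coef (rcons l p) (fact x) = coef l (fact (rder (val p) x)).
Proof.
elim: l x => [|q l IH] x /=.
  by rewrite coef_fact_cons !coef_fact_nil coef_lder_nil.
by rewrite !coef_fact_cons IH lder_rder.
Qed.

(** * The coproduct *)

Let W2_ind := basis_ind (tm_basis2 tm).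
Let coef2P := basis_coefP (tm_basis2 tm).
Let coef2W := basis_coefW (tm_basis2 tm).
Let ext2P := basis_extP (tm_basis2 tm).
Let ext2W := basis_extW (tm_basis2 tm).

Definition tns (a b : T) : T2 :=
  ext (fun k => ext (fun l => tm_word2 tm (k, l)) b) a.

Record bilin (M : lmodType F) (G : T -> T -> M) : Prop := Bilin {
  bilinl : forall b c x y, G (c *: x + y) b = c *: G x b + G y b;
  bilinr : forall a c x y, G a (c *: x + y) = c *: G a x + G a y }.

Lemma tns_bilin : bilin tns.
Proof.
split=> [b c x y|a c x y]; first exact: extP.
elim/W_ind: a => [|k|d u v IHu IHv]; rewrite /tns.
- by rewrite !(linP0 (extP _)) scaler0 addr0.
- by rewrite !extW extP.
- rewrite !extP -!/(tns _ _) IHu IHv !scalerDr !scalerA [c * d]mulrC.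
  by rewrite addrACA.
Qed.

Lemma tns_W k l : tns (W k) (W l) = tm_word2 tm (k, l).
Proof. by rewrite /tns !extW. Qed.

Lemma bilin0l (M : lmodType F) (G : T -> T -> M) b : bilin G -> G 0 b = 0.
Proof. by case=> /(_ b) h _; exact: (linP0 h). Qed.

Lemma bilin0r (M : lmodType F) (G : T -> T -> M) a : bilin G -> G a 0 = 0.
Proof. by case=> _ /(_ a) h; exact: (linP0 h). Qed.

Lemma tns_ind (P : T2 -> Prop) : P 0 -> (forall k l, P (tns (W k) (W l))) ->
  (forall c a b, P a -> P b -> P (c *: a + b)) -> forall a, P a.
Proof.
by move=> P0 PW Plin; apply: W2_ind => // -[k l]; rewrite -tns_W.
Qed.

Lemma coef2_0 kl : coef2 kl 0 = 0.
Proof. by have := coef2P kl (-1) 0 0; rewrite scaler0 addr0 mulN1r addNr. Qed.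

Lemma coef2_tns k l a b : coef2 (k, l) (tns a b) = coef k a * coef l b.
Proof.
elim/W_ind: a => [|k'|c x y IHx IHy].
- by rewrite (bilin0l _ tns_bilin) coef2_0 coef0 mul0r.
- elim/W_ind: b => [|l'|c x y IHx IHy].
  + by rewrite (bilin0r _ tns_bilin) coef2_0 coef0 mulr0.
  + by rewrite tns_W coef2W !coefW xpair_eqE -natrM mulnb.
  + by rewrite (bilinr tns_bilin) coef2P IHx IHy coefP mulrDr mulrCA.
- by rewrite (bilinl tns_bilin) coef2P IHx IHy coefP mulrDl mulrA.
Qed.

Definition lift2 (M : lmodType F) (G : T -> T -> M) : T2 -> M :=
  ext2 (fun kl => G (W kl.1) (W kl.2)).

Lemma lift2P (M : lmodType F) (G : T -> T -> M) c x y :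
  lift2 G (c *: x + y) = c *: lift2 G x + lift2 G y.
Proof. exact: ext2P. Qed.

Lemma lift2_0 (M : lmodType F) (G : T -> T -> M) : lift2 G 0 = 0.
Proof. exact: linP0 (lift2P G). Qed.

Lemma lift2D (M : lmodType F) (G : T -> T -> M) x y :
  lift2 G (x + y) = lift2 G x + lift2 G y.
Proof. by rewrite -[x]scale1r lift2P !scale1r. Qed.

Lemma lift2_tns (M : lmodType F) (G : T -> T -> M) a b :
  bilin G -> lift2 G (tns a b) = G a b.
Proof.
move=> hG; elim/W_ind: a => [|k|c x y IHx IHy].
- by rewrite (bilin0l _ tns_bilin) lift2_0 bilin0l.
- elim/W_ind: b => [|l|c x y IHx IHy].
  + by rewrite (bilin0r _ tns_bilin) lift2_0 bilin0r.
  + by rewrite tns_W /lift2 ext2W.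
  + by rewrite (bilinr tns_bilin) lift2P IHx IHy (bilinr hG).
- by rewrite (bilinl tns_bilin) lift2P IHx IHy (bilinl hG).
Qed.

(** Left multiplication by x_p (x) 1 in the twisted product, and next to it by 1 (x) x_p;
    [sq_mul_letter] confirms this. *)
Definition sq_mull (p : pos) := lift2 (fun a b => tns (letter p * a) b).
Definition sq_mulr (p : pos) :=
  lift2 (fun a b => tns (tact (rr (val p)) a) (letter p * b)).

Definition lder2 a := lift2 (fun x y => tns (lder a x) y).

Definition counit2 := lift2 (fun x y : T => coef [::] x *: y).

Definition fact2 := lift2 (fun x y => tns (fact x) (fact y)).

Lemma sq_mull_lin p c x y : sq_mull p (c *: x + y) = c *: sq_mull p x + sq_mull p y.
Proof. exact: lift2P. Qed.
Lemma sq_mull_0 p : sq_mull p 0 = 0.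
Proof. exact: lift2_0. Qed.
Lemma sq_mull_D p x y : sq_mull p (x + y) = sq_mull p x + sq_mull p y.
Proof. exact: lift2D. Qed.
Lemma sq_mulr_lin p c x y : sq_mulr p (c *: x + y) = c *: sq_mulr p x + sq_mulr p y.
Proof. exact: lift2P. Qed.
Lemma sq_mulr_0 p : sq_mulr p 0 = 0.
Proof. exact: lift2_0. Qed.
Lemma sq_mulr_D p x y : sq_mulr p (x + y) = sq_mulr p x + sq_mulr p y.
Proof. exact: lift2D. Qed.
Lemma lder2_lin a c x y : lder2 a (c *: x + y) = c *: lder2 a x + lder2 a y.
Proof. exact: lift2P. Qed.
Lemma lder2_0 a : lder2 a 0 = 0.
Proof. exact: lift2_0. Qed.
Lemma lder2_D a x y : lder2 a (x + y) = lder2 a x + lder2 a y.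
Proof. exact: lift2D. Qed.
Lemma counit2_lin c x y : counit2 (c *: x + y) = c *: counit2 x + counit2 y.
Proof. exact: lift2P. Qed.
Lemma counit2_0 : counit2 0 = 0.
Proof. exact: lift2_0. Qed.
Lemma counit2_D x y : counit2 (x + y) = counit2 x + counit2 y.
Proof. exact: lift2D. Qed.
Lemma fact2_lin c x y : fact2 (c *: x + y) = c *: fact2 x + fact2 y.
Proof. exact: lift2P. Qed.
Lemma fact2_0 : fact2 0 = 0.
Proof. exact: lift2_0. Qed.
Lemma fact2_D x y : fact2 (x + y) = fact2 x + fact2 y.
Proof. exact: lift2D. Qed.
Let lin2P := (sq_mull_lin, sq_mulr_lin, lder2_lin, counit2_lin, fact2_lin).
Let lin20 := (sq_mull_0, sq_mulr_0, lder2_0, counit2_0, fact2_0).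
Let lin2D := (sq_mull_D, sq_mulr_D, lder2_D, counit2_D, fact2_D).

Lemma sq_mull_tns p a b : sq_mull p (tns a b) = tns (letter p * a) b.
Proof.
rewrite /sq_mull lift2_tns //; split=> [d c x y|d c x y].
  by rewrite tmulrP (bilinl tns_bilin).
by rewrite (bilinr tns_bilin).
Qed.

Lemma sq_mulr_tns p a b :
  sq_mulr p (tns a b) = tns (tact (rr (val p)) a) (letter p * b).
Proof.
rewrite /sq_mulr lift2_tns //; split=> [d c x y|d c x y].
  by rewrite tactP (bilinl tns_bilin).
by rewrite tmulrP (bilinr tns_bilin).
Qed.

Definition coprd : T -> T2 :=
  ext (fun k => foldr (fun p t => sq_mull p t + sq_mulr p t) (tns 1 1) k).

Lemma coprdP c x y : coprd (c *: x + y) = c *: coprd x + coprd y.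
Proof. exact: extP. Qed.

Lemma coprd1 : coprd 1 = tns 1 1.
Proof. by rewrite -[X in coprd X]W0 /coprd extW. Qed.

Lemma coprd0 : coprd 0 = 0.
Proof. exact: linP0 coprdP. Qed.

Lemma coprd_letter p x :
  coprd (letter p * x) = sq_mull p (coprd x) + sq_mulr p (coprd x).
Proof.
elim/W_ind: x => [|k|c x y IHx IHy].
- by rewrite mulr0 coprd0 !lin20 addr0.
- by rewrite -W_cons /coprd !extW.
- by rewrite tmulrP !coprdP IHx IHy !lin2P scalerDr addrACA.
Qed.

Lemma lder2_tns a x y : lder2 a (tns x y) = tns (lder a x) y.
Proof.
rewrite /lder2 lift2_tns //; split=> [d c u v|d c u v].
  by rewrite lderP (bilinl tns_bilin).
by rewrite (bilinr tns_bilin).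
Qed.

Lemma lder2_mull a p t :
  lder2 a (sq_mull p t) = rdelta a (val p) *: t + sq_mull p (lder2 (act (rr (val p)) a) t).
Proof.
elim/tns_ind: t => [|k l|c x y IHx IHy].
- by rewrite !lin20 scaler0 addr0.
- by rewrite !(sq_mull_tns, lder2_tns) lder_letter (bilinl tns_bilin).
- rewrite !lin2P IHx IHy !scalerDr !scalerA [_ * c]mulrC.
  by rewrite addrACA.
Qed.

Lemma lder2_mulr a p t :
  lder2 a (sq_mulr p t) = sq_mulr p (lder2 (act (rr (val p)) a) t).
Proof.
elim/tns_ind: t => [|k l|c x y IHx IHy].
- by rewrite !lin20.
- rewrite !(sq_mulr_tns, lder2_tns).
  have e : a = act (rr (val p)) (act (rr (val p)) a).
    by rewrite -coxactM // root_reflectionK ?pos_is_root // coxact1.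
  by rewrite {1}e lder_tact.
- by rewrite !lin2P IHx IHy.
Qed.

(** Coassociativity again: a first letter split off before the coproduct can as well be split off
    its left factor. *)
Lemma lder2_coprd a x : lder2 a (coprd x) = coprd (lder a x).
Proof.
elim/tensor_ind: x a => [||p k IH|c x y IHx IHy] a.
- by rewrite lder0 !coprd0 lin20.
- by rewrite lder1 coprd0 coprd1 lder2_tns lder1 (bilin0l _ tns_bilin).
- rewrite coprd_letter lin2D lder2_mull lder2_mulr !IH lder_letter coprdP.
  by rewrite coprd_letter addrA.
- by rewrite coprdP lderP !lin2P IHx IHy coprdP.
Qed.

Lemma counit2_tns x y : counit2 (tns x y) = coef [::] x *: y.
Proof.
rewrite /counit2 lift2_tns //; split=> [d c u v|d c u v].
  by rewrite coefP scalerDl scalerA.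
by rewrite scalerDr !scalerA mulrC.
Qed.

Lemma counit2_coprd x : counit2 (coprd x) = x.
Proof.
have hl p t : counit2 (sq_mull p t) = 0.
  elim/tns_ind: t => [|k l|c u v IHu IHv]; first by rewrite !lin20.
    by rewrite sq_mull_tns counit2_tns coef_letter_nil scale0r.
  by rewrite !lin2P IHu IHv scaler0 addr0.
have tact_nil u y : coef [::] (tact u y) = coef [::] y.
  elim/tensor_ind: y => [||q l IH|c y z IHy IHz].
  + by rewrite tact0.
  + by rewrite tact1.
  + rewrite tactM tact_letter coef_letter_nil coef_xroot_nil //.
    by rewrite is_root_coxact // pos_is_root.
  + by rewrite tactP !coefP IHy IHz.
have hr p t : counit2 (sq_mulr p t) = letter p * counit2 t.
  elim/tns_ind: t => [|k l|c u v IHu IHv]; first by rewrite !lin20 mulr0.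
    by rewrite sq_mulr_tns !counit2_tns tact_nil tscaleAr.
  by rewrite !lin2P IHu IHv tmulrP.
elim/tensor_ind: x => [||p k IH|c x y IHx IHy].
- by rewrite coprd0 lin20.
- by rewrite coprd1 counit2_tns -{1}W0 coefW scale1r.
- by rewrite coprd_letter lin2D hl hr IH add0r.
- by rewrite coprdP lin2P IHx IHy.
Qed.

Lemma fact2_tns x y : fact2 (tns x y) = tns (fact x) (fact y).
Proof.
rewrite /fact2 lift2_tns //; split=> [d c u v|d c u v].
  by rewrite factP (bilinl tns_bilin).
by rewrite factP (bilinr tns_bilin).
Qed.

(* fact intertwines the coproduct with deconcatenation of words. *)
Lemma coef2_fact2_coprd k l x :
  coef2 (k, l) (fact2 (coprd x)) = coef (k ++ l) (fact x).
Proof.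
elim: k x => [|p k IH] x /=.
  rewrite -[in RHS](counit2_coprd x).
  elim/tns_ind: (coprd x) => [|k' l'|c u v IHu IHv].
  - by rewrite !lin20 coef2_0 fact0 coef0.
  - by rewrite fact2_tns coef2_tns counit2_tns coef_fact_nil factZ coefZ.
  - by rewrite !lin2P coef2P IHu IHv factP coefP.
rewrite coef_fact_cons -IH -lder2_coprd.
elim/tns_ind: (coprd x) => [|k' l'|c u v IHu IHv].
- by rewrite !lin20 !coef2_0.
- by rewrite lder2_tns !fact2_tns !coef2_tns coef_fact_cons.
- by rewrite !lin2P !coef2P IHu IHv.
Qed.

(** * The kernel of F (x) F *)

Definition tns_sum (r : seq (T * T)) : T2 := \sum_(p <- r) tns p.1 p.2.

Lemma fact2_sum (r : seq (T * T)) :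
  fact2 (tns_sum r) = \sum_(p <- r) tns (fact p.1) (fact p.2).
Proof.
rewrite /tns_sum; elim: r => [|p r IH]; first by rewrite !big_nil lin20.
by rewrite !big_cons lin2D IH fact2_tns.
Qed.

Lemma tns_sum_exists t : exists r, t = tns_sum r.
Proof.
elim/tns_ind: t => [|k l|c x y [r ->] [q ->]].
- by exists [::]; rewrite /tns_sum big_nil.
- by exists [:: (W k, W l)]; rewrite /tns_sum big_seq1.
- exists ([seq (c *: p.1, p.2) | p <- r] ++ q).
  rewrite /tns_sum big_cat big_map /= scaler_sumr; congr (_ + _).
  apply: eq_bigr => p _; have := bilinl tns_bilin p.2 c p.1 0.
  by rewrite !addr0 (bilin0l _ tns_bilin) addr0.
Qed.

(* Elimination on the number of terms: if x is one of the left factors and   *)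
(* fact x has a nonzero coefficient, that coefficient expresses the matching *)
(* right factor modulo ker fact by the others.                               *)
Lemma fact2_ker r : fact2 (tns_sum r) = 0 ->
  exists q, (forall p, p \in q -> fact p.1 = 0 \/ fact p.2 = 0) /\ tns_sum r = tns_sum q.
Proof.
have [N] := ubnP (size r); elim: N r => // N IH [|[x y] r] /=.
  by move=> _ _; exists [::].
rewrite ltnS => rN h0.
have [x0|x0] := pselect (fact x = 0).
  have [|q [hq e]] := IH r rN.
    move: h0; rewrite !fact2_sum big_cons /= x0.
    by rewrite (bilin0l _ tns_bilin) add0r.
  exists ((x, y) :: q); split=> [p|]; last by rewrite /tns_sum !big_cons -!/(tns_sum _) e.
  by rewrite inE => /predU1P[->|/hq //]; left.
have [k ck] : exists k, coef k (fact x) != 0.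
  apply: contrapT => h; apply: x0; apply: tensorP => k; rewrite coef0.
  by apply/eqP; apply: contraPT isT => ck _; case: h; exists k.
pose c := coef k (fact x).
pose lam (p : T * T) := coef k (fact p.1) / c.
pose y' := y + \sum_(p <- r) lam p *: p.2.
have y'0 : fact y' = 0.
  apply: tensorP => l; rewrite coef0 /y' -[y]scale1r factP coefP mul1r fact_sum coef_sum.
  apply: (mulfI ck); rewrite mulr0 mulrDr big_distrr /=.
  have := congr1 (coef2 (k, l)) h0; rewrite coef2_0 fact2_sum big_cons /=.
  rewrite -[tns _ _]scale1r coef2P mul1r coef2_tns => h2.
  apply: etrans h2; congr (_ + _).
  elim: (r) => [|p q IHq]; first by rewrite !big_nil coef2_0.
  rewrite !big_cons -[tns _ _]scale1r coef2P mul1r coef2_tns -IHq; congr (_ + _).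
  by rewrite factZ coefZ /lam mulrA mulrCA mulfV // mulr1.
pose r' := [seq (p.1 - lam p *: x, p.2) | p <- r].
have e : tns_sum ((x, y) :: r) = tns x y' + tns_sum r'.
  rewrite /tns_sum big_cons /= /y' -[y]scale1r (bilinr tns_bilin) !scale1r -addrA.
  congr (_ + _); rewrite /r' big_map /=.
  have -> : tns x (\sum_(p <- r) lam p *: p.2) = \sum_(p <- r) lam p *: tns x p.2.
    elim: (r) => [|p q IHq]; first by rewrite !big_nil (bilin0r _ tns_bilin).
    by rewrite !big_cons (bilinr tns_bilin) IHq.
  rewrite -big_split /=; apply: eq_bigr => p _.
  rewrite -scaleNr addrC [p.1 + _]addrC (bilinl tns_bilin) scaleNr.
  by rewrite addrAC addNr add0r.
have xy0 : fact2 (tns x y') = 0 by rewrite fact2_tns y'0 (bilin0r _ tns_bilin).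
have [||q [hq e']] := IH r'; first by rewrite size_map.
  by move: h0; rewrite e lin2D xy0 add0r.
exists ((x, y') :: q); split=> [p|].
  by rewrite inE => /predU1P[->|/hq //]; right.
by rewrite e e' /tns_sum big_cons.
Qed.

Lemma fact2_sum_ker (r : seq (T * T)) :
  (forall p, p \in r -> fact p.1 = 0 \/ fact p.2 = 0) -> fact2 (tns_sum r) = 0.
Proof.
move=> hr; rewrite fact2_sum big_seq big1 // => p /hr[] ->.
  exact: bilin0l _ tns_bilin.
exact: bilin0r _ tns_bilin.
Qed.

Lemma fact2_kerP (t : T2) : fact2 t = 0 <->
  exists r : seq (T * T), (forall p, p \in r -> fact p.1 = 0 \/ fact p.2 = 0) /\
    t = tns_sum r.
Proof.
split=> [|[r [hr ->]]]; last exact: fact2_sum_ker.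
by have [r ->] := tns_sum_exists t => /fact2_ker.
Qed.

Lemma fact_B (x y : T) : fact (x - y) = fact x - fact y.
Proof. by rewrite addrC -scaleN1r factP scaleN1r addrC. Qed.

Lemma coef2_fact2_coprd_sub k l (x : T) (I : finType) (P : pred I) (f g : I -> T) :
  coef2 (k, l) (fact2 (coprd x - \sum_(v | P v) tns (f v) (g v))) =
  coef (k ++ l) (fact x) - \sum_(v | P v) coef k (fact (f v)) * coef l (fact (g v)).
Proof.
rewrite addrC -scaleN1r fact2_lin coef2P coef2_fact2_coprd // mulN1r addrC.
suff -> : coef2 (k, l) (fact2 (\sum_(v | P v) tns (f v) (g v))) =
    \sum_(v | P v) coef k (fact (f v)) * coef l (fact (g v)) by [].
pose Q t c := coef2 (k, l) (fact2 t) = c.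
apply: (big_ind2 Q) => [|t c u d <- <-|v _]; rewrite /Q.
- by rewrite fact2_0 coef2_0.
- by have := coef2P (k, l) 1 (fact2 t) (fact2 u); rewrite fact2_D scale1r mul1r.
- by rewrite fact2_tns coef2_tns.
Qed.

Lemma fact2_coef0 (t : T2) : fact2 t = 0 <-> forall k l, coef2 (k, l) (fact2 t) = 0.
Proof.
split=> [-> k l|h]; first exact: coef2_0.
by apply: (basis_coef_inj (tm_basis2 tm)) => -[k l]; rewrite coef2_0.
Qed.

(** * The antipode and its uniqueness *)

(** The braided antipode negates letters and reverses products through the braiding, so moving [q]
    to the end lets its reflection act on the rest. *)
Fixpoint anti_word (k : seq pos) : T :=
  if k is q :: k' then - tact (rr (val q)) (anti_word k') * letter q else 1.

Definition anti : T -> T := ext anti_word.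

Lemma antiP c x y : anti (c *: x + y) = c *: anti x + anti y.
Proof. exact: extP. Qed.

Lemma anti0 : anti 0 = 0.
Proof. exact: linP0 antiP. Qed.

Lemma anti1 : anti 1 = 1.
Proof. by rewrite -{1}W0 /anti extW. Qed.

Lemma anti_letter q x : anti (letter q * x) = - tact (rr (val q)) (anti x) * letter q.
Proof.
elim/W_ind: x => [|k|c x y IHx IHy].
- by rewrite mulr0 anti0 tact0 oppr0 mul0r.
- by rewrite -W_cons /anti !extW.
- by rewrite tmulrP !antiP IHx IHy tactP opprD mulrDl -scalerN -scalerAl.
Qed.

Lemma anti_xroot a x : is_root a -> anti (X a * x) = - tact (rr a) (anti x) * X a.
Proof.
case/root_cases => p [] ->; first by rewrite xroot_val anti_letter.
rewrite xroot_valN root_reflectionN ?pos_is_root // !mulNr (linPN antiP) anti_letter.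
by rewrite mulrN mulNr.
Qed.

Lemma anti_tact u x : anti (tact u x) = tact u (anti x).
Proof.
elim/tensor_ind: x => [||p k IH|c x y IHx IHy].
- by rewrite !(tact0, anti0).
- by rewrite !(tact1, anti1).
- rewrite tactM tact_letter anti_xroot ?is_root_coxact ?pos_is_root // IH.
  rewrite root_reflection_coxact ?pos_is_root // -tact_comp mulgKV tact_comp.
  by rewrite anti_letter !mulNr tactN tactM tact_letter.
- by rewrite !(tactP, antiP) IHx IHy.
Qed.

Definition conv (f g : T -> T) : T2 -> T := lift2 (fun a b => f a * g b).

Lemma conv_tns (f g : T -> T) a b :
  (forall c x y, f (c *: x + y) = c *: f x + f y) ->
  (forall c x y, g (c *: x + y) = c *: g x + g y) ->
  conv f g (tns a b) = f a * g b.
Proof.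
move=> fP gP; rewrite /conv lift2_tns //; split=> [d c u v|d c u v].
  by rewrite fP tmullP.
by rewrite gP tmulrP.
Qed.

Lemma conv_lin f g c x y : conv f g (c *: x + y) = c *: conv f g x + conv f g y.
Proof. exact: lift2P. Qed.
Lemma conv_0 f g : conv f g 0 = 0.
Proof. exact: lift2_0. Qed.
Lemma conv_D f g x y : conv f g (x + y) = conv f g x + conv f g y.
Proof. exact: lift2D. Qed.

(** For a word with first letter p, the contributions of x_p (x) 1 and 1 (x) x_p cancel. *)
Lemma conv_anti_id x : conv anti id (coprd x) = coef [::] x *: 1.
Proof.
have mv p t : conv anti id (sq_mull p t) + conv anti id (sq_mulr p t) = 0.
  elim/tns_ind: t => [|k l|c u v IHu IHv].
  - by rewrite sq_mull_0 sq_mulr_0 conv_0 addr0.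
  - rewrite sq_mull_tns sq_mulr_tns !conv_tns //; try exact: antiP.
    by rewrite anti_letter anti_tact mulrA -mulrDl mulNr addNr mul0r.
  - rewrite sq_mull_lin sq_mulr_lin !conv_lin addrACA -scalerDr IHu IHv.
    by rewrite scaler0 addr0.
elim/tensor_ind: x => [||p k IH|c x y IHx IHy].
- by rewrite coprd0 conv_0 coef0 scale0r.
- by rewrite coprd1 conv_tns ?anti1 ?mulr1 //; [rewrite -{2}W0 coefW scale1r | exact: antiP].
- by rewrite coprd_letter conv_D mv coef_letter_nil scale0r.
- by rewrite coprdP conv_lin IHx IHy coefP scalerDl scalerA.
Qed.

Lemma conv_id_anti x : conv id anti (coprd x) = coef [::] x *: 1.
Proof.
have hl p t : conv id anti (sq_mull p t) = letter p * conv id anti t.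
  elim/tns_ind: t => [|k l|c u v IHu IHv].
  - by rewrite sq_mull_0 conv_0 mulr0.
  - by rewrite sq_mull_tns !conv_tns ?mulrA //; exact: antiP.
  - by rewrite sq_mull_lin !conv_lin IHu IHv tmulrP.
have hr p t : conv id anti (sq_mulr p t) = - tact (rr (val p)) (conv id anti t) * letter p.
  elim/tns_ind: t => [|k l|c u v IHu IHv].
  - by rewrite sq_mulr_0 !conv_0 tact0 oppr0 mul0r.
  - rewrite sq_mulr_tns !conv_tns //; try exact: antiP.
    by rewrite anti_letter tactM mulNr mulrN mulrA mulNr.
  - by rewrite sq_mulr_lin !conv_lin IHu IHv tactP opprD mulrDl -scalerN -scalerAl.
elim/tensor_ind: x => [||p k IH|c x y IHx IHy].
- by rewrite coprd0 conv_0 coef0 scale0r.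
- by rewrite coprd1 conv_tns ?anti1 ?mulr1 //; [rewrite -{2}W0 coefW scale1r | exact: antiP].
- rewrite coprd_letter conv_D hl hr IH coef_letter_nil scale0r.
  have tZ u c : tact u (c *: 1) = c *: 1.
    by have := tactP u c 1 0; rewrite !addr0 tact0 tact1 addr0.
  by rewrite tZ tscaleAr mulr1 mulNr -scalerAl mul1r addrN.
- by rewrite coprdP conv_lin IHx IHy coefP scalerDl scalerA.
Qed.

(* The right tensor factor of coprd (W k) has degree less than size k, except *)
(* in the term tns 1 (W k).                                                   *)
Lemma coprd_top (G : T -> T -> T) k : bilin G ->
  (forall a l, (size l < size k)%N -> G a (W l) = 0) ->
  lift2 G (coprd (W k)) = G 1 (W k).
Proof.
suff H : forall G : T -> T -> T, bilin G ->
    (forall a l, (size l < size k)%N -> G a (W l) = 0) ->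
    lift2 G (coprd (W k)) = G 1 (W k) by exact: H.
elim: k => [|p k IH] {}G hG Glow.
  by rewrite W0 coprd1 lift2_tns.
rewrite W_cons coprd_letter lift2D.
have hl t : lift2 G (sq_mull p t) = lift2 (fun a b => G (letter p * a) b) t.
  have hG' : bilin (fun a b => G (letter p * a) b).
    split=> [d c u v|d c u v]; first by rewrite tmulrP (bilinl hG).
    by rewrite (bilinr hG).
  elim/tns_ind: t => [|k' l'|c u v IHu IHv].
  - by rewrite sq_mull_0 !lift2_0.
  - by rewrite sq_mull_tns !lift2_tns.
  - by rewrite sq_mull_lin !lift2P IHu IHv.
have hG' : bilin (fun a b => G (tact (rr (val p)) a) (letter p * b)).
  split=> [d c u v|d c u v]; first by rewrite tactP (bilinl hG).
  by rewrite tmulrP (bilinr hG).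
have hr t : lift2 G (sq_mulr p t) =
    lift2 (fun a b => G (tact (rr (val p)) a) (letter p * b)) t.
  elim/tns_ind: t => [|k' l'|c u v IHu IHv].
  - by rewrite sq_mulr_0 !lift2_0.
  - by rewrite sq_mulr_tns !lift2_tns.
  - by rewrite sq_mulr_lin !lift2P IHu IHv.
rewrite hl hr [X in X + _]IH; first last.
- by move=> a l lk; apply: Glow; rewrite /= ltnW.
- split=> [d c u v|d c u v]; first by rewrite tmulrP (bilinl hG).
  by rewrite (bilinr hG).
rewrite Glow ?ltnSn // add0r IH //; first by rewrite tact1.
by move=> a l lk; rewrite -W_cons Glow.
Qed.

(** The convolution of the identity with the difference g of [f] and [anti] is zero. By [coprd_top]
    its value at a word is g of that word plus terms in g of shorter words, so g vanishes by
    induction. *)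
Lemma conv_id_inj (f : T -> T) :
  (forall c x y, f (c *: x + y) = c *: f x + f y) ->
  (forall x, conv id f (coprd x) = coef [::] x *: 1) -> forall x, f x = anti x.
Proof.
move=> fP hf; pose g x := f x - anti x.
have gP c x y : g (c *: x + y) = c *: g x + g y.
  by rewrite /g fP antiP opprD addrACA scalerBr.
have hG : bilin (fun a b => a * g b).
  by split=> [b c x y|a c x y]; rewrite ?tmullP // gP tmulrP.
have cg x : lift2 (fun a b => a * g b) (coprd x) = 0.
  have -> : lift2 (fun a b => a * g b) (coprd x) =
      conv id f (coprd x) - conv id anti (coprd x).
    elim/tns_ind: (coprd x) => [|k' l'|c u v IHu IHv].
    - by rewrite lift2_0 !conv_0 subr0.
    - by rewrite lift2_tns // !conv_tns ?mulrBr //; exact: antiP.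
    - by rewrite lift2P !conv_lin IHu IHv scalerBr opprD addrACA.
  by rewrite hf conv_id_anti subrr.
have gW k : g (W k) = 0.
  have [N] := ubnP (size k); elim: N k => // N IH k; rewrite ltnS => kN.
  rewrite -[LHS]mul1r -(coprd_top hG) ?cg // => a l lk.
  by rewrite IH ?mulr0 // (leq_trans lk).
move=> x; apply/eqP; rewrite -subr_eq0 -/(g x); apply/eqP.
elim/W_ind: x => [|k|c x y IHx IHy]; [exact: linP0 gP | exact: gW |].
by rewrite gP IHx IHy scaler0 addr0.
Qed.

(** * The twisted antipode *)

Definition trev : T -> T := ext (fun k => W (rev k)).

Lemma trevP c x y : trev (c *: x + y) = c *: trev x + trev y.
Proof. exact: extP. Qed.

Lemma trev_W k : trev (W k) = W (rev k).
Proof. exact: extW. Qed.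

Lemma trev_letter p : trev (letter p) = letter p.
Proof. exact: trev_W. Qed.

Lemma trev0 : trev 0 = 0.
Proof. exact: linP0 trevP. Qed.

Lemma trevM a b : trev (a * b) = trev b * trev a.
Proof.
elim/W_ind: a => [|k|c x y IHx IHy].
- by rewrite mul0r trev0 mulr0.
- elim/W_ind: b => [|l|c x y IHx IHy].
  + by rewrite mulr0 trev0 mul0r.
  + by rewrite -W_cat !trev_W rev_cat W_cat.
  + by rewrite tmulrP !trevP IHx IHy tmullP.
- by rewrite tmullP !trevP IHx IHy tmulrP.
Qed.

Lemma trev_xroot a : is_root a -> trev (X a) = X a.
Proof.
case/root_cases => p [] ->; first by rewrite xroot_val trev_W.
by rewrite xroot_valN (linPN trevP) trev_W.
Qed.

Lemma trev_tact u x : trev (tact u x) = tact u (trev x).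
Proof.
elim/tensor_ind: x => [||p k IH|c x y IHx IHy].
- by rewrite !(tact0, trev0).
- by rewrite tact1 -W0 trev_W W0 tact1.
- rewrite tactM tact_letter !trevM IH trev_xroot ?is_root_coxact ?pos_is_root //.
  by rewrite tactM trev_letter tact_letter.
- by rewrite !(tactP, trevP) IHx IHy.
Qed.

(** Recursive form of the explicit formula: each letter lets its reflection act on the whole result
    of the tail. *)
Fixpoint sbar_word (k : seq pos) : T :=
  if k is q :: k' then letter q * tact (rr (val q)) (sbar_word k') else 1.

Definition sbar : T -> T := ext sbar_word.

Lemma sbarP c x y : sbar (c *: x + y) = c *: sbar x + sbar y.
Proof. exact: extP. Qed.

Lemma sbar0 : sbar 0 = 0.
Proof. exact: linP0 sbarP. Qed.

Lemma sbar1 : sbar 1 = 1.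
Proof. by rewrite -{1}W0 /sbar extW. Qed.

Lemma sbar_letter q x : sbar (letter q * x) = letter q * tact (rr (val q)) (sbar x).
Proof.
elim/W_ind: x => [|k|c x y IHx IHy].
- by rewrite mulr0 sbar0 tact0 mulr0.
- by rewrite -W_cons /sbar !extW.
- by rewrite tmulrP !sbarP IHx IHy tactP tmulrP.
Qed.

Lemma sbar_xroot a x : is_root a -> sbar (X a * x) = X a * tact (rr a) (sbar x).
Proof.
case/root_cases => p [] ->; first by rewrite xroot_val sbar_letter.
rewrite xroot_valN root_reflectionN ?pos_is_root // !mulNr (linPN sbarP) sbar_letter.
by [].
Qed.

Lemma sbar_tact u x : sbar (tact u x) = tact u (sbar x).
Proof.
elim/tensor_ind: x => [||p k IH|c x y IHx IHy].
- by rewrite !(tact0, sbar0).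
- by rewrite !(tact1, sbar1).
- rewrite tactM tact_letter sbar_xroot ?is_root_coxact ?pos_is_root // IH.
  rewrite root_reflection_coxact ?pos_is_root // -tact_comp mulgKV tact_comp.
  by rewrite sbar_letter tactM tact_letter.
- by rewrite !(tactP, sbarP) IHx IHy.
Qed.

Lemma sbar_anti k : (-1) ^+ size k *: trev (anti (W k)) = sbar (W k).
Proof.
elim: k => [|p k IH]; first by rewrite W0 anti1 sbar1 -W0 trev_W expr0 scale1r.
rewrite W_cons anti_letter sbar_letter -IH mulNr (linPN trevP) trevM trev_tact trev_letter.
have tZ u c x : tact u (c *: x) = c *: tact u x.
  by have := tactP u c x 0; rewrite tact0 !addr0.
by rewrite tZ tscaleAr exprS mulN1r scaleNr scalerN opprK.
Qed.

(** [lder] twists the root by the letters it passes, [rder] twists the letters after it; the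
    reflections inserted by [sbar] exchange the two conventions. *)
Lemma lder_sbar a x : lder a (sbar x) = sbar (rder a x).
Proof.
elim/tensor_ind: x a => [||p k IH|c x y IHx IHy] a.
- by rewrite !(sbar0, lder0, rder0).
- by rewrite !(sbar1, lder1, rder1, sbar0).
- rewrite sbar_letter lder_letter lder_tact IH rder_letter sbarP sbar_tact.
  by rewrite sbar_letter.
- by rewrite !(sbarP, lderP, rderP) IHx IHy.
Qed.

Lemma coef_tact_nil u x : coef [::] (tact u x) = coef [::] x.
Proof.
elim/tensor_ind: x => [||q l IH|c y z IHy IHz].
- by rewrite tact0.
- by rewrite tact1.
- rewrite tactM tact_letter coef_letter_nil coef_xroot_nil //.
  by rewrite is_root_coxact // pos_is_root.
- by rewrite tactP !coefP IHy IHz.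
Qed.

Lemma coef_sbar_nil x : coef [::] (sbar x) = coef [::] x.
Proof.
elim/tensor_ind: x => [||q l IH|c y z IHy IHz].
- by rewrite sbar0.
- by rewrite sbar1.
- by rewrite sbar_letter !coef_letter_nil.
- by rewrite sbarP !coefP IHy IHz.
Qed.

(** In particular [fact (sbar x)] depends on [fact x] alone, so [sbar] descends to the Nichols
    algebra. *)
Lemma coef_fact_sbar k x : coef k (fact (sbar x)) = coef (rev k) (fact x).
Proof.
elim: k x => [|p k IH] x; first by rewrite /= !coef_fact_nil coef_sbar_nil.
by rewrite coef_fact_cons lder_sbar IH rev_cons coef_fact_rcons.
Qed.

(** * The pairing and its symmetry *)

(** Evaluation matches a word with its reversal; the pairing of the Nichols algebra is
    [pair y (fact z)]. *)
Definition pair (y z : T) : F := ext (fun k => coef (rev k) z : F^o) y.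

Lemma pairPl c x y z : pair (c *: x + y) z = c * pair x z + pair y z.
Proof. exact: (extP (fun k => coef (rev k) z : F^o)). Qed.

Lemma pair_W k z : pair (W k) z = coef (rev k) z.
Proof. exact: (extW (fun k => coef (rev k) z : F^o)). Qed.

Lemma pair0l z : pair 0 z = 0.
Proof. by have := pairPl (-1) 0 0 z; rewrite scaler0 addr0 mulN1r addNr. Qed.

Lemma pairPr c x y z : pair z (c *: x + y) = c * pair z x + pair z y.
Proof.
elim/W_ind: z => [|k|d u v IHu IHv]; first by rewrite !pair0l mulr0 addr0.
  by rewrite !pair_W coefP.
by rewrite !pairPl IHu IHv !mulrDr mulrCA addrACA.
Qed.

Lemma pair0r z : pair z 0 = 0.
Proof. by have := pairPr (-1) 0 0 z; rewrite scaler0 addr0 mulN1r addNr. Qed.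

Lemma pair_letter p y z :
  pair (letter p * y) (fact z) = pair y (fact (rder (val p) z)).
Proof.
elim/W_ind: y => [|k|c x y IHx IHy]; first by rewrite mulr0 !pair0l.
  by rewrite -W_cons !pair_W rev_cons coef_fact_rcons.
by rewrite tmulrP !pairPl IHx IHy.
Qed.

Lemma pair_xroot a y z : is_root a ->
  pair (X a * y) (fact z) = pair y (fact (rder a z)).
Proof.
have pairNl u v : pair (- u) v = - pair u v.
  by have := pairPl (-1) u 0 v; rewrite pair0l !addr0 scaleN1r mulN1r.
have rder_opp b x : rder (- b) x = - rder b x.
  elim/tensor_ind: x => [||q k IH|c x1 x2 IH1 IH2].
  - by rewrite !rder0 oppr0.
  - by rewrite !rder1 oppr0.
  - by rewrite !rder_letter IH rdeltaNl mulrN scaleNr opprD.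
  - by rewrite !rderP IH1 IH2 opprD scalerN.
have pairNr u v : pair u (- v) = - pair u v.
  by have := pairPr (-1) v 0 u; rewrite pair0r !addr0 scaleN1r mulN1r.
case/root_cases => p [] ->; first by rewrite xroot_val pair_letter.
by rewrite xroot_valN mulNr pairNl pair_letter rder_opp (linPN factP) pairNr.
Qed.

Lemma pair1 z : pair 1 z = coef [::] z.
Proof. by rewrite -W0 pair_W. Qed.

Lemma pair_tact u y z : pair (tact u y) (fact (tact u z)) = pair y (fact z).
Proof.
elim/tensor_ind: y z => [||p k IH|c x y IHx IHy] z.
- by rewrite tact0 !pair0l.
- by rewrite tact1 !pair1 !coef_fact_nil coef_tact_nil.
- rewrite tactM tact_letter pair_xroot ?is_root_coxact ?pos_is_root //.
  by rewrite rder_tact IH pair_letter.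
- by rewrite tactP !pairPl IHx IHy.
Qed.

(** The reflection that [rder] leaves on the rest of the word is moved to the other argument by the
    invariance [pair_tact]. *)
Lemma pair_letter_r q y z :
  pair y (fact (letter q * z)) = pair (rder (val q) y) (fact z).
Proof.
elim/tensor_ind: y z => [||p k IH|c x y IHx IHy] z.
- by rewrite rder0 !pair0l.
- by rewrite rder1 pair1 coef_fact_nil coef_letter_nil pair0l.
- rewrite pair_letter !rder_letter factP pairPr IH pairPl pair_letter.
  congr (_ + _); rewrite !rdelta_pos (eq_sym q p).
  have [->|_] := eqVneq p q; last by rewrite !mul0r.
  rewrite !mul1r -(pair_tact (rr (val q)) (W k)) -tact_comp.
  by rewrite root_reflectionK ?pos_is_root // tact_id.
- by rewrite rderP !pairPl IHx IHy.
Qed.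

(** Multiplication by a letter is adjoint to [rder] in both arguments. *)
Lemma pair_sym y z : pair y (fact z) = pair z (fact y).
Proof.
elim/tensor_ind: z y => [||q k IH|c u v IHu IHv] y.
- by rewrite fact0 pair0l pair0r.
- rewrite fact1 pair1 coef_fact_nil.
  elim/W_ind: y => [|k|c u v IHu IHv]; first by rewrite pair0l coef0.
    by rewrite pair_W -W0 !coefW; case: k => [|p k] //; rewrite rev_cons; case: (rev k).
  by rewrite pairPl coefP IHu IHv.
- by rewrite pair_letter_r IH pair_letter.
- by rewrite factP pairPr IHu IHv pairPl.
Qed.

End TensorAlgebra.

(** * Chains in the Bruhat order *)

Section Chains.
Variables (R : realType) (gT : finGroupType) (S : {set gT}).
Import Order.TTheory GRing.Theory Num.Theory.
Local Open Scope ring_scope.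

Local Notation n := #|S|.
Local Notation s := (@sgen gT S).
Local Notation root := 'rV[R]_n.
Local Notation sr := (@simple_root R gT S).
Local Notation pos := (pos_root R S).
Local Notation act := (@coxact R gT S).
Local Notation rr := (@root_reflection R gT S).
Local Notation is_root := (@is_root R gT S).
Local Notation ell := (ell S).

Hypothesis hWS : coxeter_system S.

Lemma simple_root_pos i : sr i \in positive_roots R S.
Proof. by rewrite mem_pos pos_row_simple is_root_simple. Qed.

Definition simple_pos (i : 'I_n) : pos := SeqSub (simple_root_pos i).
Local Notation sp := simple_pos.

Lemma rr_simple_pos i : rr (val (sp i)) = s i.
Proof. exact: root_reflection_simple. Qed.

Lemma rr_rr_mul (p : pos) (w : gT) : (rr (val p) * (rr (val p) * w))%g = w.
Proof. by rewrite mulgA root_reflectionK ?pos_is_root // mul1g. Qed.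

Local Notation roots_of r := [seq sr i | i <- r].

(** The exchange condition made explicit: the reflection in the pulled root is the j-th letter
    conjugated by the product of the letters before it. *)
Lemma rr_pull j (r : seq 'I_n) : (j < size r)%N ->
  (rr (pull j (roots_of r)) * wprod s r)%g = wprod s (omit j r).
Proof.
elim: j r => [|j IH] [|i r] //= jr.
  rewrite root_reflection_simple // omit0 wprod_cons mulgA sgenK ?mul1g //.
  by case: hWS.
have rp : is_root (pull j (roots_of r)).
  apply: is_root_pull => //; rewrite ?size_map //.
  by rewrite all_map; apply/allP => i' _; apply: is_root_simple.
rewrite root_reflection_coxact // ?is_root_coxact //.
by rewrite root_reflection_simple // omitS !wprod_cons -IH // -!mulgA mulKg.
Qed.

(** By [pos_row_diff] each letter contributes the change of positivity it causes, and the changes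
    telescope. *)
Lemma sum_rdelta_pull (F : fieldType) a (r : seq 'I_n) : is_root a ->
  \sum_(j <- iota 0 (size r)) rdelta F a (pull j (roots_of r)) =
  (pos_row a)%:R - (pos_row (act (wprod s r)^-1%g a))%:R.
Proof.
elim: r a => [|i r IH] a ra.
  by rewrite big_nil wprod_nil invg1 coxact1 // subrr.
rewrite /= big_cons -[1%N]/(1 + 0)%N iotaDl big_map /=.
have -> : \sum_(j <- iota 0 (size r)) rdelta F a (act (rr (sr i)) (pull j (roots_of r)))
  = \sum_(j <- iota 0 (size r)) rdelta F (act (s i) a) (pull j (roots_of r)).
  apply: eq_bigr => j _; rewrite root_reflection_simple //.
  rewrite -(rdelta_coxact hWS _ (s i) a) -coxactM // sgenK ?coxact1 //.
  by case: hWS.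
rewrite IH ?is_root_coxact // /rdelta (pos_row_diff hWS _ i ra) coxact_sgen //.
rewrite addrA subrK wprod_cons invMg -coxact_sgen // -coxactM // sgenV //.
by case: hWS.
Qed.

(** If w^-1 makes p negative, the sum in [sum_rdelta_pull] is 1, so some pulled root is p or -p and
    deleting its letter shortens w. The other direction applies this to s_p w. *)
Lemma pos_row_descent (p : pos) (w : gT) :
  (ell (rr (val p) * w)%g < ell w)%N = ~~ pos_row (act w^-1%g (val p)).
Proof.
have rp := pos_is_root p.
have neg u : ~~ pos_row (act u^-1%g (val p)) -> (ell (rr (val p) * u)%g < ell u)%N.
  have [r sr ru] := ell_word hWS u => npu.
  have := @sum_rdelta_pull R (val p) r rp; rewrite ru (negPf npu) pos_pos_row subr0.
  have [/hasP[j]|/hasPn no] := boolP (has (fun j => rdelta R (val p) (pull j (roots_of r)) != 0)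
      (iota 0 (size r))).
    rewrite mem_iota add0n /= => jr d0 _.
    have e : rr (val p) = rr (pull j (roots_of r)).
      move: d0; rewrite /rdelta; have [->//|_] := eqVneq (val p) _.
      have [->|_] := eqVneq (val p) _; last by rewrite subrr eqxx.
      rewrite root_reflectionN //; apply: is_root_pull => //; rewrite ?size_map //.
      by rewrite all_map; apply/allP => i' _; apply: is_root_simple.
    rewrite e -{1}ru rr_pull // -sr.
    apply: (leq_ltn_trans (ell_le (omit j r))).
    by rewrite size_omit // ltn_predL (leq_ltn_trans _ jr).
  rewrite big_seq big1 => [/eqP|j /no /negPn/eqP //].
  by rewrite eq_sym oner_eq0.
have [pu|/neg //] := boolP (pos_row _); apply/negbTE; rewrite -leqNgt; apply: ltnW.
have := neg (rr (val p) * w)%g; rewrite rr_rr_mul invMg coxactM // root_reflectionV //.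
rewrite coxact_root_reflectionE // coxactN // pos_rowN ?is_root_coxact // pu.
by move=> ->.
Qed.

(* k spells a chain in which each letter p lowers the length by one through  *)
(* u |-> s_p u, leading from w down to v.                                    *)
Fixpoint chain (w : gT) (k : seq pos) (v : gT) : bool :=
  if k is p :: k' then
    ((ell (rr (val p) * w)%g).+1 == ell w) && chain (rr (val p) * w)%g k' v
  else w == v.

(** Every step multiplies by a known reflection. A chain word to 1 therefore determines its source,
    which separates the terms of a coproduct. *)
Lemma chain_source w w' k v : chain w k v -> chain w' k v -> w = w'.
Proof.
elim: k w w' => [|p k IH] w w' /=; first by move=> /eqP -> /eqP ->.
move=> /andP[_ h] /andP[_ h']; apply: (mulgI (rr (val p))); exact: IH h h'.
Qed.

Lemma chain_to1 w : exists k, chain w k 1%g.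
Proof.
have [N] := ubnP (ell w); elim: N w => // N IH w; rewrite ltnS => wN.
have [->|w1] := eqVneq w 1%g; first by exists [::]; rewrite /= eqxx.
have [i wi] : exists i, (ell (s i * w)%g < ell w)%N.
  have [|i h] := ell_desc hWS (w := w^-1%g); first by rewrite invg_eq1.
  exists i; rewrite -(ellV hWS w) -(ellV hWS (s i * w)%g) invMg sgenV //.
  by case: hWS.
have st : (ell (s i * w)%g).+1 = ell w.
  have := ell_step hWS w^-1%g i.
  rewrite -(ellV hWS (w^-1 * s i)%g) invMg invgK (ellV hWS) sgenV; last by case: hWS.
  move: wi; ell_lia.
have [k hk] := IH (s i * w)%g (leq_trans wi wN).
by exists (sp i :: k); rewrite /= root_reflection_simple // st eqxx.
Qed.

Lemma chain_catE (F : fieldType) w k l z :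
  (chain w (k ++ l) z)%:R = \sum_v (chain w k v)%:R * (chain v l z)%:R :> F.
Proof.
elim: k w => [|p k IH] w /=.
  rewrite (bigD1 w) //= eqxx mul1r big1 ?addr0 // => v.
  by rewrite eq_sym => /negPf ->; rewrite mul0r.
case: eqP => _ /=; first exact: IH.
by rewrite big1 // => v _; rewrite mul0r.
Qed.

Variables (F : fieldType) (tm : tensor_model F pos).
Local Notation T := (tm_alg tm).
Local Notation W := (tm_word tm).
Local Notation coef := (tm_coef (t := tm)).
Local Notation coef2 := (tm_coef2 (t := tm)).
Local Notation fact := (@fact R gT S F tm).
Local Notation fact2 := (@fact2 R gT S F tm).
Local Notation coprd := (@coprd R gT S F tm).
Local Notation tact := (@tact R gT S F tm).
Local Notation xroots := (@xroots R gT S F tm).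
Local Notation sbar := (@sbar R gT S F tm).

Definition simple_word (r : seq 'I_n) : T := W [seq sp i | i <- r].

(** Induction on k. The derivative along p multiplies one common coefficient by the total sign, and
    [pos_row_descent] says when this sign is 1. *)
Lemma coef_fact_simple_word k r :
  coef k (fact (simple_word r)) = ((size r == ell (wprod s r)) && chain (wprod s r) k 1%g)%:R.
Proof.
have vals q : [seq val p | p <- [seq sp i | i <- q]] = roots_of q by rewrite -map_comp.
elim: k r => [|p k IH] r.
  rewrite coef_fact_nil // (basis_coefW (tm_basis tm)); congr (nat_of_bool _)%:R.
  apply/idP/idP => [|/andP[/eqP sr /eqP w1]].
    by case: r => // _; rewrite /= wprod_nil ell1 // !eqxx.
  by move: sr; rewrite w1 ell1 //; case: r {w1}.
rewrite coef_fact_cons // lder_W_sum // fact_sum coef_sum size_map vals.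
set w := wprod s r.
(* Deleting any letter whose pulled root is p or -p leaves a word of s_p w with one letter less, so
   all these terms share the coefficient c. *)
pose c := (((size r).-1 == ell (rr (val p) * w)%g) && chain (rr (val p) * w)%g k 1%g)%:R : F.
have -> : \sum_(j <- iota 0 (size r)) coef k
   (fact (rdelta F (val p) (pull j (roots_of r)) *: W (omit j [seq sp i | i <- r]))) =
   (\sum_(j <- iota 0 (size r)) rdelta F (val p) (pull j (roots_of r))) * c.
  rewrite big_distrl /=; apply: eq_big_seq => j; rewrite mem_iota add0n /= => jr.
  rewrite factZ coefZ -map_omit IH.
  have so : size (omit j r) = (size r).-1.
    by rewrite size_omit.
  have rp : is_root (pull j (roots_of r)).
    apply: is_root_pull => //; rewrite ?size_map //.
    by rewrite all_map; apply/allP => i' _; apply: is_root_simple.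
  rewrite /c; have [e|ne] := eqVneq (val p) (pull j (roots_of r)).
    by rewrite so -rr_pull // e.
  have [e|ne'] := eqVneq (val p) (- pull j (roots_of r)).
    by rewrite so -rr_pull // e root_reflectionN.
  by rewrite /rdelta (negPf ne) (negPf ne') subrr !mul0r.
rewrite sum_rdelta_pull ?pos_is_root // pos_pos_row /c -/w.
have -> : pos_row (act w^-1%g (val p)) = ~~ (ell (rr (val p) * w)%g < ell w)%N.
  by rewrite pos_row_descent negbK.
have le := ell_le r; rewrite -/w in le; move: le; rewrite [chain w _ _]/=.
set a := ell (_ * w)%g; set e := ell w; move: (chain _ _ _) (size r) a e => ch N {}a {}e le.
have -> : (N == e) && ((a.+1 == e) && ch) = (a < e)%N && ((N.-1 == a) && ch).
  by rewrite !andbA; congr (_ && _); apply/idP/idP; lia.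
by case: (a < e)%N; rewrite ?subr0 ?mul1r ?subrr ?mul0r.
Qed.

Fixpoint bool_seqs (l : nat) : seq (seq bool) :=
  if l is l'.+1 then [seq b :: ms | b <- [:: true; false], ms <- bool_seqs l']
  else [:: [::]].

(** Left factor of the coproduct term in which the marked letters go left; an unmarked letter goes
    right and its reflection acts on the left letters after it. *)
Fixpoint lfactor (ms : seq bool) (r : seq 'I_n) : T :=
  match ms, r with
  | b :: ms', i :: r' =>
      if b then W [:: sp i] * lfactor ms' r' else tact (s i) (lfactor ms' r')
  | _, _ => 1
  end.

Definition co_mask (ms : seq bool) (r : seq 'I_n) := mask (map negb ms) r.

Lemma coprd_simple_word r : coprd (simple_word r) =
  \sum_(ms <- bool_seqs (size r)) tns (lfactor ms r) (simple_word (co_mask ms r)).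
Proof.
elim: r => [|i r IH]; first by rewrite /simple_word /= big_seq1 tm_word_nil coprd1.
rewrite /simple_word /= W_cons coprd_letter -/(simple_word r) IH.
rewrite !big_cat big_nil /= addr0 !big_map /=; congr (_ + _).
  elim: (bool_seqs _) => [|ms q IHq]; first by rewrite !big_nil sq_mull_0.
  by rewrite !big_cons sq_mull_D IHq sq_mull_tns.
elim: (bool_seqs _) => [|ms q IHq]; first by rewrite !big_nil sq_mulr_0.
rewrite !big_cons sq_mulr_D IHq sq_mulr_tns rr_simple_pos; congr (tns _ _ + _).
by rewrite /simple_word /= [RHS]W_cons.
Qed.

(** Represents x_{w/v} for a reduced word r of w: right factors that are not reduced are killed by
    F, and the reduced words of v all have the class x_v. *)
Definition quotient_elt (v : gT) (r : seq 'I_n) : T :=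
  \sum_(ms <- bool_seqs (size r) |
       (wprod s (co_mask ms r) == v) && (size (co_mask ms r) == ell v)) lfactor ms r.

Lemma coef2_fact2_simple_word k l r : size r = ell (wprod s r) ->
  coef2 (k, l) (fact2 (coprd (simple_word r))) =
  \sum_v (chain (wprod s r) k v)%:R * (chain v l 1%g)%:R.
Proof.
by move=> lr; rewrite coef2_fact2_coprd // coef_fact_simple_word lr eqxx chain_catE.
Qed.

Lemma sum_chain_to1 (P : pred gT) (f : gT -> F) v l : P v -> chain v l 1%g ->
  \sum_(u | P u) f u * (chain u l 1%g)%:R = f v.
Proof.
move=> Pv vl; rewrite (bigD1 v) //= vl mulr1 big1 ?addr0 // => u /andP[_ uv].
by case: (boolP (chain u l 1%g)) => [ul|_]; [rewrite (chain_source ul vl) eqxx in uv | rewrite mulr0].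
Qed.

(** Let l spell a chain from v to 1. At l, the image under F of a right factor has coefficient 1 if
    it is a reduced word of v and 0 otherwise, so the coefficient at (k, l) isolates v. *)
Lemma coef_fact_quotient_elt k v r : size r = ell (wprod s r) ->
  coef k (fact (quotient_elt v r)) = (chain (wprod s r) k v)%:R.
Proof.
move=> lr; have [l vl] := chain_to1 v.
have := coef2_fact2_simple_word k l lr.
rewrite (@sum_chain_to1 predT _ v) // => <-.
rewrite coprd_simple_word /quotient_elt -big_filter fact_sum coef_sum big_filter.
elim: (bool_seqs _) => [|ms q IHq].
  by rewrite !big_nil fact2_0 coef2_0.
rewrite !big_cons fact2_D fact2_tns.
have coef2D x y : coef2 (k, l) (x + y) = coef2 (k, l) x + coef2 (k, l) y.
  by rewrite -[x]scale1r (basis_coefP (tm_basis2 tm)) mul1r scale1r.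
rewrite coef2D -IHq coef2_tns coef_fact_simple_word.
set u := wprod s _; have [->|uv] := eqVneq u v.
  by case: eqP => _; rewrite /= ?vl ?mulr1 // mulr0 add0r.
case: (boolP (chain u l 1%g)) => [ul|_]; last by rewrite andbF mulr0 add0r.
by rewrite (chain_source ul vl) eqxx in uv.
Qed.

Fixpoint inv_roots (r : seq 'I_n) : seq root :=
  if r is i :: r' then sr i :: [seq act (s i) a | a <- inv_roots r'] else [::].

Lemma size_inv_roots r : size (inv_roots r) = size r.
Proof. by elim: r => //= i r IH; rewrite size_map IH. Qed.

Lemma all_is_root_inv r : all is_root (inv_roots r).
Proof.
elim: r => //= i r IH; rewrite is_root_simple // all_map.
by apply: sub_all IH => a; rewrite /= is_root_coxact.
Qed.

Lemma tact_xroots u l : all is_root l ->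
  tact u (xroots l) = xroots [seq act u a | a <- l].
Proof.
rewrite /xroots; elim: l => [|a l IH] /=; first by rewrite !big_nil tact1.
by case/andP => ra /IH e; rewrite !big_cons tactM // e tact_xroot.
Qed.

(** [lfactor] carries the reflections of the omitted letters and [sbar] supplies those of the chosen
    ones, so each chosen letter is moved by its whole prefix and becomes alpha_j. *)
Lemma sbar_lfactor ms r : size ms = size r ->
  sbar (lfactor ms r) = xroots (mask ms (inv_roots r)).
Proof.
have rm q t : all is_root (mask q (inv_roots t)).
  by apply/allP => a /mem_mask; apply: (allP (all_is_root_inv t)).
elim: ms r => [|b ms IH] [|i r] //=; first by rewrite sbar1 /xroots big_nil.
case=> sz; have e : tact (s i) (sbar (lfactor ms r)) =
    xroots (mask ms [seq act (s i) a | a <- inv_roots r]).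
  by rewrite IH // tact_xroots // map_mask.
case: b => /=; last by rewrite sbar_tact.
by rewrite sbar_letter // rr_simple_pos e /xroots big_cons -(xroot_val tm).
Qed.

End Chains.

(** * Chains and covers *)

Section ChainsAndCovers.
Variables (R : realType) (gT : finGroupType) (S : {set gT}).
Import Order.TTheory GRing.Theory Num.Theory.
Local Open Scope ring_scope.

Local Notation pos := (pos_root R S).
Local Notation act := (@coxact R gT S).
Local Notation rr := (@root_reflection R gT S).
Local Notation is_root := (@is_root R gT S).
Local Notation ell := (ell S).
Local Notation chain := (@chain R gT S).

Hypothesis hWS : coxeter_system S.

Lemma bruhat_step_ell v w : bruhat_step S v w -> (ell v < ell w)%N.
Proof. by case/andP. Qed.

Lemma bruhat_ell v w : bruhat S v w -> v != w -> (ell v < ell w)%N.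
Proof.
case/connectP => p pp ->; elim: p v pp => [|u p IH] v /=; first by rewrite eqxx.
case/andP => /bruhat_step_ell vu /IH h _; have [<- //|/h] := eqVneq u (last u p).
exact: ltn_trans.
Qed.

Lemma bruhat_ell_le v w : bruhat S v w -> (ell v <= ell w)%N.
Proof. by move=> vw; have [->|/(bruhat_ell vw)/ltnW] := eqVneq v w. Qed.

Lemma bruhat_step_rr (p : pos) (v : gT) : (ell v < ell (rr (val p) * v)%g)%N ->
  bruhat_step S v (rr (val p) * v)%g.
Proof.
move=> lt; apply/andP; split=> //; apply/existsP; exists (rr (val p) ^ v)%g.
rewrite conjgE mulKVg eqxx andbT.
have -> : (v^-1 * (rr (val p) * v))%g = rr (act v^-1%g (val p)).
  by rewrite root_reflection_coxact ?pos_is_root // invgK mulgA.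
by rewrite root_reflection_in // is_root_coxact // pos_is_root.
Qed.

Lemma bruhat_cover_rr (p : pos) (v : gT) :
  ell (rr (val p) * v)%g = (ell v).+1 -> bruhat_cover S v (rr (val p) * v)%g.
Proof.
move=> e; have st : bruhat_step S v (rr (val p) * v)%g by rewrite bruhat_step_rr ?e.
apply/and3P; split.
- by apply: contra_eq_neq e => <-; rewrite neq_ltn ltnSn.
- exact: connect1.
apply/forallP => u; apply/implyP => /andP[vu uw].
have [//|uv] := eqVneq u v; rewrite orFb; apply: contraT => uw'.
have := bruhat_ell vu; rewrite eq_sym => /(_ uv) h1.
by have := bruhat_ell uw uw'; rewrite e ltnS leqNgt h1.
Qed.

Lemma chain_bruhat w k v : chain w k v -> bruhat S v w.
Proof.
elim: k w => [|p k IH] w /=; first by move=> /eqP ->; apply: connect0.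
case/andP => /eqP e /IH h; apply: connect_trans h (connect1 _).
have := @bruhat_step_rr p (rr (val p) * w)%g; rewrite rr_rr_mul //; apply.
by rewrite -e.
Qed.

Fixpoint upchain (v : gT) (k : seq pos) (w : gT) : bool :=
  if k is p :: k' then
    (ell (rr (val p) * v)%g == (ell v).+1) && upchain (rr (val p) * v)%g k' w
  else v == w.

Lemma chain_rcons w k p v : chain w (rcons k p) v =
  chain w k (rr (val p) * v)%g && (ell (rr (val p) * v)%g == (ell v).+1).
Proof.
elim: k w => [|q k IH] w /=; last by rewrite IH andbA.
apply/andP/andP => [[/eqP e /eqP <-]|[/eqP -> /eqP ->]].
  by rewrite rr_rr_mul // -e !eqxx.
by rewrite rr_rr_mul // !eqxx.
Qed.

Lemma chain_rev w k v : chain w (rev k) v = upchain v k w.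
Proof.
elim: k v => [|p k IH] v /=; first by rewrite eq_sym.
by rewrite rev_cons chain_rcons IH andbC.
Qed.

Local Notation up_scan v k := (scanl (fun u (p : pos) => rr (val p) * u)%g v k).

Lemma cover_path_ell v c : path (bruhat_cover S) v c -> (ell v + size c <= ell (last v c))%N.
Proof.
elim: c v => [|u c IH] v /=; first by rewrite addn0.
case/andP => /and3P[vu bvu _] /IH; have := bruhat_ell bvu vu.
move: (ell _) (ell _) (ell _); lia.
Qed.

(** Every cover raises the length by at least one, and the number of steps equals the total
    difference, so each raises it by exactly one; conversely [bruhat_cover_rr] makes such steps
    covers. *)
Lemma saturated_upchain v w k : ell w = (ell v + size k)%N ->
  saturated_chain S v w (up_scan v k) = upchain v k w.
Proof.
elim: k v => [|p k IH] v; first by [].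
rewrite /saturated_chain /=; set u := (rr _ * v)%g => e.
apply/andP/andP => [[/andP[cu pu] lw]|[/eqP lu h]].
  have := cover_path_ell pu; rewrite (eqP lw) size_scanl.
  case/and3P: (cu) => vu bvu _; have := bruhat_ell bvu vu.
  move=> h1 h2; have lu : ell u = (ell v).+1 by move: h1 h2 e => /=; lia.
  split; first exact/eqP.
  by rewrite -IH ?lu ?addSnnS // /saturated_chain pu.
move: h; rewrite -IH ?lu ?addSnnS // /saturated_chain => /andP[-> ->].
by rewrite bruhat_cover_rr.
Qed.

(** If w = v t then w^-1 = v^-1 (v t v^-1), and a conjugate of a reflection is a reflection. *)
Lemma bruhat_stepV v w : bruhat_step S v w -> bruhat_step S v^-1%g w^-1%g.
Proof.
case/andP => /existsP[t /andP[tS /eqP ->]] lt; rewrite /bruhat_step !ellV // lt andbT.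
case/imset2P: tS => x y xS _ ->; apply/existsP; exists (x ^ (y * v^-1))%g.
have xV : (x^-1)%g = x.
  by apply/eqP; rewrite eq_invg_mul -expg2; case: hWS => _ /(_ x xS) <- _; rewrite expg_order.
apply/andP; split; first by apply/imset2P; exists x (y * v^-1)%g; rewrite ?inE.
by rewrite conjgM [(_ ^ v^-1)%g]conjgE invgK mulKg invMg -conjVg xV.
Qed.

Lemma bruhatV v w : bruhat S v^-1%g w^-1%g = bruhat S v w.
Proof.
have V x y : bruhat S x y -> bruhat S x^-1%g y^-1%g.
  case/connectP => p pp ->; elim: p x pp => [|u p IH] x /=; first by move=> _; apply: connect0.
  by case/andP => /bruhat_stepV/connect1 xu /IH; apply: connect_trans.
by apply/idP/idP => /V //; rewrite !invgK.
Qed.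

Lemma bruhat_coverV v w : bruhat_cover S v^-1%g w^-1%g = bruhat_cover S v w.
Proof.
rewrite /bruhat_cover bruhatV (inj_eq invg_inj); congr [&& _, _ & _].
apply/forallP/forallP => h u; have := h u^-1%g.
  by rewrite !bruhatV !(inj_eq invg_inj).
by rewrite -{1}(invgK v) -{1}(invgK w) !bruhatV !(inv_eq invgK).
Qed.

End ChainsAndCovers.

(** * Subsets of positions as bit masks *)

Section CountingSubsets.
Variables (R : realType) (gT : finGroupType) (S : {set gT}).
Import Order.TTheory GRing.Theory Num.Theory.
Local Open Scope ring_scope.

Local Notation n := #|S|.
Local Notation s := (@sgen gT S).
Local Notation pos := (pos_root R S).
Local Notation is_root := (@is_root R gT S).
Local Notation ell := (ell S).
Local Notation chain := (@chain R gT S).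

Hypothesis hWS : coxeter_system S.

Lemma mem_bool_seqs l ms : (ms \in bool_seqs l) = (size ms == l).
Proof.
elim: l ms => [|l IH] ms; first by rewrite inE; case: ms.
rewrite /= cats0 mem_cat.
case: ms => [|b ms]; first by apply/negbTE/negP => /orP[] /mapP[].
rewrite /= eqSS -IH; apply/orP/idP => [[] /mapP[ms' h [_ ->]] //|h].
by case: b; [left|right]; apply/mapP; exists ms.
Qed.

Lemma size_bool_seqs l : size (bool_seqs l) = (2 ^ l)%N.
Proof. by elim: l => //= l IH; rewrite cats0 size_cat !size_map IH expnS mul2n addnn. Qed.

Variable l : nat.

Definition mask_of (J : {set 'I_l}) : seq bool := [seq i \in J | i <- enum 'I_l].

Lemma mask_of_enum : perm_eq (map mask_of (enum {: {set 'I_l}})) (bool_seqs l).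
Proof.
have inj : injective mask_of.
  move=> J K e; apply/setP => i.
  have nthE L : nth false (mask_of L) i = (i \in L).
    by rewrite (nth_map i) -?enumT ?size_enum_ord ?nth_ord_enum.
  by rewrite -!nthE e.
have u : uniq (map mask_of (enum {: {set 'I_l}})) by rewrite map_inj_uniq // enum_uniq.
have sub : {subset map mask_of (enum {: {set 'I_l}}) <= bool_seqs l}.
  by move=> q /mapP[J _ ->]; rewrite mem_bool_seqs size_map size_enum_ord.
have sz : (size (bool_seqs l) <= size (map mask_of (enum {: {set 'I_l}})))%N.
  by rewrite size_bool_seqs size_map -cardE -cardsT -powersetT card_powerset cardsT card_ord.
have [_ e] := uniq_min_size u sub sz.
by apply: uniq_perm => //; apply: leq_size_uniq u sub sz.
Qed.

Lemma mask_mask_of (U : Type) (f : 'I_l -> U) J :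
  mask (mask_of J) [seq f i | i <- enum 'I_l] = [seq f i | i <- enum J].
Proof.
rewrite -map_mask /mask_of -filter_mask; congr map.
by rewrite enumT; apply: eq_filter.
Qed.

Lemma comask_mask_of (U : Type) (f : 'I_l -> U) J :
  mask (map negb (mask_of J)) [seq f i | i <- enum 'I_l] = [seq f i | i <- enum (~: J)].
Proof.
rewrite -mask_mask_of; congr mask; rewrite /mask_of -map_comp.
by apply: eq_map => i; rewrite /= inE.
Qed.

Variable (b : l.-tuple 'I_n).

Lemma omit_prodE (c : l.-tuple 'I_n) J :
  omit_prod c J = wprod s [seq tnth c j | j <- enum (~: J)].
Proof.
by rewrite /omit_prod -big_filter deprecated_filter_index_enum /wprod big_map.
Qed.

Lemma comask_prod J : wprod s (co_mask (mask_of J) b) = omit_prod b J.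
Proof.
by rewrite /co_mask -[X in mask _ X]map_tnth_enum comask_mask_of omit_prodE.
Qed.

Lemma size_comask J : size (co_mask (mask_of J) b) = (l - #|J|)%N.
Proof.
rewrite /co_mask -[X in mask _ X]map_tnth_enum comask_mask_of size_map -cardE.
by rewrite [LHS]cardsCs setCK card_ord.
Qed.

Lemma nth_inv_roots_alpha (j : 'I_l) : nth 0 (inv_roots R b) j = alpha R b j.
Proof.
rewrite /alpha (tnth_nth (tnth b j)); move: (tnth b j) (ltn_ord j) => d.
have := size_tuple b; move: (tval b) (nat_of_ord j) => r.
elim: r l => [|i r IH] l' j0 <- //; case: j0 => [|j0] /= jr.
  by rewrite wprod_nil coxact1.
rewrite (nth_map 0) ?size_inv_roots // (IH (size r)) //.
by rewrite wprod_cons coxactM.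
Qed.

(** By [coxact_pos] a negative root would mean that letter j shortens the prefix before it, against
    reducedness. *)
Lemma alpha_pos w (j : 'I_l) : reduced_expr s w b -> alpha R b j \in positive_roots R S.
Proof.
case/andP => /eqP wb /eqP sb.
have -> : alpha R b j \in positive_roots R S = pos_row (alpha R b j).
  by rewrite mem_pos is_root_coxact // is_root_simple // andbT.
rewrite coxact_pos //; set i := tnth b j.
have e : (val b = take j b ++ i :: drop j.+1 b).
  by rewrite /i (tnth_nth i) -drop_nth ?size_tuple ?ltn_ord // cat_take_drop.
have := wb; rewrite {1}e wprod_cat wprod_cons mulgA => we.
have := ellM hWS (wprod s (take j b) * s i)%g (wprod s (drop j.+1 b)); rewrite we.
rewrite -[Defs.ell S w]sb size_tuple.
have := ell_le (take j b); have := ell_le (drop j.+1 b).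
rewrite size_drop size_tuple size_takel ?size_tuple ?(ltnW (ltn_ord j)) //.
have := ltn_ord j; move: (nat_of_ord j) (wprod s (take j b)) => j0 u.
ell_lia.
Qed.

(** The length of the word is that of w', so the complement of J has the length of v' exactly when J
    has m elements. *)
Lemma count_subsets_chain v w v' w' m (k : 'I_l -> pos) :
  reduced_expr s w' b -> bruhat S v w -> bruhat S v' w' ->
  m = (ell w - ell v)%N -> m = (ell w' - ell v')%N ->
  (forall j, val (k j) = alpha R b j) ->
  (\sum_(ms <- bool_seqs l | (wprod s (co_mask ms b) == v') &&
       (size (co_mask ms b) == ell v'))
     chain w (rev (mask ms [seq k j | j <- enum 'I_l])) v)%N = left_count R b v w v' m.
Proof.
move=> /andP[_ /eqP lb] vw vw' mE mE' kE.
have le1 := bruhat_ell_le vw; have le2 := bruhat_ell_le vw'.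
rewrite -(perm_big _ mask_of_enum) big_map big_enum_cond /=.
rewrite /left_count -sum1dep_card big_mkcond [RHS]big_mkcond /=; apply: eq_bigr => J _.
rewrite comask_prod size_comask mask_mask_of chain_rev //.
rewrite size_tuple in lb; rewrite -/ell in lb.
have leJ : (#|J| <= l)%N by have := max_card J; rewrite card_ord.
have -> : (l - #|J| == ell v')%N = (#|J| == m).
  have lE : l = ell w' by [].
  by move: le2 leJ; rewrite mE' -lE; move: (#|J|) => x; ell_lia.
rewrite [v' == _]eq_sym; case: eqP => _ /=; last by rewrite andbF.
case: eqP => //= Jm; have -> : saturated_chain S v w (left_chain R b v J) =
    upchain v [seq k j | j <- enum J] w.
  rewrite -saturated_upchain //; last first.
    by rewrite size_map -cardE Jm mE subnKC.
  congr saturated_chain; rewrite /left_chain.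
  elim: (enum J) v {vw mE le1} => //= j t IH v.
  by rewrite kE IH.
by case: upchain.
Qed.

End CountingSubsets.

(** * Reversing the reduced word *)

Section Reversal.
Variables (R : realType) (gT : finGroupType) (S : {set gT}).
Local Notation n := #|S|.
Local Notation s := (@sgen gT S).
Local Notation rr := (@root_reflection R gT S).

Hypothesis hWS : coxeter_system S.
Variables (l : nat) (b : l.-tuple 'I_n).

Local Notation rb := (rev_tuple b).

Lemma tnth_rev (j : 'I_l) : tnth rb (rev_ord j) = tnth b j.
Proof.
have jl := ltn_ord j; rewrite [LHS](tnth_nth (tnth b j)) /= nth_rev size_tuple; last by lia.
by rewrite [RHS](tnth_nth (tnth b j)); congr nth; lia.
Qed.

Lemma alpha_rev (j : 'I_l) : alpha R rb (rev_ord j) = alpha' R b j.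
Proof.
rewrite /alpha tnth_rev /alpha' /=; congr (coxact (wprod _ _) _).
by rewrite take_rev size_tuple; congr (rev (drop _ _)); have := ltn_ord j; lia.
Qed.

Lemma rev_enum_ord : rev (enum 'I_l) = [seq rev_ord j | j <- enum 'I_l].
Proof.
apply: (inj_map val_inj); rewrite map_rev -[RHS]map_comp.
have -> : [seq (val \o @rev_ord l) j | j <- enum 'I_l] = [seq (l - i.+1)%N | i <- iota 0 l].
  by rewrite -val_enum_ord -map_comp.
rewrite val_enum_ord; apply: (@eq_from_nth _ 0%N) => [|i].
  by rewrite size_rev size_map.
rewrite size_rev size_iota => il; rewrite nth_rev ?size_iota //.
by rewrite (nth_map 0%N) ?size_iota // !nth_iota; lia.
Qed.

Lemma enum_imset_rev (J : {set 'I_l}) :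
  enum [set rev_ord j | j in J] = rev [seq rev_ord j | j <- enum J].
Proof.
have enumE (A : {set 'I_l}) : enum A = [seq i <- enum 'I_l | i \in A].
  by rewrite [in RHS]enumT; apply: eq_filter.
rewrite (enumE J) (enumE [set _ | _ in _]).
have -> : [seq rev_ord j | j <- [seq i <- enum 'I_l | i \in J]] =
    [seq i <- [seq rev_ord j | j <- enum 'I_l] | rev_ord i \in J].
  by rewrite filter_map; congr map; apply: eq_filter => i; rewrite /= rev_ordK.
rewrite -rev_enum_ord filter_rev revK; apply: eq_filter => i.
by rewrite -{1}(rev_ordK i) mem_imset // ; apply: rev_ord_inj.
Qed.

Lemma reduced_expr_rev w : reduced_expr s w b -> reduced_expr s w^-1%g rb.
Proof.
case/andP => /eqP wb /eqP lb; apply/andP; split.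
  by rewrite /= wprod_rev // wb.
by rewrite size_rev lb -/(ell S w) -/(ell S w^-1%g) ellV.
Qed.

(** Reversing positions is a bijection on subsets that inverts the omitted product and every element
    of the chain; inversion preserves covers. *)
Lemma left_count_rev v w v' m :
  left_count R rb v^-1%g w^-1%g v'^-1%g m = right_count R b v w v' m.
Proof.
rewrite /left_count /right_count -(card_imset _ (imset_inj (@rev_ord_inj l))).
congr #|pred_of_set _|; apply/setP => J.
have imK (A : {set 'I_l}) : [set rev_ord j | j in [set rev_ord j | j in A]] = A.
  rewrite -imset_comp -[RHS]imset_id; apply: eq_imset => j; exact: rev_ordK.
rewrite -{1}(imK J) mem_imset ?inE; last by apply: imset_inj; apply: rev_ord_inj.
rewrite card_imset; last exact: rev_ord_inj.
congr [&& _, _ & _].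
  have -> : omit_prod rb [set rev_ord j | j in J] = (omit_prod b J)^-1%g.
    rewrite !omit_prodE.
    have -> : ~: [set rev_ord j | j in J] = [set rev_ord j | j in ~: J].
      apply/setP => i; rewrite inE -{1 2}(rev_ordK i) !mem_imset ?inE //; exact: rev_ord_inj.
    rewrite enum_imset_rev map_rev -wprod_rev //; congr (wprod _ (rev _)).
    by rewrite -map_comp; apply: eq_map => j; rewrite /= tnth_rev.
  by rewrite (inj_eq invg_inj).
rewrite /left_chain /right_chain enum_imset_rev -map_rev.
have -> : scanl (fun u j => rr (alpha R rb j) * u)%g v^-1%g [seq rev_ord j | j <- rev (enum J)] =
   [seq u^-1%g | u <- scanl (fun u j => u * rr (alpha' R b j))%g v (rev (enum J))].
  elim: (rev (enum J)) v => //= j t IH u; rewrite alpha_rev.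
  have -> : (rr (alpha' R b j) * u^-1 = (u * rr (alpha' R b j))^-1)%g.
    rewrite invMg root_reflectionV // /alpha' is_root_coxact //; exact: is_root_simple.
  by rewrite IH.
rewrite /saturated_chain last_map (inj_eq invg_inj) path_map; congr (_ && _).
by apply: eq_path => x y; apply: bruhat_coverV.
Qed.

End Reversal.

(** * The defining formulas in a tensor model *)

Section Braiding.
Variables (R : realType) (gT : finGroupType) (S : {set gT}).
Import Order.TTheory GRing.Theory Num.Theory.
Local Open Scope ring_scope.

Local Notation n := #|S|.
Local Notation pos := (pos_root R S).
Local Notation act := (@coxact R gT S).
Local Notation rr := (@root_reflection R gT S).
Local Notation is_root := (@is_root R gT S).

Hypothesis hWS : coxeter_system S.

Variables (F : fieldType) (tm : tensor_model F pos).
Local Notation T := (tm_alg tm).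
Local Notation T2 := (tm_sq tm).
Local Notation W := (tm_word tm).
Local Notation letter p := (W [:: p]).
Local Notation ext := (tm_ext (t := tm)).
Local Notation ext2 := (tm_ext2 (t := tm)).
Local Notation X := (@xr R gT S F tm).
Local Notation tact := (@tact R gT S F tm).
Local Notation xroots := (@xroots R gT S F tm).
Local Notation fact := (@fact R gT S F tm).
Local Notation coprd := (@coprd R gT S F tm).

Let extP := basis_extP (tm_basis tm).
Let extW := basis_extW (tm_basis tm).
Let ext2P := basis_extP (tm_basis2 tm).
Let W_ind := basis_ind (tm_basis tm).

Definition brd (i : nat) : T -> T := ext (fun k =>
  if drop i k is [:: p, q & r] then
    W (take i k) * (X (act (rr (val p)) (val q)) * letter p) * W r
  else W k).

Lemma brdP i c x y : brd i (c *: x + y) = c *: brd i x + brd i y.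
Proof. exact: extP. Qed.

Lemma brd0 i : brd i 0 = 0.
Proof. exact: linP0 (brdP i). Qed.

Lemma brd_lettersE p q x :
  brd 0 (letter p * (letter q * x)) = X (act (rr (val p)) (val q)) * (letter p * x).
Proof.
elim/W_ind: x => [|k|c x y IHx IHy]; first by rewrite !mulr0 brd0.
  by rewrite -!W_cons /brd extW /= tm_word_nil mul1r -mulrA -W_cons.
by rewrite !tmulrP brdP IHx IHy.
Qed.

Lemma brd_letter i p x : brd i.+1 (letter p * x) = letter p * brd i x.
Proof.
elim/W_ind: x => [|k|c x y IHx IHy]; first by rewrite !(mulr0, brd0).
  rewrite -!W_cons /brd !extW /=; case: (drop i k) => [|a [|b r]]; first by rewrite W_cons.
    by rewrite W_cons.
  by rewrite W_cons !mulrA.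
by rewrite !tmulrP !brdP IHx IHy tmulrP.
Qed.

Lemma brd_xroots i l : (i.+1 < size l)%N -> all is_root l ->
  brd i (xroots l) = xroots (root_braid i l).
Proof.
have bN j x : brd j (- x) = - brd j x := linPN (brdP j) x.
rewrite /xroots; elim: i l => [|i IH] [|a l] //=.
  case: l => [|b l] // _ /and3P[ra rb rl]; rewrite !big_cons.
  have [p [] ->] := root_cases hWS ra; have [q [] ->] := root_cases hWS rb;
  rewrite ?xroot_valN // ?xroot_val // ?root_reflectionN ?pos_is_root // ?coxactN //;
  rewrite ?xrootN ?is_root_coxact ?pos_is_root // ?(mulNr, mulrN, opprK) ?bN ?opprK;
  by rewrite brd_lettersE ?(mulNr, mulrN, opprK).
rewrite ltnS => il /andP[ra rl]; rewrite !big_cons.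
have [p [] ->] := root_cases hWS ra; rewrite ?xroot_valN // ?xroot_val //.
  by rewrite brd_letter IH.
by rewrite !mulNr bN brd_letter IH.
Qed.

Definition brd_perm (m : nat) (sigma : 'S_m.+1) (a : T) : T :=
  foldr (fun i : 'I_m => brd i) a (redword (@adj_tperm m) sigma).

Lemma brd_permE m (sigma : 'S_m.+1) l : size l = m.+1 -> all is_root l ->
  brd_perm sigma (xroots l) =
  xroots (foldr (fun i : 'I_m => root_braid i) l (redword (@adj_tperm m) sigma)).
Proof.
move=> sl rl; rewrite /brd_perm; elim: (redword _ _) => //= i r ->.
have [sr rr] : size (foldr (fun i : 'I_m => root_braid i) l r) = m.+1 /\
    all is_root (foldr (fun i : 'I_m => root_braid i) l r).
  by elim: r => //= j r [IH1 IH2]; rewrite size_root_braid all_root_braid.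
by rewrite brd_xroots // sr ltnS.
Qed.

Lemma xroots_val k : xroots [seq val p | p <- k] = W k.
Proof.
rewrite /@xroots big_map; elim: k => [|p k IH]; first by rewrite big_nil tm_word_nil.
by rewrite big_cons IH xroot_val // [RHS]W_cons.
Qed.

Definition brd_fact_at (m : nat) (a : T) : T :=
  if m is m'.+1 then \sum_(sigma : 'S_m'.+1) brd_perm sigma a else a.

(** By [brd_xroots] the braiding acts as [root_braid] on lists of roots, to which [sum_redword]
    applies. *)
Lemma brd_fact_atE k : brd_fact_at (size k) (W k) = fact (W k).
Proof.
rewrite fact_W /fact_roots size_map.
case Ek: (size k) => [|m] /=.
  by rewrite (size0nil Ek) tm_word_nil /= big_seq1 /@xroots big_nil.
rewrite -[LHS]/(\sum_(sigma : 'S_m.+1) brd_perm sigma (W k)) -{1}xroots_val.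
rewrite -(sum_redword (V := T) xroots (@root_braid_action R gT S hWS m.+1)); last first.
  by rewrite size_map all_is_root_val.
by apply: eq_bigr => sigma _; rewrite brd_permE ?size_map ?all_is_root_val.
Qed.

Definition root_deg (k : seq pos) : gT := (\prod_(p <- k) rr (val p))%g.

Definition sq_mul (t u : T2) : T2 :=
  ext2 (fun ab => ext2 (fun cd =>
    tns (W ab.1 * tact (root_deg ab.2) (W cd.1)) (W ab.2 * W cd.2)) u) t.

Lemma sq_mul_tns k l a b :
  sq_mul (tns (W k) (W l)) (tns a b) = tns (W k * tact (root_deg l) a) (W l * b).
Proof.
rewrite /sq_mul tns_W (basis_extW (tm_basis2 tm)) /=.
apply: (@lift2_tns R gT S F tm _
  (fun a b => tns (W k * tact (root_deg l) a) (W l * b))).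
by split=> [d c x y|d c x y];
  rewrite ?(tactP, tmulrP) ?(bilinl (tns_bilin tm)) ?(bilinr (tns_bilin tm)).
Qed.

Lemma sq_mulPr t c x y : sq_mul t (c *: x + y) = c *: sq_mul t x + sq_mul t y.
Proof.
rewrite /sq_mul; elim/(basis_ind (tm_basis2 tm)): t => [|k|d u v IHu IHv].
- by rewrite !(linP0 (ext2P _)) scaler0 addr0.
- by rewrite !(basis_extW (tm_basis2 tm)) ext2P.
- by rewrite !ext2P IHu IHv !scalerDr !scalerA [d * c]mulrC addrACA.
Qed.

Lemma sq_mul_letter p t :
  sq_mul (tns (letter p) 1 + tns 1 (letter p)) t = sq_mull p t + sq_mulr p t.
Proof.
elim/tns_ind: t => [|k l|c x y IHx IHy].
- by rewrite sq_mull_0 sq_mulr_0 (linP0 (sq_mulPr _)) addr0.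
- have -> u : sq_mul (tns (letter p) 1 + tns 1 (letter p)) u =
    sq_mul (tns (letter p) 1) u + sq_mul (tns 1 (letter p)) u.
    by rewrite /sq_mul -[tns (letter p) 1]scale1r ext2P !scale1r.
  rewrite -tm_word_nil !sq_mul_tns sq_mull_tns sq_mulr_tns.
  by rewrite /root_deg big_nil big_seq1 tact_id // tm_word_nil !mul1r.
- by rewrite sq_mulPr IHx IHy sq_mull_lin sq_mulr_lin scalerDr addrACA.
Qed.

Lemma coprd_foldr k : foldr (fun p acc =>
    sq_mul (tns (letter p) 1 + tns 1 (letter p)) acc) (tns 1 1) k = coprd (W k).
Proof.
elim: k => [|p k IH] /=; first by rewrite tm_word_nil coprd1.
by rewrite IH sq_mul_letter W_cons coprd_letter.
Qed.

Local Notation s := (@sgen gT S).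
Local Notation sr := (@simple_root R gT S).
Local Notation ell := (ell S).
Local Notation coef := (tm_coef (t := tm)).

Lemma prod_xr_simple r : \prod_(i <- r) X (sr i) = simple_word hWS tm r.
Proof.
rewrite /simple_word; elim: r => [|i r IH]; first by rewrite big_nil tm_word_nil.
by rewrite big_cons IH [RHS]W_cons -xroot_val.
Qed.

(** Only F(x) and F(y) matter, so x may be replaced by the [quotient_elt] of the given word.
    Symmetry then moves F to y, and each term reads off one coefficient of F(y). *)
Lemma pair_sbar_quotient (x y : T) (v w v' w' : gT) m l (b : l.-tuple 'I_n) :
  reduced_expr s w' b -> bruhat S v w -> bruhat S v' w' ->
  m = (ell w - ell v)%N -> m = (ell w' - ell v')%N ->
  (forall k, coef k (fact y) = (chain w k v)%:R) ->
  (forall k, coef k (fact x) = (chain w' k v')%:R) ->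
  pair y (fact (sbar x)) = (left_count R b v w v' m)%:R.
Proof.
move=> hb vw vw' mE mE' hy hx.
have [/eqP wb /eqP lb] := andP hb.
have ex : fact (sbar x) = fact (sbar (quotient_elt hWS tm v' b)).
  apply: (basis_coef_inj (tm_basis tm)) => k.
  by rewrite !coef_fact_sbar // hx coef_fact_quotient_elt // wb.
pose k j : pos := SeqSub (alpha_pos R hWS j hb).
have kE j : val (k j) = alpha R b j by [].
have kinv : [seq val p | p <- [seq k j | j <- enum 'I_l]] = inv_roots R b.
  apply: (@eq_from_nth _ 0) => [|i].
    by rewrite 2!size_map size_enum_ord size_inv_roots size_tuple.
  rewrite 2!size_map size_enum_ord => il.
  have := nth_inv_roots_alpha R hWS b (Ordinal il); rewrite /= => ->.
  rewrite -kE -map_comp (nth_map (Ordinal il)) ?size_enum_ord //=.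
  by congr (ssval (k _)); apply: (nth_ord_enum _ (Ordinal il)).
rewrite ex pair_sym // /quotient_elt.
rewrite -(count_subsets_chain hWS hb vw vw' mE mE' kE) natr_sum size_tuple.
rewrite big_mkcond [RHS]big_mkcond /= !big_seq.
have sb_sum (r : seq (seq bool)) (f : seq bool -> T) :
    pair (sbar (\sum_(ms <- r) f ms)) (fact y) = \sum_(ms <- r) pair (sbar (f ms)) (fact y).
  elim: r => [|ms r IH]; first by rewrite !big_nil sbar0 pair0l.
  by rewrite !big_cons -[f ms]scale1r sbarP pairPl mul1r IH scale1r.
rewrite -!big_seq sb_sum; apply: eq_big_seq => ms; rewrite mem_bool_seqs => /eqP sms.
case: ifP => _; last by rewrite sbar0 pair0l.
rewrite sbar_lfactor ?size_tuple // -kinv; move: [seq k j | j <- enum 'I_l] => q.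
rewrite -map_mask xroots_val pair_W hy.
by [].
Qed.

End Braiding.

(** * The Nichols algebra *)

Section MonoidAlgebra.
Import GRing.Theory.
Local Open Scope ring_scope.

Lemma malg_lin_ind (F : nzRingType) (K : choiceType) (P : {malg F[K]} -> Prop) :
  P 0 -> (forall k, P << k >>) -> (forall c a b, P a -> P b -> P (c *: a + b)) ->
  forall a, P a.
Proof.
move=> P0 Pk Plin a; rewrite (monalgE a).
elim/big_ind: _ => // [x y Px Py|k _]; first by rewrite -[x]scale1r; apply: Plin.
have -> : << a@_k *g k >> = a@_k *: << k >> :> {malg F[K]}.
  by apply/malgP => l; rewrite mcoeffZ !mcoeffU mulrnAr mulr1.
by rewrite -[_ *: _]addr0; apply: Plin.
Qed.

Lemma lin_ext_mono (F : nzRingType) (K : choiceType) (M : lmodType F) (f : K -> M) k :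
  lin_ext f << k >> = f k.
Proof.
rewrite (@lin_extEw _ _ _ _ _ [fset k]%fset) ?msuppU_le //.
by rewrite big_seq_fset1 mcoeffUU scale1r.
Qed.

Section Product.
Variables (F : comNzRingType) (K : monomType).
Implicit Types (c d : F) (a b : {malg F[K]}).

Lemma malg_monoM (k l : K) c d :
  << c *g k >> * << d *g l >> = << (c * d) *g mmul k l >> :> {malg F[K]}.
Proof. exact: fgmulUU. Qed.

Lemma malg_scale_mono c d (k : K) :
  c *: << d *g k >> = << (c * d) *g k >> :> {malg F[K]}.
Proof. by apply/malgP => l; rewrite mcoeffZ !mcoeffU mulrnAr. Qed.

Lemma malg_scaleAr c a b : a * (c *: b) = c *: (a * b).
Proof.
elim/malg_lin_ind: a => [|k|d x y IHx IHy]; first by rewrite !mul0r scaler0.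
  elim/malg_lin_ind: b c => [|l|d x y IHx IHy] c.
  - by rewrite scaler0 mulr0 scaler0.
  - by rewrite malg_scale_mono !malg_monoM malg_scale_mono !mulr1 mul1r.
  - by rewrite scalerDr !mulrDr IHy IHx scalerA IHx scalerDr scalerA.
by rewrite !mulrDl IHy -!scalerAl IHx scalerDr !scalerA [c * d]mulrC.
Qed.

End Product.

Lemma eq_lin_ext (F : nzRingType) (K : choiceType) (M : lmodType F) (f g : K -> M) a :
  f =1 g -> lin_ext f a = lin_ext g a.
Proof. by move=> fg; apply: eq_bigr => k _; rewrite fg. Qed.

Lemma eq_foldr (I X : Type) (f g : I -> X -> X) (r : seq I) x :
  (forall i, f i =1 g i) -> foldr f x r = foldr g x r.
Proof. by move=> fg; elim: r => //= i r ->; rewrite fg. Qed.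

Section WordBasis.
Variables (F : fieldType) (I : choiceType).

Lemma malg_word_basis : is_basis (fun k : seq I => << FMonom k >> : {malg F[{fmonom I}]})
  (fun k x => x@_(FMonom k)) (fun N f => lin_ext (fun k : {fmonom I} => f k)).
Proof.
split=> [P P0 PW Plin|k c x y|k l|x y h|N f c x y|N f k].
- by apply: malg_lin_ind => // -[k].
- by rewrite mcoeffD mcoeffZ.
- by rewrite mcoeffU1; congr (nat_of_bool _)%:R; apply: fmP.
- by apply/malgP => -[k].
- exact: linearP.
- by rewrite lin_ext_mono.
Qed.

Lemma malg_word_basis2 :
  is_basis (fun kl : seq I * seq I => << (FMonom kl.1, FMonom kl.2) >> :
      {malg F[({fmonom I} * {fmonom I})%type]})
    (fun kl x => x@_(FMonom kl.1, FMonom kl.2))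
    (fun N f => lin_ext (fun kl : {fmonom I} * {fmonom I} => f (kl.1 : seq I, kl.2 : seq I))).
Proof.
split=> [P P0 PW Plin|k c x y|k l|x y h|N f c x y|N f k].
- by apply: malg_lin_ind => // -[[k] [l]]; apply: (PW (k, l)).
- by rewrite mcoeffD mcoeffZ.
- by rewrite mcoeffU; case: k l => [k1 k2] [l1 l2].
- by apply/malgP => -[[k] [l]]; apply: (h (k, l)).
- exact: linearP.
- by rewrite lin_ext_mono; case: k.
Qed.

Lemma malg_word_nil : << FMonom [::] >> = 1 :> {malg F[{fmonom I}]}.
Proof.
apply/malgP => x; rewrite mcoeff1 mcoeffU1 eq_sym; congr (_ == _)%:R.
by apply/eqP; rewrite fmP fm1.
Qed.

Lemma malg_word_cat (k l : seq I) :
  << FMonom (k ++ l) >> = << FMonom k >> * << FMonom l >> :> {malg F[{fmonom I}]}.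
Proof.
rewrite malg_monoM mulr1; congr << _ *g _ >>.
by apply/eqP; rewrite fmP fmM.
Qed.

End WordBasis.

End MonoidAlgebra.

(** * Identification with the concrete tensor algebra *)

Section Concrete.
Variables (R : realType) (gT : finGroupType) (S : {set gT}).
Import Order.TTheory GRing.Theory Num.Theory.
Local Open Scope ring_scope.

Local Notation C := (complex R).
Local Notation pos := (pos_root R S).
Local Notation is_root := (@is_root R gT S).

Definition nichols_model : tensor_model (C : fieldType) pos :=
  @TensorModel _ _ (tensor_alg R S) (tensor2 R S) _ _ _ _ _ _
    (malg_word_basis C pos) (malg_word_basis2 C pos)
    (malg_word_nil C pos) (@malg_word_cat C pos) (@malg_scaleAr C _).

Local Notation tm := nichols_model.
Local Notation T := (tm_alg tm).
Local Notation T2 := (tm_sq tm).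
Local Notation W := (tm_word tm).
Local Notation letter p := (W [:: p]).
Local Notation anti := (@anti R gT S _ tm).

Hypothesis hWS : coxeter_system S.

Lemma braidE i (x : T) : braid i x = brd i x.
Proof. by apply: eq_lin_ext => -[k]. Qed.

Lemma braided_factE (x : T) : braided_fact x = fact x.
Proof.
apply: eq_lin_ext => -[k]; refine (etrans _ (etrans (brd_fact_atE hWS tm k) (fact_W tm k))).
have permE m (sigma : 'S_m.+1) (y : T) : braid_perm sigma y = brd_perm sigma y.
  exact (eq_foldr _ _ (fun (i : 'I_m) x => braidE i x)).
have atE m (y : T) : braided_fact_at m y = brd_fact_at m y.
  case: m => [|m]; first exact: erefl.
  exact (eq_bigr _ (fun sigma _ => permE m sigma y)).
exact (atE (size k) (W k)).
Qed.

Lemma tensE (x y : T) : tens x y = tns x y.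
Proof.
refine (eq_lin_ext _ (fun k => _)); refine (eq_lin_ext _ (fun l => _)).
by destruct k; destruct l.
Qed.

Lemma tmulE (t u : T2) : tmul t u = sq_mul t u.
Proof.
refine (eq_lin_ext _ (fun k => _)); refine (eq_lin_ext _ (fun l => _)).
by destruct k as [[k] [k']], l as [[l] [l']]; exact: tensE.
Qed.

Lemma coprodE (x : T) : coprod x = coprd x.
Proof.
apply: eq_lin_ext => -[k].
have := coprd_foldr hWS tm k; rewrite /@coprd (basis_extW (tm_basis tm)) => <-.
refine (etrans (congr1 (fun z => foldr _ z _) (tensE 1 1)) _).
refine (eq_foldr _ _ (fun p t => _)).
refine (etrans (congr1 (fun z => tmul z t) (_ : _ = (tns (letter p) 1 + tns 1 (letter p) : T2))) (tmulE _ t)).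
exact (f_equal2 (fun x y : T2 => x + y) (tensE _ _) (tensE _ _)).
Qed.

Lemma convolE (f g : T -> T) (x : T) : convol f g x = conv f g (coprd x).
Proof.
rewrite -coprodE /convol.
by apply: eq_lin_ext => -[[k] [l]].
Qed.

Lemma is_antipode_anti : is_antipode (anti : T -> T).
Proof.
split=> [c x y|x|x]; first exact (@antiP R gT S _ tm c x y).
- exact (etrans (convolE anti id x) (@conv_anti_id R gT S hWS _ tm x)).
- exact (etrans (convolE id anti x) (@conv_id_anti R gT S _ tm x)).
Qed.

(** [antipode] is a choice: [is_antipode_anti] shows that there is something to choose,
    [conv_id_inj] that it is unique. *)
Lemma antipodeE (x : T) : antipode x = anti x.
Proof.
have [fP _ fid] : is_antipode (antipode (R := R) (S := S)).
  exact: (classical_sets.xgetPex _ (ex_intro _ _ is_antipode_anti)).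
exact (@conv_id_inj R gT S _ tm _ fP (fun y => etrans (esym (convolE id _ y)) (fid y)) x).
Qed.

Lemma sbar_tensorE (x : T) : sbar_tensor x = sbar x.
Proof.
apply: eq_lin_ext => -[k].
have := sbar_anti hWS tm k; rewrite -antipodeE.
rewrite /@sbar (basis_extW (tm_basis tm)) => <-.
by [].
Qed.

Lemma ev_wordE (k l : seq pos) :
  ev_word (FMonom k : word R S) (FMonom l) = (FMonom l == FMonom (rev k) :> word R S)%:R :> C.
Proof.
rewrite fmP /= /ev_word /=; case: eqP => [skl|nkl]; last first.
  by case: eqP => // e; case: nkl; rewrite e size_rev.
rewrite -(inj_eq (inv_inj revK)) revK eq_sym.
have : size k = size (rev l) by rewrite size_rev.
move: (rev l) => q; elim: k {skl} q => [|p k IH] [|p' q] //=; first by rewrite big_nil.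
by case=> /IH {}IH; rewrite big_cons IH eqseq_cons -natrM mulnb.
Qed.

Lemma evE (y z : T) : ev y z = pair y z.
Proof.
rewrite /ev /@pair /= /lin_ext; apply: eq_bigr => -[k] _.
rewrite (eq_bigr (fun l => y@_(FMonom k) * (z@_l * (l == FMonom (rev k))%:R))); last first.
  by move=> [l] _; rewrite ev_wordE mulrA.
rewrite -big_distrr /=; congr (_ * _).
have [h|h] := boolP (FMonom (rev k) \in msupp z).
  rewrite (big_rem _ h) /= eqxx mulr1 big_seq big1 ?addr0 // => l.
  rewrite mem_rem_uniq ?fset_uniq // !inE => /andP[/negPf -> _].
  by rewrite mulr0.
rewrite (mcoeff_outdom h) big_seq big1 // => l lz.
have [e|_] := eqVneq l _; last by rewrite mulr0.
by rewrite -e lz in h.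
Qed.

End Concrete.

Section QuotientTheory.
Import GRing.Theory.
Local Open Scope ring_scope.
Variables (U : zmodType) (I : zmodClosed U).

Lemma quot_eqP (x y : U) :
  \pi_(Quotient.quot I)%qT x = \pi_(Quotient.quot I)%qT y <-> x - y \in I.
Proof. by rewrite Quotient.idealrBE; split=> [->|/eqP]. Qed.

Lemma quot_repr (x : U) :
  generic_quotient.repr (\pi_(Quotient.quot I)%qT x) - x \in I.
Proof. by apply/quot_eqP; rewrite generic_quotient.reprK. Qed.

Lemma quot_sum (J : Type) (r : seq J) (P : pred J) (f : J -> U) :
  \pi_(Quotient.quot I)%qT (\sum_(i <- r | P i) f i) =
  \sum_(i <- r | P i) \pi_(Quotient.quot I)%qT (f i).
Proof.
apply: (big_morph (\pi_(Quotient.quot I)%qT : U -> Quotient.quot I)).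
  by move=> x y; rewrite Quotient.pi_add.
by apply/esym; rewrite !generic_quotient.piE.
Qed.

End QuotientTheory.

(** * The elements x_{w/v} and the invariant *)

Section QuotientElements.
Variables (R : realType) (gT : finGroupType) (S : {set gT}).
Import Order.TTheory GRing.Theory Num.Theory.
Local Open Scope ring_scope.

Local Notation n := #|S|.
Local Notation C := (complex R).
Local Notation tm := (nichols_model R S).
Local Notation T := (tm_alg tm).
Local Notation T2 := (tm_sq tm).
Local Notation s := (@sgen gT S).
Local Notation ell := (ell S).
Local Notation fact := (@fact R gT S _ tm).
Local Notation fact2 := (@fact2 R gT S _ tm).
Local Notation coprd := (@coprd R gT S _ tm).
Local Notation tns_sum := (@tns_sum R gT S _ tm).
Local Notation tns := (@tns R gT S _ tm).
Local Notation coef := (tm_coef (t := tm)).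
Local Notation coef2 := (tm_coef2 (t := tm)).
Local Notation nrepr := (@nrepr R gT S).
Local Notation B := (nichols R S).

Hypothesis hWS : coxeter_system S.

Lemma nichols_kerE (x : T) : (x \in nichols_ker (R := R) (S := S)) = (fact x == 0).
Proof. by rewrite -(braided_factE hWS). Qed.

Lemma nichols_kerP (x : T) : x \in nichols_ker (R := R) (S := S) <-> fact x = 0.
Proof. by rewrite nichols_kerE; split=> /eqP. Qed.

Lemma tens_sumE (r : seq (T * T)) : \sum_(p <- r) tens p.1 p.2 = tns_sum r.
Proof. exact (eq_bigr _ (fun p _ => tensE p.1 p.2)). Qed.

Lemma nichols2_kerP (t : T2) : t \in nichols2_ker (R := R) (S := S) <-> fact2 t = 0.
Proof.
split=> [/asboolP[r [hr e]]|/fact2_kerP[r [hr e]]].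
  apply/fact2_kerP; exists r; split; last exact (etrans e (tens_sumE r)).
  by move=> p /hr[] /nichols_kerP h; [left|right].
apply/asboolP; exists r; split; last exact (etrans e (esym (tens_sumE r))).
by move=> p /hr[] h; [left|right]; apply/nichols_kerP.
Qed.

Lemma fact_nrepr (x : T) : fact (nrepr (nclass x)) = fact x.
Proof.
apply/eqP; rewrite -subr_eq0 -fact_B -nichols_kerE; exact: quot_repr.
Qed.

Lemma fact_xelt v : fact (nrepr (xelt R S v)) = fact (simple_word hWS tm (redword s v)).
Proof. by rewrite -prod_xr_simple; exact: fact_nrepr. Qed.

Lemma coef_fact_xelt v l : coef l (fact (nrepr (xelt R S v))) = (chain v l 1%g)%:R.
Proof.
have [rv sv] := redwordP (coxeter_word hWS) v.
by rewrite fact_xelt coef_fact_simple_word rv sv eqxx.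
Qed.

(** The defining equation holds in the quotient exactly when F (x) F kills the difference of its
    sides, and F maps x_w and x_v to sums of chains to 1. *)
Lemma is_xdiv_fact w (X : gT -> B) : is_xdiv w X <->
  (forall k l, (chain w (k ++ l) 1%g)%:R =
     \sum_(v | bruhat S v w) coef k (fact (nrepr (X v))) * (chain v l 1%g)%:R :> C) /\
  (forall v, ~~ bruhat S v w -> X v = 0).
Proof.
have sumE : \sum_(v | bruhat S v w) ntens (X v) (xelt R S v) =
    nclass2 (\sum_(v | bruhat S v w) tens (nrepr (X v)) (nrepr (xelt R S v))).
  by rewrite /nclass2 quot_sum.
have coefE k l : coef2 (k, l) (fact2 (coprod (nrepr (xelt R S w)) -
      \sum_(v | bruhat S v w) tens (nrepr (X v)) (nrepr (xelt R S v)) : T2)) =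
    (chain w (k ++ l) 1%g)%:R -
     \sum_(v | bruhat S v w) coef k (fact (nrepr (X v))) * (chain v l 1%g)%:R.
  have hs : \sum_(v | bruhat S v w) tens (nrepr (X v)) (nrepr (xelt R S v)) =
      \sum_(v | bruhat S v w) tns (nrepr (X v)) (nrepr (xelt R S v)).
    exact (eq_bigr _ (fun v _ => tensE (nrepr (X v)) (nrepr (xelt R S v)))).
  refine (etrans (congr1 (fun t => coef2 (k, l) (fact2 t)) (f_equal2 (fun t u : T2 => t - u) (coprodE hWS _) hs)) _).
  refine (etrans (@coef2_fact2_coprd_sub _ _ _ hWS _ tm k l _ _ _ _ _) _).
  rewrite coef_fact_xelt.
  suff -> : \sum_(v | bruhat S v w) coef k (fact (nrepr (X v))) * coef l (fact (nrepr (xelt R S v))) =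
    \sum_(v | bruhat S v w) coef k (fact (nrepr (X v))) * (chain v l 1%g)%:R by [].
  by apply: eq_bigr => v _; rewrite coef_fact_xelt.
split=> -[h h0]; split=> //.
  move=> k l; apply/eqP; rewrite -subr_eq0 -coefE.
  move: h; rewrite sumE => /quot_eqP/nichols2_kerP ->.
  by rewrite coef2_0.
rewrite sumE; apply/quot_eqP/nichols2_kerP/fact2_coef0 => k l.
by rewrite coefE h subrr.
Qed.

(** [quotient_elt] provides a solution, so the chosen family is one. Taking for l a chain from v to
    1 isolates the term of v and determines its image under F. *)
Lemma xdiv_fact w v k : bruhat S v w ->
  coef k (fact (nrepr (xdiv R S w v))) = (chain w k v)%:R.
Proof.
have [X hX] : exists X, is_xdiv (R := R) (S := S) w X.
  pose q v := quotient_elt hWS tm v (redword s w).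
  have [rw sw] := redwordP (coxeter_word hWS) w.
  exists (fun v => if bruhat S v w then nclass (q v) else 0).
  apply/is_xdiv_fact; split=> [k' l|u /negPf -> //].
  rewrite chain_catE [RHS]big_mkcond; apply: eq_bigr => u _; case: ifP => uw.
    by rewrite uw fact_nrepr coef_fact_quotient_elt ?rw.
  case: (boolP (chain w k' u)) => [/(chain_bruhat hWS)|_]; first by rewrite uw.
  by rewrite mul0r.
have := classical_sets.xgetPex ((fun=> 0) : gT -> B) (ex_intro _ X hX).
rewrite -/(xdiv R S w) => /is_xdiv_fact[h _] vw.
have [l vl] := chain_to1 R hWS v.
have := h k l.
rewrite (@sum_chain_to1 _ _ _ _ (fun u => bruhat S u w)
  (fun u => coef k (fact (nrepr (xdiv R S w u)))) v l vw vl).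
rewrite chain_catE => <-.
by rewrite (@sum_chain_to1 _ _ _ _ predT (fun u => (chain w k u)%:R) v).
Qed.

Lemma cdiv_left_count (v w v' w' : gT) m l (b : l.-tuple 'I_n) :
  bruhat S v w -> bruhat S v' w' ->
  m = (ell w - ell v)%N -> m = (ell w' - ell v')%N -> reduced_expr s w' b ->
  cdiv R S w v w' v' = (left_count R b v w v' m)%:R.
Proof.
move=> vw vw' mE mE' hb.
have hy k := xdiv_fact k vw; have hx k := xdiv_fact k vw'.
rewrite -(pair_sbar_quotient hWS (tm := tm) hb vw vw' mE mE' hy hx).
rewrite /cdiv /pairing /pairing_tensor /nsbar.
refine (etrans (evE _ _) _).
refine (congr1 (@pair R gT S _ tm (nrepr (xdiv R S w v))) _).
refine (etrans (braided_factE hWS _) (etrans (fact_nrepr _) _)).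
exact (congr1 fact (sbar_tensorE hWS _)).
Qed.

End QuotientElements.

Theorem theorem9p1 (R : realType) (gT : finGroupType) (S : {set gT})
    (hWS : coxeter_system S)
    (v w v' w' : gT) (m : nat)
    (hvw : bruhat S v w) (hvw' : bruhat S v' w')
    (hdeg : (w * v^-1 = w' * v'^-1)%g)
    (hm : m = ell S w - ell S v) (hm' : m = ell S w' - ell S v')
    (l : nat) (b : l.-tuple 'I_#|S|)
    (hb : reduced_expr (@sgen gT S) w' b) :
  [/\ cdiv R S w v w' v' = ((left_count R b v w v' m)%:R)%R,
      cdiv R S w^-1%g v^-1%g w'^-1%g v'^-1%g
        = ((right_count R b v w v' m)%:R)%R
    & forall (l2 : nat) (b2 : l2.-tuple 'I_#|S|),
        reduced_expr (@sgen gT S) w' b2 ->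
        left_count R b2 v w v' m = left_count R b v w v' m /\
        right_count R b2 v w v' m = right_count R b v w v' m].
Proof.
have leftE l2 (b2 : l2.-tuple 'I_#|S|) (hb2 : reduced_expr (@sgen gT S) w' b2) :=
  cdiv_left_count R hWS hvw hvw' hm hm' hb2.
have rightE l2 (b2 : l2.-tuple 'I_#|S|) (hb2 : reduced_expr (@sgen gT S) w' b2) :
    cdiv R S w^-1%g v^-1%g w'^-1%g v'^-1%g = ((right_count R b2 v w v' m)%:R)%R.
  rewrite -(left_count_rev R hWS).
  apply: (cdiv_left_count R hWS); rewrite ?bruhatV ?ellV //.
  exact: reduced_expr_rev.
split=> [||l2 b2 hb2]; [exact: leftE | exact: rightE | split].
  (* Both counts equal an invariant that does not mention the expression, and natural numbers embed
     into the complex numbers. *)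
  apply/eqP; rewrite -(Num.Theory.eqr_nat (complex R)).
  by rewrite -(leftE _ _ hb2) -(leftE _ _ hb).
apply/eqP; rewrite -(Num.Theory.eqr_nat (complex R)).
by rewrite -(rightE _ _ hb2) -(rightE _ _ hb).
Qed.
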